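(* For every $\alpha\in(0,1)$ there exists a stationary Gaussian process $f$ on $\mathbb{R}$, with spectral measure $\mu$ satisfying $\lim_{\delta\to0}\frac{\log\mu[B(\delta)]}{\log\delta}=\alpha$, for which the following property fails: for every $\epsilon>0$, $\mathrm{Cap}_f(B(T+T^{1-\epsilon}))\sim\mathrm{Cap}_f(B(T))$ as $T\to\infty$.
   Context: A stationary Gaussian process on $\mathbb{R}$ here means a continuous, centred, non-degenerate, stationary Gaussian process $f$ with covariance kernel $K(x)=\mathbb{E}[f(0)f(x)]$. Its spectral measure $\mu$ is the unique non-negative, finite, symmetric measure on $\mathbb{R}$ with $K=\mathcal{F}[\mu]$, where $\mathcal{F}[\mu](x)=\int e^{-2\pi i\lambda x}d\mu(\lambda)$. $B(r)=[-r,r]$. Capacity: for compact $D$, $$\mathrm{Cap}_f(D)=\Big(\min_{\nu\in\mathcal{P}(D)}\int_D\int_DK(x-y)\,d\nu(x)\,d\nu(y)\Big)^{-1}\in(0,\infty],$$ where $\mathcal{P}(D)$ is the set of Borel probability measures on $D$. $a(T)\sim b(T)$ means $a(T)/b(T)\to1$. *)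

(* Defs.v *)
From HB Require Import structures.
From mathcomp Require Import all_boot all_order all_algebra.
From mathcomp Require Import complex.
From mathcomp Require Import all_classical all_reals all_analysis.

Set Implicit Arguments.
Unset Strict Implicit.
Unset Printing Implicit Defensive.

Import Order.TTheory GRing.Theory Num.Theory.
Import numFieldNormedType.Exports.

Local Open Scope classical_set_scope.
Local Open Scope ring_scope.

Section GaussianProcess.
Context {d : measure_display} {Omega : measurableType d} {R : realType}.
Variable P : probability Omega R.
Implicit Types f : R -> {RV P >-> R}.

Definition lin_comb f n (t c : 'I_n -> R) : Omega -> R :=
  fun w => \sum_(i < n) c i * f (t i) w.

(* normal_prob m 0 is a junk value (the uniform law on [0, 1]); the Gaussian
   law of variance 0 is the Dirac mass. *)
Definition gaussian_law (m s : R) (A : set R) : \bar R :=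
  if s == 0 then \d_m A else normal_prob m s A.

Definition gaussian_rv (X : Omega -> R) : Prop :=
  exists m s : R, forall A : set R, measurable A ->
    pushforward P X A = gaussian_law m s A.

Definition gaussian_process f : Prop :=
  forall n (t c : 'I_n -> R), gaussian_rv (lin_comb f t c).

Definition continuous_process f : Prop :=
  forall w, continuous (fun t : R => f t w).

Definition centred_process f : Prop := forall t, ('E_P[f t] = 0)%E.

(* The vector (f t_0, ..., f t_{n-1}) has an invertible covariance matrix
   whenever the t_i are distinct; n = 1 says that 'V_P[f t] > 0. *)
Definition nondegenerate_process f : Prop :=
  forall n (t c : 'I_n -> R), injective t -> (exists i, c i != 0) ->
    (0 < 'V_P[lin_comb f t c])%E.

Definition fin_dim_law f n (t : 'I_n -> R) : set (n.-tuple R) -> \bar R :=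
  pushforward P (fun w => [tuple f (t i) w | i < n]).

Definition stationary_process f : Prop :=
  forall n (t : 'I_n -> R) (h : R) (A : set (n.-tuple R)), measurable A ->
    fin_dim_law f (fun i => t i + h) A = fin_dim_law f t A.

Record stationary_gaussian_process f : Prop := StationaryGaussianProcess {
  sgp_gaussian : gaussian_process f;
  sgp_centred : centred_process f;
  sgp_stationary : stationary_process f;
  sgp_continuous : continuous_process f;
  sgp_nondegenerate : nondegenerate_process f }.

Definition cov_kernel f (x : R) : R := fine 'E_P[(f 0 \* f x)%R]%E.

End GaussianProcess.

Section SpectralMeasure.
Context {R : realType}.
Implicit Types (mu : {finite_measure set R -> \bar R}) (K : R -> R).

Definition cexpi (theta : R) : R[i] := (cos theta +i* sin theta)%C.

(* R[i] carries no measure-theoretic integral: complex-valued functions are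
   integrated componentwise. *)
Definition cintegral mu (g : R -> R[i]) : R[i] :=
  ((\int[mu]_l complex.Re (g l)) +i* (\int[mu]_l complex.Im (g l)))%C.

Definition fourier mu (x : R) : R[i] :=
  cintegral mu (fun l => cexpi (- (2 * pi * l * x))).

Definition symmetric_measure mu : Prop :=
  forall A : set R, measurable A -> mu (-%R @^-1` A) = mu A.

Definition spectral_measure K mu : Prop :=
  symmetric_measure mu /\ forall x, (K x)%:C%C = fourier mu x.

End SpectralMeasure.

Section Capacity.
Context {R : realType}.
Implicit Types (K : R -> R) (D : set R).

Definition centred_itv (r : R) : set R := `[- r, r]%classic.

Definition energy K D (nu : probability R R) : \bar R :=
  (\int[nu]_(x in D) \int[nu]_(y in D) (K (x - y))%:E)%E.

(* Borel probability measures on D are those nu on R with nu D = 1. For D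
   compact and K a continuous covariance kernel the infimum is a minimum; the
   inverse in \bar R satisfies 0^-1 = +oo. *)
Definition capacity K D : \bar R :=
  ((ereal_inf [set energy K D nu | nu in
      [set nu : probability R R | nu D = 1%E]])^-1)%E.

(* In \bar R, +oo / +oo = 0: an infinite value of b T is not compared with
   one of a T. *)
Definition asymp_equiv (a b : R -> \bar R) : Prop :=
  (a T / b T)%E @[T --> +oo%R] --> 1%E.

End Capacity.

(* Main.v *)
(* Let S_n = 3^(p n^2) with p alpha >= 4. The spectral measure is atomic: for
   each n, i <= n^2 and k < 2^i it has mass S_n^(-alpha) 2^(-i) spread over the
   points +/- (2k+1) / (2 S_n). Level n has mass (n^2+1) S_n^(-alpha), which
   decays superexponentially, so that the exponent at 0 is alpha. All
   frequencies of levels <= n are odd multiples of 1 / (2 S_n), so the kernel of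
   these levels changes sign under translation by S_n, and the measure with two
   equal atoms at +/- S_n / 2 only sees the levels > n: its energy is smaller
   than S_n^(-alpha) by a factor superpolynomial in n. On the slightly shorter
   interval of radius T = S_n / 2 - S_n 2^(-n^2), on the contrary, a positive
   combination of the functions (-1)^k cos (2 pi (2k+1) x / (2 S_n)) of level n
   is at least 1/4, so by Cauchy-Schwarz every probability measure has energy at
   least S_n^(-alpha) / (16 (n^2+1)). As S_n 2^(-n^2) <= T^(1-eps) for small
   eps, the capacity at least doubles between T and T + T^(1-eps).

   The process is the random Fourier series sum_j a_j (xi_j cos (2 pi l_j t) +
   eta_j sin (2 pi l_j t)) with i.i.d. Gaussian coefficients and summable a_j.
   A time shift rotates the pairs (xi_j, eta_j), so stationarity follows from
   the rotation invariance of the Gaussian law of the plane. The coefficients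
   are obtained from a uniform variable by splitting its binary digits. *)

Require Import Defs.
From HB Require Import structures.
From mathcomp Require Import all_boot all_order all_algebra.
From mathcomp Require Import complex.
From mathcomp Require Import all_classical all_reals all_analysis.
From mathcomp Require Import measurable_realfun.
From mathcomp Require Import ring lra zify.

Set Implicit Arguments.
Unset Strict Implicit.
Unset Printing Implicit Defensive.

Import Order.TTheory GRing.Theory Num.Theory.
Import numFieldNormedType.Exports.

Local Open Scope classical_set_scope.
Local Open Scope ring_scope.

(** * Laws on the real line and binary digits *)

(** The growth of [S_n] meets two opposite demands. As log S_(n+1) / log S_n tends to 1, the
    behaviour of [mu] between consecutive scales does not disturb the exponent. As S_(n+1) / S_n =
    3^(p(2n+1)) is unbounded, the mass above level n is smaller than that of level n by a factor
    that absorbs the loss n^2 + 1. All cosines of level n vanish at S_n / 2. Detecting a measure at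
    distance S_n 2^(-n^2) from that node takes frequencies up to about 2^(n^2) / S_n. Grouping them
    in dyadic blocks of equal mass makes the loss in Cauchy-Schwarz the number of blocks, not the
    number of atoms. The condition p alpha >= 4 means S_1^(-alpha/2) <= 1/9. Level n has fewer than
    2^(n^2+1) atoms, each of amplitude at most a constant times S_n^(-alpha/2), so the amplitudes,
    and not only the masses, are summable. With an atomic spectrum, non-degeneracy needs an
    argument: high levels contain arbitrarily long arithmetic progressions of frequencies, and an
    exponential sum with n distinct nodes cannot vanish along n consecutive terms of a fine enough
    progression. *)

Lemma measurable_preimageT d d' (T : measurableType d) (T' : measurableType d')
    (f : T -> T') (A : set T') :
  measurable_fun setT f -> measurable A -> measurable (f @^-1` A).
Proof. by move=> mf mA; rewrite -[X in measurable X]setTI; exact: mf. Qed.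

Lemma measure_eq_cdf (R : realType) (m1 m2 : {measure set R -> \bar R}) :
  (m1 setT < +oo)%E -> (m2 setT < +oo)%E ->
  (forall x, m1 `]-oo, x]%classic = m2 `]-oo, x]%classic) ->
  forall A, measurable A -> m1 A = m2 A.
Proof.
move=> f1 f2 m12 A mA.
apply: (measure_unique (@ocitv R) (fun n => `](- n%:R), n%:R]%classic)) => //.
- exact: ocitvI.
- by move=> n; exact: is_ocitv.
- by rewrite bigcup_itvT.
- move=> _ [[a b] _ <-] /=.
  have [ab|ba] := ltP a b; last by rewrite set_itv_ge ?measure0 // bnd_simp -leNgt.
  have -> : `]a, b]%classic = `]-oo, b]%classic `\` `]-oo, a]%classic.
    by rewrite -[RHS]setCK setCD setCitvl setUC -[LHS]setCK setCitv.
  have lt_oo (m : {measure set R -> \bar R}) x :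
      (m setT < +oo)%E -> (m `]-oo, x]%classic < +oo)%E.
    by apply: le_lt_trans; apply: le_measure; rewrite ?inE.
  have sub : `]-oo, a]%classic `<=` `]-oo, b]%classic.
    by move=> x; rewrite /= !in_itv/= => /le_trans; apply; exact: ltW.
  rewrite !measureD ?lt_oo // !setIidr //.
  congr (_ - _)%E; exact: m12.
- by move=> k; apply: le_lt_trans f1; apply: le_measure; rewrite ?inE.
Qed.

Lemma probability_eq_cdf (R : realType) (p q : probability R R) :
  (forall x, p `]-oo, x]%classic = q `]-oo, x]%classic) ->
  forall A, measurable A -> p A = q A.
Proof.
move=> pq A mA.
have f (r : probability R R) : (r setT < +oo)%E by rewrite probability_setT ltry.
exact: (measure_eq_cdf (f p) (f q) pq).
Qed.

Definition image_measure d d' (T : measurableType d) (T' : measurableType d')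
    (R : realType) (m : {measure set T -> \bar R}) (f : T -> T')
    (mf : measurable_fun setT f) : {measure set T' -> \bar R} :=
  measure_function_pushforward__canonical__measure_function_Measure m mf.

Definition image_probability d d' (T : measurableType d) (T' : measurableType d')
    (R : realType) (P : probability T R) (f : T -> T')
    (mf : measurable_fun setT f) : probability T' R :=
  distribution P (mfun_Sub (mem_set mf)).

Lemma image_probabilityE d d' (T : measurableType d) (T' : measurableType d')
    (R : realType) (P : probability T R) (f : T -> T')
    (mf : measurable_fun setT f) A : image_probability P mf A = P (f @^-1` A).
Proof. by []. Qed.

(** The factor [c] serves independence: for the restriction of [unif] to an event of probability
    [c], the conclusion says that [f] has law [p] and is independent of that event. *)
Lemma measure_preimage_eq_cdf d (T : measurableType d) (R : realType)
    (m : {measure set T -> \bar R}) (f : T -> R) (c : {nonneg R})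
    (p : probability R R) :
  measurable_fun setT f -> (m setT < +oo)%E ->
  (forall x, m (f @^-1` `]-oo, x]) = c%:num%:E * p `]-oo, x]%classic)%E ->
  forall A, measurable A -> m (f @^-1` A) = (c%:num%:E * p A)%E.
Proof.
move=> mf moo mp A mA.
apply: (@measure_eq_cdf R (image_measure m mf) (mscale c p)) => //.
by rewrite /= /mscale /= probability_setT mule1 ltry.
Qed.

(** * The uniform law and its first binary digit *)

Section uniform01.
Context {R : realType}.

(** The identity transports laws from [measurableTypeR R], where [uniform_prob] lives, to [R] with
    its own measurable structure. *)
Let idR : measurableTypeR R -> R := idfun.

Let measurable_idR : measurable_fun setT idR.
Proof. by move=> _ A mA; rewrite setTI. Qed.

HB.instance Definition _ := isMeasurableFun.Build _ _ _ _ idR measurable_idR.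

Definition unif : probability R R :=
  distribution (uniform_prob (@ltr01 R)) idR.

Definition clip01 (x : R) : R := Num.min 1 (Num.max 0 x).

Lemma unifE (A : set R) : measurable A ->
  unif A = lebesgue_measure (A `&` `[0, 1]%classic).
Proof.
move=> mA; rewrite /= /uniform_prob integral_uniform_pdf.
rewrite (eq_integral (fun=> 1%E)); last first.
  move=> y; rewrite inE/= => -[_]; rewrite in_itv/= /uniform_pdf => ->.
  by rewrite subr0 invr1.
rewrite integral_cst //= ?mul1e //.
by apply: (@measurableI _ (measurableTypeR R)) => //; exact: measurable_itv.
Qed.

Lemma unif_cdf (x : R) : unif `]-oo, x]%classic = (clip01 x)%:E.
Proof.
rewrite unifE; last exact: measurable_itv.
rewrite /clip01.
have [x0|x0] := ltP x 0.
  rewrite min_r //.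
  rewrite (_ : _ `&` _ = set0) ?measure0 // -subset0 => y /=; rewrite !in_itv /=.
  by move=> [yx /andP[y0 _]]; have := le_lt_trans y0 (le_lt_trans yx x0); rewrite ltxx.
rewrite (_ : _ `&` _ = `[0, Num.min 1 x]%classic); last first.
  apply/seteqP; split=> y /=; rewrite !in_itv /= le_min.
    by move=> [-> /andP[-> ->]].
  by move=> /and3P[-> -> ->].
rewrite lebesgue_measure_itv /= lte_fin sube0.
case: ltP => [//|]; rewrite ge_min lt_geF //= => x0'.
by rewrite min_r ?(le_trans x0') //; congr EFin; apply/eqP; rewrite eq_le x0 x0'.
Qed.

Lemma clip01_le0 (x : R) : x <= 0 -> clip01 x = 0.
Proof. by move=> x0; rewrite /clip01 max_l // min_r. Qed.

Lemma clip01_ge1 (x : R) : 1 <= x -> clip01 x = 1.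
Proof. by move=> x1; rewrite /clip01 min_l // le_max x1 orbT. Qed.

Lemma clip01_id (x : R) : 0 <= x <= 1 -> clip01 x = x.
Proof. by move=> /andP[x0 x1]; rewrite /clip01 max_r // min_r. Qed.

(** Self-similarity of the uniform law, read on its distribution function: it is the equal mixture
    of its images under x / 2 and (x + 1) / 2. *)
Lemma clip01_halve (x : R) :
  clip01 x = 2^-1 * (clip01 (2 * x) + clip01 (2 * x - 1)).
Proof.
have [x0|x0] := leP x 0; first by rewrite !clip01_le0; lra.
have [x1|x1] := leP 1 x; first by rewrite !clip01_ge1; lra.
rewrite (clip01_id (x := x)); last by lra.
have [x2|x2] := leP x 2^-1.
  by rewrite (clip01_id (x := 2 * x)) ?clip01_le0; lra.
by rewrite (clip01_ge1 (x := 2 * x)) ?clip01_id; lra.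
Qed.

(** Total on [R]: points outside [0, 1] also have digits 0 or 1, so the digit sums below lie in
    [0, 1] for every argument. Dyadic points such as 1/2 get the expansion ending in ones. *)
Definition bit (u : R) : R := if u <= 2^-1 then 0 else 1.
Definition dbl (u : R) : R := 2 * u - bit u.

Lemma measurable_bit : measurable_fun setT bit.
Proof.
apply: measurable_fun_ifT => //.
by apply: measurable_fun_ler => //; exact: measurable_cst.
Qed.

Lemma measurable_dbl : measurable_fun setT dbl.
Proof.
apply: measurable_funB; last exact: measurable_bit.
by apply: measurable_funM => //; exact: measurable_cst.
Qed.

(** Each half of [0, 1] is mapped affinely onto [0, 1] with slope 2. Hence [bit] is a fair coin and
    [dbl u] is uniform and independent of it; the family [C] expresses a joint event of the two. *)
Lemma unif_bit (C : R -> set R) : measurable (C 0) -> measurable (C 1) ->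
  unif [set u | C (bit u) (dbl u)] = ((2^-1)%:E * (unif (C 0%R) + unif (C 1%R)))%E.
Proof.
move=> mC0 mC1.
pose B0 : set R := `]-oo, 2^-1]%classic.
have mB0 : measurable B0 by exact: measurable_itv.
have restr (b : R) (D : set R) (mD : measurable D) A : measurable A ->
    (forall x, unif ([set u | 2 * u - b <= x] `&` D) = (2^-1 * clip01 x)%:E) ->
    unif ([set u | A (2 * u - b)] `&` D) = ((2^-1)%:E * unif A)%E.
  move=> mA Dcdf.
  have mf : measurable_fun setT (fun u : R => 2 * u - b).
    by apply: measurable_funB => //; apply: measurable_funM.
  have h0 : (0 : R) <= 2^-1 by [].
  apply: (@measure_preimage_eq_cdf _ _ _ (mrestr unif mD) _ (NngNum h0)) => //.
    apply: (@le_lt_trans _ _ 1%E); last exact: ltry.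
    by apply: probability_le1; exact: measurableI.
  by move=> x; rewrite unif_cdf /mrestr -EFinM -Dcdf.
have half0 (A : set R) : measurable A ->
    unif ([set u | A (2 * u - 0)] `&` B0) = ((2^-1)%:E * unif A)%E.
  move=> mA; apply: restr => // x.
  rewrite (_ : _ `&` _ = `]-oo, Num.min 2^-1 (x / 2)]%classic); last first.
    apply/seteqP; split => u; rewrite /B0 /= !in_itv/= le_min.
      by move=> [? ->]; lra.
    by move=> /andP[-> ?]; split => //; lra.
  rewrite unif_cdf; congr EFin.
  have [x1|x1] := leP 1 x; first by rewrite (clip01_ge1 x1) min_l ?clip01_id; lra.
  rewrite min_r; last by lra.
  have [x0|x0] := leP x 0; first by rewrite !clip01_le0; lra.
  by rewrite !clip01_id; lra.
have half1 (A : set R) : measurable A ->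
    unif ([set u | A (2 * u - 1)] `&` ~` B0) = ((2^-1)%:E * unif A)%E.
  move=> mA; apply: restr => //; first exact: measurableC.
  move=> x; pose y := Num.max 2^-1 ((x + 1) / 2).
  rewrite (_ : _ `&` _ = `]-oo, y]%classic `\` B0); last first.
    apply/seteqP; split => u; rewrite /B0 /y /= !in_itv/= le_max.
      by move=> [? ?]; split => //; apply/orP; right; lra.
    by move=> [/orP[->//|? ?]]; split => //; lra.
  have yB0 : B0 `<=` `]-oo, y]%classic.
    by move=> u; rewrite /B0 /y /= !in_itv/= le_max => ->.
  have -> : unif (`]-oo, y]%classic `\` B0)
      = (unif `]-oo, y]%classic - unif B0)%E.
    rewrite measureD ?setIidr //.
    exact: le_lt_trans (probability_le1 _ _) (ltry _).
  rewrite !unif_cdf -EFinB; congr EFin.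
  rewrite (clip01_id (x := 2^-1)); last by lra.
  have [x0|x0] := leP x 0.
    by rewrite /y max_l ?(clip01_le0 x0) ?clip01_id; lra.
  rewrite /y max_r; last by lra.
  by have [x1|x1] := leP 1 x; [rewrite !clip01_ge1; lra|rewrite !clip01_id; lra].
rewrite ge0_muleDr ?measure_ge0 // -half0 // -half1 //.
rewrite -measureU; first last.
- by rewrite setIACA setICr setI0.
- apply: measurableI; last exact: measurableC.
  rewrite -[X in measurable X]setTI.
  by apply: measurable_funB => //; exact: measurable_funM.
- apply: measurableI => //; rewrite -[X in measurable X]setTI.
  by apply: measurable_funB => //; exact: measurable_funM.
congr (unif _); apply/seteqP; split => u; rewrite /= /dbl /bit /B0 /= in_itv/=.
- by case: ifPn => [u2|/negP u2]; rewrite ?subr0; [left|right].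
- case=> -[].
  by move=> Cu ->.
  by move=> Cu /negP/negbTE ->.
Qed.

End uniform01.
Arguments unif : simpl never.

(** * Independence of the even and the odd binary digits *)

Section digits.
Context {R : realType}.
Implicit Types (u x y : R).

(** Positions are counted from 0, so that [even_digits (dbl u)] collects the odd ones. *)
Definition even_digits u : R :=
  limn (series (fun k => bit (iter k.*2 dbl u) / 2 ^+ k.+1)).

Lemma bit01 u : 0 <= bit u <= 1.
Proof. by rewrite /bit; case: ifP; rewrite lexx ler01. Qed.

Let partial_sum u n : 0 <= series (fun k => bit (iter k.*2 dbl u) / 2 ^+ k.+1) n <= 1.
Proof.
rewrite seriesEord /= sumr_ge0 => [|i _]; last first.
  by rewrite divr_ge0 ?exprn_ge0 //; case/andP: (bit01 (iter i.*2 dbl u)).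
apply: (@le_trans _ _ (1 - (2^-1) ^+ n)); last by rewrite lerBlDr lerDl exprn_ge0.
elim: n => [|n IH]; first by rewrite big_ord0 expr0 subrr.
rewrite big_ord_recr /= -[X in _ * X]exprVn !(exprS 2^-1).
have /andP[b0 b1] := bit01 (iter n.*2 dbl u).
have : 0 <= (2^-1 : R) ^+ n by rewrite exprn_ge0.
by move: IH; set p := _ ^+ n; set s := \sum_(_ < _) _; nra.
Qed.

Lemma even_digits_cvg u :
  series (fun k => bit (iter k.*2 dbl u) / 2 ^+ k.+1) @ \oo --> even_digits u.
Proof.
apply: nondecreasing_is_cvgn; last first.
  by exists 1 => _ [n _ <-]; case/andP: (partial_sum u n).
apply/nondecreasing_series => k _ _.
by rewrite divr_ge0 ?exprn_ge0 //; case/andP: (bit01 (iter k.*2 dbl u)).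
Qed.

Lemma even_digits01 u : 0 <= even_digits u <= 1.
Proof.
apply/andP; split.
  by apply: limr_ge; [exact: even_digits_cvg|apply: nearW => n; case/andP: (partial_sum u n)].
by apply: limr_le; [exact: even_digits_cvg|apply: nearW => n; case/andP: (partial_sum u n)].
Qed.

Lemma even_digits_rec u :
  even_digits u = 2^-1 * (bit u + even_digits (dbl (dbl u))).
Proof.
rewrite {1}/even_digits; apply: cvg_lim => //.
rewrite -cvg_shiftS /=.
rewrite (_ : (fun n => _) = (fun n => 2^-1 * (bit u +
  series (fun k => bit (iter k.*2 dbl (dbl (dbl u))) / 2 ^+ k.+1) n))).
  apply: cvgMr; apply: cvgD; first exact: cvg_cst.
  exact: even_digits_cvg.
apply/funext => n; rewrite !seriesEord /= big_ord_recl /= expr1 mulrDr mulr_sumr.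
congr (_ + _); first by rewrite mulrC.
apply: eq_bigr => i _; rewrite /bump /= add0n add1n -!iterSr -!iterS.
by rewrite mulrCA -invfM -exprS.
Qed.

Lemma measurable_even_digits : measurable_fun setT even_digits.
Proof.
apply: (@measurable_fun_cvg _ _ _ _
  (fun n u => series (fun k => bit (iter k.*2 dbl u) / 2 ^+ k.+1) n)) => [n|u _]; last first.
  exact: even_digits_cvg.
rewrite /series /=; apply: measurable_sum => k; apply: measurable_funM => //.
apply: measurableT_comp; first exact: measurable_bit.
elim: (k.*2) => [|j IH]; first exact: measurable_id.
by apply: measurableT_comp IH; exact: measurable_dbl.
Qed.

Lemma unif_dbl (A : set R) : measurable A -> unif (dbl @^-1` A) = unif A.
Proof.
move=> mA; have := @unif_bit R (fun=> A) mA mA => ->.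
rewrite -[unif A]fineK ?fin_num_measure // -EFinD -EFinM.
by congr EFin; lra.
Qed.

Lemma unif_bit2 (C : R -> R -> set R) :
  (forall a b, measurable (C a b)) ->
  unif [set u | C (bit u) (bit (dbl u)) (dbl (dbl u))] =
  ((4^-1)%:E * (unif (C 0%R 0%R) + unif (C 0%R 1%R) +
                (unif (C 1%R 0%R) + unif (C 1%R 1%R))))%E.
Proof.
move=> mC.
pose C' (a : R) := [set v | C a (bit v) (dbl v)].
have mC' a : measurable (C' a).
  rewrite (_ : C' a = ((fun v => bit v = 0) `&` (dbl @^-1` C a 0)) `|`
                      ((fun v => bit v = 1) `&` (dbl @^-1` C a 1))).
    have mbit b : measurable (fun v : R => bit v = b).
      exact: (measurable_preimageT measurable_bit (measurable_set1 b)).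
    by apply: measurableU; apply: measurableI => //;
      exact: (measurable_preimageT measurable_dbl).
  apply/seteqP; split => v; rewrite /C' /=.
    by rewrite /dbl /bit; case: ifP => _; [left|right].
  by case=> -[] ->.
have -> := @unif_bit R C' (mC' _) (mC' _).
have f a b : unif (C a b) = (fine (unif (C a b)))%:E by rewrite fineK ?fin_num_measure.
rewrite /C' !unif_bit // (f 0 0) (f 0 1) (f 1 0) (f 1 1).
rewrite -!(EFinD, EFinM).
by congr EFin; lra.
Qed.

Let G x y := fine (unif [set u | even_digits u <= x /\ even_digits (dbl u) <= y]).

Let mG x y : measurable [set u | even_digits u <= x /\ even_digits (dbl u) <= y].
Proof.
have mE := measurable_even_digits.
have mEd : measurable_fun setT (even_digits \o dbl).
  by apply: measurableT_comp => //; exact: measurable_dbl.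
rewrite (_ : mkset _ = (even_digits @^-1` `]-oo, x]) `&`
                       ((even_digits \o dbl) @^-1` `]-oo, y])).
  by apply: measurableI; [apply: (measurable_preimageT mE)|
    apply: (measurable_preimageT mEd)]; exact: measurable_itv.
by apply/seteqP; split => u; rewrite /= !in_itv.
Qed.

Let GE x y :
  unif [set u | even_digits u <= x /\ even_digits (dbl u) <= y] = (G x y)%:E.
Proof. by rewrite /G fineK // fin_num_measure //; exact: mG. Qed.

(** Conditioning on the first two digits gives a functional equation for the joint distribution
    function. The product [clip01 x * clip01 y] satisfies the same one by [clip01_halve], so only
    uniqueness of the bounded solution remains. *)
Let G_rec x y : G x y = 4^-1 *
  (G (2 * x) (2 * y) + G (2 * x) (2 * y - 1) +
   (G (2 * x - 1) (2 * y) + G (2 * x - 1) (2 * y - 1))).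
Proof.
pose C a b : set R :=
  [set u | even_digits u <= 2 * x - a /\ even_digits (dbl u) <= 2 * y - b].
rewrite {1}/G (_ : [set u | even_digits u <= x /\ _] =
  [set u | C (bit u) (bit (dbl u)) (dbl (dbl u))]); last first.
  apply/seteqP; split => u; rewrite /C /= (even_digits_rec u) (even_digits_rec (dbl u)).
    by move=> [? ?]; split; lra.
  by move=> [? ?]; split; lra.
rewrite unif_bit2; last by move=> a b; exact: mG.
rewrite /C !subr0.
by rewrite !GE.
Qed.

Let G01 x y : 0 <= G x y <= 1.
Proof.
by rewrite -!lee_fin -GE measure_ge0 probability_le1 //; exact: mG.
Qed.

Let G_lt0 x y : x < 0 \/ y < 0 -> G x y = 0.
Proof.
move=> xy; rewrite /G (_ : mkset _ = set0) ?measure0 // -subset0 => u /= [ux uy].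
have /andP[e0 _] := even_digits01 u; have /andP[d0 _] := even_digits01 (dbl u).
by case: xy; lra.
Qed.

Let G_ge1 x y : 1 <= x -> 1 <= y -> G x y = 1.
Proof.
move=> x1 y1; rewrite /G (_ : mkset _ = setT) ?probability_setT //.
apply/seteqP; split => u //= _.
have /andP[_ e1] := even_digits01 u; have /andP[_ d1] := even_digits01 (dbl u).
by split; [exact: le_trans x1|exact: le_trans y1].
Qed.

Let small_eq0 (a : R) : (forall n, `|a| <= (2^-1) ^+ n) -> a = 0.
Proof.
move=> an; apply/eqP; rewrite -normr_le0.
have c : (2^-1 : R) ^+ n @[n --> \oo] --> 0.
  by apply: cvg_expr; rewrite ger0_norm //; lra.
rewrite -(cvg_lim _ c) //; apply: limr_ge; first by apply/cvg_ex; exists 0.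
exact: nearW.
Qed.

Let clip01_itv x : 0 <= clip01 x <= 1.
Proof. by rewrite /clip01 le_min ler01 le_max lexx ge_min lexx. Qed.

(* The error halves at each digit, because only one of the dyadic halves of
   [0, 1] contains x. *)
Let G1_clip x y : 1 <= y -> G x y = clip01 x.
Proof.
move=> y1; apply/eqP; rewrite -subr_eq0; apply/eqP/small_eq0 => n.
elim: n x y y1 => [|n IH] x y y1.
  have := G01 x y; have := clip01_itv x; rewrite expr0 ler_norml; lra.
have p0 : 0 <= (2^-1 : R) ^+ n by rewrite exprn_ge0.
have [x0|x0] := ltP x 0.
  by rewrite (G_lt0 (or_introl x0)) (clip01_le0 (ltW x0)) subrr normr0 exprn_ge0.
have [x1|x1] := leP 1 x; first by rewrite G_ge1 ?clip01_ge1 // subrr normr0 exprn_ge0.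
rewrite G_rec clip01_halve exprS.
have [x2|x2] := ltP x 2^-1.
  have x2' : 2 * x - 1 < 0 by lra.
  rewrite !(G_lt0 (x := 2 * x - 1)); [|by left|by left].
  rewrite (clip01_le0 (ltW x2')).
  have := IH (2 * x) (2 * y); have := IH (2 * x) (2 * y - 1).
  by rewrite !ler_norml; move: (_ ^+ _) p0 => p p0 /(_ _)/andP[|]; lra.
have x2' : 1 <= 2 * x by lra.
rewrite !(G_ge1 x2'); [|by lra|by lra].
rewrite (clip01_ge1 x2').
have := IH (2 * x - 1) (2 * y); have := IH (2 * x - 1) (2 * y - 1).
by rewrite !ler_norml; move: (_ ^+ _) p0 => p p0 /(_ _)/andP[|]; lra.
Qed.

Let G1_clipr x y : 1 <= x -> G x y = clip01 y.
Proof.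
move=> x1; rewrite -(@G1_clip _ 1) // /G; congr fine.
pose S := [set u | even_digits u <= y].
have mS : measurable S.
  rewrite (_ : S = even_digits @^-1` `]-oo, y]).
    exact: (measurable_preimageT measurable_even_digits).
  by apply/seteqP; split => u; rewrite /S /= in_itv.
rewrite (_ : mkset _ = dbl @^-1` S) ?unif_dbl //; last first.
  apply/seteqP; split => u /=; first by case.
  by move=> ?; split => //; case/andP: (even_digits01 u) => _ /le_trans; apply.
congr (unif _); apply/seteqP; split => u /=; last by case.
by move=> ?; split => //; case/andP: (even_digits01 (dbl u)).
Qed.

(** In each quadrant of the unit square, three of the four terms of [G_rec] are zero or given by the
    marginals, which is why the marginals are computed beforehand. The difference with the product
    is then a quarter of the difference at a rescaled point, and n iterations make it smaller than
    2^(-n). *)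
Let Gclip x y : G x y = clip01 x * clip01 y.
Proof.
apply/eqP; rewrite -subr_eq0; apply/eqP/small_eq0 => n.
elim: n x y => [|n IH] x y.
  have := G01 x y; rewrite expr0 ler_norml.
  have := clip01_itv x; have := clip01_itv y; nra.
have p0 : 0 <= (2^-1 : R) ^+ n by rewrite exprn_ge0.
have z0 : `|0 : R| <= 2^-1 ^+ n.+1 by rewrite normr0 exprn_ge0.
have [x0|x0] := ltP x 0.
  by rewrite (G_lt0 (or_introl x0)) (clip01_le0 (ltW x0)) mul0r subrr.
have [y0|y0] := ltP y 0.
  by rewrite (G_lt0 (or_intror y0)) (clip01_le0 (ltW y0)) mulr0 subrr.
have [y1|y1] := leP 1 y.
  by rewrite G1_clip // (clip01_ge1 y1) mulr1 subrr.
have [x1|x1] := leP 1 x.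
  by rewrite G1_clipr // (clip01_ge1 x1) mul1r subrr.
rewrite G_rec (clip01_halve x) (clip01_halve y) exprS.
have sub2 (z : R) : z < 2^-1 -> clip01 (2 * z - 1) = 0.
  by move=> z2; rewrite clip01_le0 //; lra.
have sup2 (z : R) : 2^-1 <= z -> clip01 (2 * z) = 1.
  by move=> z2; rewrite clip01_ge1 //; lra.
have [x2|x2] := ltP x 2^-1; have [y2|y2] := ltP y 2^-1.
- rewrite (sub2 _ x2) (sub2 _ y2) !(G_lt0 (x := 2 * x - 1)); try by left; lra.
  rewrite (G_lt0 (y := 2 * y - 1)); last by right; lra.
  by have := IH (2 * x) (2 * y); rewrite !ler_norml; lra.
- rewrite (sub2 _ x2) (sup2 _ y2) !(G_lt0 (x := 2 * x - 1)); try by left; lra.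
  rewrite (@G1_clip _ (2 * y)); last by lra.
  by have := IH (2 * x) (2 * y - 1); rewrite !ler_norml; lra.
- rewrite (sup2 _ x2) (sub2 _ y2) !(G_lt0 (y := 2 * y - 1)); try by right; lra.
  rewrite (G1_clipr (x := 2 * x)); last by lra.
  by have := IH (2 * x - 1) (2 * y); rewrite !ler_norml; lra.
- rewrite (sup2 _ x2) (sup2 _ y2) !(@G1_clip _ (2 * y)); try by lra.
  rewrite (G1_clipr (x := 2 * x)); last by lra.
  rewrite (sup2 _ x2).
  by have := IH (2 * x - 1) (2 * y - 1); rewrite !ler_norml; lra.
Qed.

Lemma unif_even_digits x y :
  unif [set u | even_digits u <= x /\ even_digits (dbl u) <= y] =
  (clip01 x * clip01 y)%:E.
Proof. by rewrite -Gclip /G fineK // fin_num_measure. Qed.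

(** The passage from distribution functions to Borel sets is made one variable at a time, with
    [unif] restricted to an event on the other variable. *)
Lemma unif_digits_indep (A B : set R) : measurable A -> measurable B ->
  unif [set u | A (even_digits u) /\ B (even_digits (dbl u))] =
  (unif A * unif B)%E.
Proof.
move=> mA mB.
have mE := @measurable_even_digits.
have mEd : measurable_fun setT (even_digits \o dbl).
  by apply: measurableT_comp => //; exact: measurable_dbl.
have lt1 C : measurable C -> (unif C < +oo)%E.
  by move=> mC; apply: le_lt_trans (probability_le1 _ mC) (ltry _).
have half y : unif (even_digits @^-1` A `&` (even_digits \o dbl) @^-1` `]-oo, y]) =
    (unif `]-oo, y]%classic * unif A)%E.
  have mD := measurable_preimageT mEd (measurable_itv `]-oo, y]).
  have c0 : 0 <= fine (unif `]-oo, y]%classic) by rewrite fine_ge0.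
  have cE : (NngNum c0)%:num%:E = unif `]-oo, y]%classic.
    by rewrite /= unif_cdf.
  rewrite -cE.
  apply: (@measure_preimage_eq_cdf _ _ _ (mrestr unif mD)) => //.
    by apply: lt1; exact: measurableI.
  move=> x; rewrite cE !unif_cdf -EFinM mulrC -unif_even_digits /mrestr.
  by congr (unif _); apply/seteqP; split => u; rewrite /= !in_itv.
have mD := measurable_preimageT mE mA.
have c0 : 0 <= fine (unif A) by rewrite fine_ge0.
have cE : (NngNum c0)%:num%:E = unif A by rewrite /= fineK // (fin_num_measure unif).
rewrite -cE -(measure_preimage_eq_cdf (m := mrestr unif mD) (f := even_digits \o dbl)) //.
- by rewrite /mrestr; congr (unif _); apply/seteqP; split => u [].
- by apply: lt1; exact: measurableI.
- by move=> y; rewrite cE muleC -half /mrestr setIC.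
Qed.

End digits.

(** * Sampling an arbitrary law from a uniform variable *)

Section quantile.
Context {R : realType}.
Variable p : probability R R.

Let Xid : {RV p >-> R} := mfun_Sub (mem_set (@measurable_id _ R setT)).

Let F (x : R) : R := fine (p `]-oo, x]%classic).

Let FE x : cdf Xid x = (F x)%:E.
Proof. by rewrite /F fineK // fin_num_measure //; exact: measurable_itv. Qed.

Let F01 x : 0 <= F x <= 1.
Proof.
by have := cdf_ge0 Xid x; have := cdf_le1 Xid x; rewrite FE !lee_fin => -> ->.
Qed.

Let F_homo x y : x <= y -> F x <= F y.
Proof. by move=> xy; have := cdf_nondecreasing Xid xy; rewrite !FE lee_fin. Qed.

Let F_rc x : F y @[y --> x^'+] --> F x.
Proof.
apply: fine_cvg; rewrite -FE.
exact: (@cdf_right_continuous _ _ _ p Xid x).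
Qed.

Let F_y : F x @[x --> +oo] --> (1 : R).
Proof. by apply: fine_cvg; exact: (@cvg_cdfy1 _ _ _ p Xid). Qed.

Let F_Ny : F x @[x --> -oo] --> (0 : R).
Proof. by apply: fine_cvg; exact: (@cvg_cdfNy0 _ _ _ p Xid). Qed.

(** Outside the open interval the set may be empty or unbounded below; the value 0 is taken there,
    on a null set of [unif]. *)
Definition quantile (u : R) : R :=
  if 0 < u < 1 then inf [set x | u <= F x] else 0.

(** The Galois connection between [quantile] and [F]; the direction from left to right rests on the
    right continuity of [F]. *)
Let quantile_le u x : 0 < u < 1 -> (quantile u <= x) = (u <= F x).
Proof.
move=> u01; rewrite /quantile u01; case/andP: u01 => u0 u1.
have ne : [set x | u <= F x] !=set0.
  have [M [_ MF]] : \forall x \near +oo, u < F x.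
    by apply: cvgr_gt F_y _ u1.
  by exists (M + 1); apply/ltW/MF; rewrite ltrDl.
have lb : has_lbound [set x | u <= F x].
  have [M [_ MF]] : \forall x \near -oo, F x < u.
    by apply: cvgr_lt F_Ny _ u0.
  exists (M - 1) => y /= uFy; rewrite leNgt; apply/negP => yM.
  have : F y < u by apply: MF; rewrite (lt_trans yM) // gtrDl oppr_lt0.
  by rewrite ltNge uFy.
apply/idP/idP => [qx|uFx]; last exact: ge_inf.
rewrite leNgt; apply/negP => Fxu.
have [e /= e0 eF] : \forall y \near x^'+, F y < u.
  by apply: cvgr_lt (F_rc (x := x)) _ Fxu.
have [y /= uFy yx] : exists2 y, u <= F y & y < x + e.
  have /inf_lt [//|y Fy yx] : inf [set x | u <= F x] < x + e.
    by rewrite (le_lt_trans qx) // ltrDl.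
  by exists y.
have [xy|yx'] := ltP x y.
  have : F y < u by apply: eF => //=; rewrite distrC gtr0_norm ?subr_gt0 // ltrBlDl.
  by rewrite ltNge uFy.
by have := lt_le_trans Fxu (le_trans uFy (F_homo yx')); rewrite ltxx.
Qed.

Let I01 : set R := `]0, 1[%classic.

Let unif_I01 (A : set R) : measurable A -> unif (A `&` I01) = unif A.
Proof.
move=> mA; have mI : measurable I01 by exact: measurable_itv.
have I1 : unif (~` I01) = 0%E.
  rewrite unifE; last exact: measurableC.
  apply: countable_lebesgue_measure0.
  apply: (@sub_countable _ _ _ [set 0; 1 : R]); last by apply: finite_set_countable.
  apply: subset_card_le => u; rewrite /I01 /= !in_itv /= => -[/negP].
  rewrite negb_and -!leNgt => /orP[u0|u1] /andP[u0' u1'].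
    by left; apply/eqP; rewrite eq_le u0 u0'.
  by right; apply/eqP; rewrite eq_le u1 u1'.
have UA : A = (A `&` I01) `|` (A `&` ~` I01) by rewrite -setIUr setUCr setIT.
rewrite [in RHS]UA measureU ?I1 //; first last.
- by rewrite setIACA setICr setI0.
- by apply: measurableI => //; exact: measurableC.
- exact: measurableI.
rewrite [X in (_ + X)%E](_ : _ = 0%E) ?adde0 //.
apply/eqP; rewrite eq_le measure_ge0 andbT -I1; apply: le_measure; rewrite ?inE //.
- by apply: measurableI => //; exact: measurableC.
- exact: measurableC.
Qed.

Lemma measurable_quantile : measurable_fun setT quantile.
Proof.
apply: (measurability _ (RGenOInfty.measurableE R)) => //.
move=> _ [_ [x ->] <-]; rewrite setTI.
rewrite (_ : _ @^-1` _ = (I01 `&` `]F x, +oo[%classic) `|`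
                         (~` I01 `&` [set u | x < 0])).
  apply: measurableU; apply: measurableI.
  - exact: measurable_itv.
  - exact: measurable_itv.
  - by apply: measurableC; exact: measurable_itv.
  - by case: (ltP x 0) => _; [rewrite set_true|rewrite set_false].
apply/seteqP; split => u; rewrite /I01 /= !in_itv /= !andbT.
  have [u01|u01] := boolP (0 < u < 1).
    by rewrite ltNge quantile_le // -ltNge; left.
  by rewrite /quantile (negbTE u01) => x0; right; split => //; exact/negP.
move=> [[u01]|[/negP/negbTE u01]]; last by rewrite /quantile u01.
by rewrite ltNge -quantile_le // -ltNge.
Qed.

Lemma unif_quantile (A : set R) : measurable A -> unif (quantile @^-1` A) = p A.
Proof.
apply: (@probability_eq_cdf _ (image_probability unif measurable_quantile) p) => x.
rewrite image_probabilityE -[RHS]/(cdf Xid x) FE -[F x]clip01_id // -unif_cdf.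
have mq : measurable (quantile @^-1` `]-oo, x]).
  exact: (measurable_preimageT measurable_quantile).
rewrite -(unif_I01 mq) -[RHS](unif_I01 (measurable_itv _)).
congr (unif _); apply/seteqP; split => u; rewrite /I01 /= !in_itv /=.
  by move=> [+ u01]; rewrite quantile_le.
by move=> [+ u01]; rewrite quantile_le.
Qed.

End quantile.

(** * Rotation invariance of the Gaussian law *)

Section shear.
Context {R : realType}.
Local Notation T := (measurableTypeR R).
Local Notation mu := (@lebesgue_measure R).
Implicit Types (f : T -> \bar R) (g : T * T -> \bar R).

Lemma lebesgue_measure_shift (a : R) (A : set T) : measurable A ->
  pushforward mu (fun x : T => (x + a : T)) A = mu A.
Proof.
move=> mA; apply/esym.
have mf : measurable_fun [set: T] (fun x : T => (x + a : T)).
  exact: (@measurable_funD _ T R setT).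
apply: (@lebesgue_measure_unique R (image_measure mu mf)) => // _ [[b c]] _ <-.
rewrite /image_measure /= /pushforward.
rewrite (_ : _ @^-1` _ = `](b - a), (c - a)]%classic); last first.
  by apply/seteqP; split => x; rewrite /= !in_itv /= ltrBlDr lerBrDr.
rewrite !lebesgue_measure_itv/= !lte_fin ltrD2r.
by case: ifP => // _; rewrite -!EFinB; congr EFin; ring.
Qed.

Lemma ge0_integral_shift f (a : R) :
  measurable_fun setT f -> (forall x, 0 <= f x)%E ->
  (\int[mu]_x f (x + a)%R = \int[mu]_x f x)%E.
Proof.
move=> mf f0.
have ms : measurable_fun [set: T] (fun x : T => (x + a : T)).
  exact: (@measurable_funD _ T R setT).
have -> : (\int[mu]_x f x = \int[image_measure mu ms]_x f x)%E.
  by apply: eq_measure_integral => A mA _; rewrite /= lebesgue_measure_shift.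
by rewrite ge0_integral_pushforward.
Qed.

(** Iterated integrals, rather than an integral for the product measure: for a fixed first
    coordinate a shear is a translation of the inner variable. *)
Definition integral2 g : \bar R := (\int[mu]_x \int[mu]_y g (x, y))%E.

Lemma integral2_swap g : measurable_fun setT g -> (forall z, 0 <= g z)%E ->
  integral2 g = integral2 (fun z => g (z.2, z.1)).
Proof. by move=> mg g0; rewrite /integral2 fubini_tonelli. Qed.

Lemma integral2_shear g (a : R) :
  measurable_fun setT g -> (forall z, 0 <= g z)%E ->
  integral2 (fun z => g (z.1, z.2 + a * z.1)%R) = integral2 g.
Proof.
move=> mg g0; apply: eq_integral => x _ /=.
apply: (@ge0_integral_shift (fun y => g (x, y))) => // .
exact: measurableT_comp mg (measurable_pair1 x).
Qed.

Lemma measurable_integral2_linear (a b c d : R) :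
  measurable_fun [set: T * T]
    (fun z : T * T => ((a * z.1 + b * z.2 : T), (c * z.1 + d * z.2 : T))).
Proof.
have mlin (k l : R) : measurable_fun [set: T * T] (fun z => k * z.1 + l * z.2 : T).
  have mM (m : R) (f : T * T -> T) : measurable_fun setT f ->
      measurable_fun setT (fun z => m * f z : T).
    by move=> mf; exact: (@measurable_funM _ (T * T)%type R setT (cst m) f).
  apply: (@measurable_funD _ (T * T)%type R setT); apply: mM.
    exact: (@measurable_fst _ _ T T).
  exact: (@measurable_snd _ _ T T).
by apply/measurable_fun_pairP; split; exact: mlin.
Qed.

(* A rotation of angle different from pi is a product of three shears. *)
Lemma integral2_rot g (c s : R) : c ^+ 2 + s ^+ 2 = 1 -> s != 0 ->
  measurable_fun setT g -> (forall z, 0 <= g z)%E ->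
  integral2 (fun z => g (c * z.1 - s * z.2, s * z.1 + c * z.2)%R) = integral2 g.
Proof.
move=> cs s0 mg g0.
have mcomp (k l m n : R) h : measurable_fun setT h ->
    measurable_fun setT (fun z : T * T => h (k * z.1 + l * z.2, m * z.1 + n * z.2) : \bar R).
  move=> mh; exact: measurableT_comp mh (measurable_integral2_linear k l m n).
(* For an angle theta, [b] is -tan(theta/2): the rotation is the horizontal shear by [b], followed
   by the vertical shear by [s] and the horizontal shear by [b] again. *)
pose b := (c - 1) / s.
have shear2 h : measurable_fun setT h -> (forall z, 0 <= h z)%E ->
    integral2 (fun z => h (z.1 + b * z.2, z.2)%R) = integral2 h.
  move=> mh h0; rewrite integral2_swap //; last first.
    by have := mcomp 1 b 0 1 h mh; apply: eq_measurable_fun => z _; rewrite !mul1r mul0r add0r.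
  rewrite (integral2_swap mh) //=.
  rewrite -(@integral2_shear (fun z => h (z.2, z.1)) b) //.
  by have := mcomp 0 1 1 0 h mh; apply: eq_measurable_fun => z _; rewrite !mul1r !mul0r add0r addr0.
pose h1 (z : T * T) := g (z.1 + b * z.2, z.2)%R.
have mh1 : measurable_fun setT h1.
  by have := mcomp 1 b 0 1 g mg; apply: eq_measurable_fun => z _; rewrite !mul1r mul0r add0r.
pose h2 (z : T * T) := h1 (z.1, z.2 + s * z.1)%R.
have mh2 : measurable_fun setT h2.
  have := mcomp 1 0 s 1 h1 mh1; apply: eq_measurable_fun => z _.
  by rewrite !mul1r mul0r addr0 [X in (_, X)]addrC.
have h20 z : (0 <= h2 z)%E by exact: g0.
transitivity (integral2 (fun z => h2 (z.1 + b * z.2, z.2)%R)); last first.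
  rewrite (shear2 _ mh2 h20) (integral2_shear s mh1) => [|z]; last exact: g0.
  exact: shear2.
apply: eq_integral => x _; apply: eq_integral => y _; rewrite /h2 /h1 /b /=.
congr (g (_, _)).
  have bs : (c - 1) / s * s = c - 1 by rewrite divfK.
  have bc : (c - 1) / s * (c + 1) = - s.
    by apply: (mulIf s0); rewrite mulrAC bs; move: cs; nra.
  move: bs bc; set b' := (c - 1) / s => bs bc.
  transitivity (x + b' * s * x + (b' * (1 + b' * s) + b') * y); last by ring.
  rewrite bs; transitivity (c * x + b' * (c + 1) * y); last by ring.
  by rewrite bc mulNr.
by field.
Qed.

End shear.

Section std_normal.
Context {R : realType}.
Local Notation T := (measurableTypeR R).
Local Notation mu := (@lebesgue_measure R).

Let idR : T -> R := idfun.

Let measurable_idR : measurable_fun setT idR.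
Proof. by move=> _ A mA; rewrite setTI. Qed.

Definition std_normal : probability R R :=
  image_probability (normal_prob 0 1) measurable_idR.

Definition std_normal2 : probability (R * R)%type R :=
  (std_normal \x std_normal)%E.

Definition rot (c s : R) (z : R * R) : R * R :=
  (c * z.1 - s * z.2, s * z.1 + c * z.2).

Let density (z : T * T) : \bar R := (normal_pdf 0 1 z.1 * normal_pdf 0 1 z.2)%:E.

Let measurable_density : measurable_fun setT density.
Proof.
apply/measurable_EFinP; apply: (@measurable_funM _ (T * T)%type R setT).
  apply: (measurableT_comp (@measurable_normal_pdf R 0 1)).
  exact: (@measurable_fst _ _ T T).
apply: (measurableT_comp (@measurable_normal_pdf R 0 1)).
exact: (@measurable_snd _ _ T T).
Qed.

Let density_ge0 z : (0 <= density z)%E.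
Proof. by rewrite lee_fin mulr_ge0 ?normal_pdf_ge0. Qed.

Let m2 (A : set (R * R)) : \bar R := (\int[mu \x mu]_(z in A) density z)%E.

Let m20 : m2 set0 = 0%E. Proof. exact: integral_set0. Qed.

Let m2_ge0 A : (0 <= m2 A)%E.
Proof. by apply: integral_ge0 => z _; exact: density_ge0. Qed.

Let m2_sigma : semi_sigma_additive m2.
Proof. exact: (semi_sigma_additive_nng_induced measurable_density density_ge0). Qed.

HB.instance Definition _ := isMeasure.Build _ _ _ m2 m20 m2_ge0 m2_sigma.

Let m2E (A : set (T * T)) : measurable A ->
  m2 A = integral2 (fun z : T * T => (density z * (\1_A z)%:E)%E).
Proof.
move=> mA; rewrite /m2 integral_mkcond.
rewrite (_ : _ \_ A = (fun z => density z * (\1_A z)%:E)%E); last first.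
  apply/funext => z; rewrite patchE indicE; case: (z \in A).
    by rewrite mule1.
  by rewrite mule0.
rewrite fubini_tonelli1 //.
  apply: emeasurable_funM => //; apply/measurable_EFinP; exact: measurable_indic.
by move=> z; rewrite mule_ge0 ?density_ge0 ?lee_fin.
Qed.

Let std_normal2E (A : set (R * R)) : measurable A -> std_normal2 A = m2 A.
Proof.
apply: (@product_measure_unique _ _ R R R std_normal std_normal m2) => B C mB mC.
have normalE (D : set T) : measurable D ->
    (\int[mu]_x (normal_pdf 0 1 x * \1_D x)%:E)%E = std_normal D.
  move=> mD; rewrite image_probabilityE /= /normal_prob [RHS]integral_mkcond.
  apply: eq_integral => x _; rewrite patchE indicE; case: (x \in D).
    by rewrite mulr1.
  by rewrite mulr0.
have mpdf (D : set T) : measurable D ->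
    measurable_fun setT (fun x : T => (normal_pdf 0 1 x * \1_D x)%:E).
  move=> mD; apply/measurable_EFinP; apply: (@measurable_funM _ T R setT).
    exact: measurable_normal_pdf.
  exact: measurable_indic.
have pdf_ge0 (D : set T) x : (0 <= (normal_pdf 0 1 x * \1_D x)%:E)%E.
  by rewrite lee_fin mulr_ge0 ?normal_pdf_ge0.
rewrite -[LHS]/(m2 (B `*` C)) m2E; last exact: measurableX.
transitivity (std_normal B * std_normal C)%E; last by [].
rewrite -(normalE B) // -(normalE C) // /integral2.
under eq_integral => x _.
  under eq_integral => y _.
    rewrite (_ : (_ * _)%E = ((normal_pdf 0 1 x * \1_B x)%:E *
                              (normal_pdf 0 1 y * \1_C y)%:E)%E); last first.
      rewrite -!EFinM /= !indicE in_setX /= mulrACA; congr (_ * _)%:E.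
      by case: (x \in B); case: (y \in C); rewrite /= ?mulr1 ?mulr0.
    over.
  rewrite ge0_integralZl //=; last exact: mpdf.
  over.
by rewrite ge0_integralZr //=; [exact: mpdf|apply: integral_ge0].
Qed.

Lemma measurable_rot (c s : R) : measurable_fun setT (rot c s).
Proof.
have := measurable_integral2_linear c (- s) s c.
by apply: eq_measurable_fun => z _; rewrite /rot mulNr.
Qed.

Let density_rot (c s : R) (z : T * T) : c ^+ 2 + s ^+ 2 = 1 ->
  density (rot c s z) = density z.
Proof.
move=> cs; rewrite /density /rot /=; congr EFin.
rewrite normal_pdfE ?oner_neq0 // mulrACA [RHS]mulrACA; congr (_ * _).
rewrite /normal_fun -!expRD; congr expR; rewrite !subr0.
suff : (c * z.1 - s * z.2) ^+ 2 + (s * z.1 + c * z.2) ^+ 2 = z.1 ^+ 2 + z.2 ^+ 2.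
  by move=> h; rewrite -!mulrDl -!opprD h.
transitivity ((c ^+ 2 + s ^+ 2) * (z.1 ^+ 2 + z.2 ^+ 2)); first by ring.
by rewrite cs mul1r.
Qed.

Let rot_neq0 (c s : R) (A : set (R * R)) : c ^+ 2 + s ^+ 2 = 1 -> s != 0 ->
  measurable A -> std_normal2 (rot c s @^-1` A) = std_normal2 A.
Proof.
move=> cs s0 mA.
have mrA : measurable (rot c s @^-1` A).
  exact: (measurable_preimageT (measurable_rot c s)).
rewrite !std_normal2E // !m2E //.
pose g (z : T * T) := (density z * (\1_A z)%:E)%E.
have mg : measurable_fun setT g.
  by apply: emeasurable_funM => //; apply/measurable_EFinP; exact: measurable_indic.
have g0 z : (0 <= g z)%E by rewrite mule_ge0 ?density_ge0 ?lee_fin.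
rewrite -[RHS](integral2_rot cs s0 mg g0).
apply: eq_integral => x _; apply: eq_integral => y _.
by rewrite /g -(density_rot _ cs).
Qed.

Lemma std_normal2_rot (c s : R) (A : set (R * R)) : c ^+ 2 + s ^+ 2 = 1 ->
  measurable A -> std_normal2 (rot c s @^-1` A) = std_normal2 A.
Proof.
move=> cs mA; have [s0|] := eqVneq s 0; last by move=> s0; exact: rot_neq0.
have /eqP : c ^+ 2 = 1 by rewrite -cs s0 expr0n addr0.
rewrite sqrf_eq1 => /orP[] /eqP cE; rewrite {}cE {}s0 {cs}.
  congr (std_normal2 _); apply/seteqP; split => -[x y];
  by rewrite /rot /= !mul1r !mul0r subr0 add0r.
(* The case c = -1 remains: the half turn is the square of the quarter turn, to which the three
   shears apply. *)
have cs : (0 : R) ^+ 2 + 1 ^+ 2 = 1 by rewrite expr0n expr1n add0r.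
have mrA : measurable (rot 0 1 @^-1` A).
  exact: (measurable_preimageT (measurable_rot 0 1)).
have h (B : set (R * R)) : measurable B -> std_normal2 (rot 0 1 @^-1` B) = std_normal2 B.
  by move=> mB; exact: rot_neq0 cs (oner_neq0 R) mB.
transitivity (std_normal2 (rot 0 1 @^-1` A)); last exact: h.
transitivity (std_normal2 (rot 0 1 @^-1` (rot 0 1 @^-1` A))); last exact: h.
congr (std_normal2 _); apply/seteqP; split => -[x y];
by rewrite /rot /= !mul1r !mul0r !mulN1r !sub0r !subr0 !addr0 ?add0r.
Qed.

End std_normal.

Section scaling.
Context {R : realType}.
Local Notation T := (measurableTypeR R).
Local Notation mu := (@lebesgue_measure R).

Lemma lebesgue_measure_scale (s : R) (A : set T) : 0 < s -> measurable A ->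
  (s%:E * mu ((fun x : T => (s * x)%R : T) @^-1` A))%E = mu A.
Proof.
move=> s0 mA; apply/esym.
have mf : measurable_fun [set: T] (fun x : T => (s * x : T)).
  exact: (@measurable_funM _ T R setT (cst s)).
apply: (@lebesgue_measure_unique R (mscale (NngNum (ltW s0)) (image_measure mu mf))) => // _ [[b c]] _ <-.
rewrite -[RHS]/(s%:E * mu ((fun x : T => (s * x)%R : T) @^-1` `]b, c]%classic))%E.
rewrite (_ : _ @^-1` _ = `](b / s), (c / s)]%classic); last first.
  by apply/seteqP; split => x; rewrite /= !in_itv /= ltr_pdivrMr // ler_pdivlMr // ![_ * s]mulrC.
rewrite !lebesgue_measure_itv/= !lte_fin ltr_pM2r ?invr_gt0 //.
by case: ifP => // _; rewrite ?mule0 // -!EFinB -EFinM; congr EFin; field; lra.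
Qed.

Lemma ge0_integral_scale (f : T -> \bar R) (s : R) : 0 < s ->
  measurable_fun setT f -> (forall x, 0 <= f x)%E ->
  (s%:E * \int[mu]_x f (s * x)%R = \int[mu]_x f x)%E.
Proof.
move=> s0 mf f0.
have ms : measurable_fun [set: T] (fun x : T => (s * x : T)).
  exact: (@measurable_funM _ T R setT (cst s)).
have -> : (\int[mu]_x f x = \int[mscale (NngNum (ltW s0)) (image_measure mu ms)]_x f x)%E.
  apply: eq_measure_integral => A mA _.
  by apply/esym; exact: lebesgue_measure_scale.
by rewrite ge0_integral_mscale // ge0_integral_pushforward.
Qed.

Lemma normal_pdf_scale (s x : R) : 0 < s ->
  s * normal_pdf 0 s (s * x) = normal_pdf 0 1 x.
Proof.
move=> s0; rewrite !normal_pdfE ?oner_neq0 ?gt_eqF // mulrA; congr (_ * _).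
  rewrite /normal_peak expr1n mul1r -mulrnAr sqrtrM ?sqr_ge0 // sqrtr_sqr gtr0_norm //.
  by rewrite invfM mulrA divff ?mul1r // gt_eqF.
rewrite /normal_fun !subr0 exprMn expr1n; congr expR.
rewrite -(mulr_natr (s ^+ 2) 2); field.
by rewrite gt_eqF.
Qed.

Lemma std_normal_scale (s : R) (A : set R) : 0 <= s -> measurable A ->
  std_normal (( *%R s) @^-1` A) = gaussian_law 0 s A.
Proof.
move=> s0 mA; rewrite /gaussian_law; have [->|sN0] := eqVneq s 0.
  rewrite diracE; case: (boolP (0 \in A)) => [/set_mem A0|/negP A0].
    rewrite (_ : _ @^-1` _ = setT) ?probability_setT //.
    by apply/seteqP; split => x //= _; rewrite mul0r.
  rewrite (_ : _ @^-1` _ = set0) ?measure0 // -subset0 => x /=.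
  by rewrite mul0r => /mem_set.
have {}s0 : 0 < s by rewrite lt_neqAle eq_sym sN0.
rewrite image_probabilityE /= /normal_prob.
rewrite [LHS]integral_mkcond [RHS]integral_mkcond.
have m1 (r : R) (D : set T) : measurable D ->
    measurable_fun setT ((fun x : T => (normal_pdf 0 r x)%:E) \_ D).
  move=> mD; apply/(measurable_restrictT _ mD); apply: measurable_funTS.
  by apply/measurable_EFinP; exact: measurable_normal_pdf.
rewrite -[RHS](@ge0_integral_scale _ s) //.
- rewrite -ge0_integralZl //.
  + apply: eq_integral => x _; rewrite !patchE.
    rewrite (_ : (x \in _) = (s * x \in A)); last by apply/idP/idP; rewrite !inE.
    by case: ifP => _; rewrite ?mule0 // -EFinM normal_pdf_scale.
  + have ms : measurable_fun [set: T] (fun x : T => (s * x : T)).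
      exact: (@measurable_funM _ T R setT (cst s)).
    exact: (measurableT_comp (m1 s A mA) ms).
  + by move=> x _; rewrite patchE; case: ifP => // _; rewrite lee_fin normal_pdf_ge0.
  + by rewrite lee_fin ltW.
- exact: m1.
- by move=> x; rewrite patchE; case: ifP => // _; rewrite lee_fin normal_pdf_ge0.
Qed.

(** For r nonzero the linear form is r times the first coordinate of a rotated point, so rotation
    invariance reduces it to a marginal. *)
Lemma std_normal2_lin (b c r : R) (A : set R) : 0 <= r -> r ^+ 2 = b ^+ 2 + c ^+ 2 ->
  measurable A ->
  std_normal2 [set z | A (b * z.1 + c * z.2)] = std_normal (( *%R r) @^-1` A).
Proof.
move=> r0 rbc mA.
have mrA : measurable (( *%R r) @^-1` A).
  by apply: measurable_preimageT => //; exact: (@measurable_funM _ R R setT (cst r)).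
have proj : std_normal2 ((( *%R r) @^-1` A) `*` setT) = std_normal (( *%R r) @^-1` A).
  transitivity (std_normal (( *%R r) @^-1` A) * std_normal setT)%E.
    exact: product_measure1E.
  by rewrite probability_setT mule1.
rewrite -proj.
have [rE|rN0] := eqVneq r 0.
  have [b0 c0] : b = 0 /\ c = 0.
    by move: rbc; rewrite rE; split; apply/eqP; nra.
  congr (std_normal2 _); apply/seteqP; split => z /=; rewrite rE b0 c0 !mul0r add0r;
  [by move=> ?; split|by case].
rewrite -[RHS](@std_normal2_rot R (b / r) (- c / r)).
- have E (z : R * R) : r * (rot (b / r) (- c / r) z).1 = b * z.1 + c * z.2.
    by rewrite /rot /=; field.
  congr (std_normal2 _); apply/seteqP; split => z /=; rewrite -E;
  [by move=> ?; split|by case].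
- have : r ^+ 2 != 0 by rewrite expf_eq0.
  by rewrite !exprMn sqrrN -mulrDl -rbc exprVn; move/divff.
- exact: measurableX.
Qed.

End scaling.

(** * Independent Gaussian sequences *)

Section independent_sum.
Context {R : realType}.

Lemma measurable_scale (s : R) : measurable_fun setT ( *%R s).
Proof. exact: (@measurable_funM _ R R setT (cst s)). Qed.

(** Written as an image law so that s = 0 is no special case in sums and limits; [scaled_normalE]
    identifies it with [gaussian_law] for s >= 0. *)
Definition scaled_normal (s : R) : probability R R :=
  image_probability std_normal (measurable_scale s).

Lemma scaled_normalE (s : R) (A : set R) : 0 <= s -> measurable A ->
  scaled_normal s A = gaussian_law 0 s A.
Proof. exact: std_normal_scale. Qed.

(** The pair (X, Y) has the law of (s z1, t z2) under [std_normal2], so [std_normal2_lin] applies.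
    Two separate spaces suit the induction on the number of terms, in which [unif_split] turns head
    and tail into the two factors of a product. *)
Lemma scaled_normal_add d1 d2 (T1 : measurableType d1) (T2 : measurableType d2)
    (P1 : probability T1 R) (P2 : probability T2 R)
    (X : T1 -> R) (Y : T2 -> R) (s t r : R) (A : set R) :
  measurable_fun setT X -> measurable_fun setT Y ->
  (forall B, measurable B -> P1 (X @^-1` B) = scaled_normal s B) ->
  (forall B, measurable B -> P2 (Y @^-1` B) = scaled_normal t B) ->
  0 <= r -> r ^+ 2 = s ^+ 2 + t ^+ 2 -> measurable A ->
  (P1 \x P2)%E [set w | A (X w.1 + Y w.2)] = scaled_normal r A.
Proof.
move=> mX mY lX lY r0 rst mA.
pose h (w : T1 * T2) : R * R := (X w.1, Y w.2).
pose k (z : R * R) : R * R := (s * z.1, t * z.2).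
have mh : measurable_fun setT h.
  apply: measurable_fun_pair.
    by apply: measurableT_comp mX _; exact: measurable_fst.
  by apply: measurableT_comp mY _; exact: measurable_snd.
have mk : measurable_fun setT k.
  apply: measurable_fun_pair.
    by apply: measurableT_comp (measurable_scale s) _; exact: measurable_fst.
  by apply: measurableT_comp (measurable_scale t) _; exact: measurable_snd.
have hk B : measurable B -> (P1 \x P2)%E (h @^-1` B) = std_normal2 (k @^-1` B).
  move=> mB; transitivity ((scaled_normal s \x scaled_normal t)%E B).
    apply/esym.
    apply: (@product_measure_unique _ _ R R R (scaled_normal s) (scaled_normal t)
      (image_measure (P1 \x P2)%E mh)) => // C D mC mD.
    transitivity (P1 (X @^-1` C) * P2 (Y @^-1` D))%E; last by rewrite lX // lY.
    have mXC := measurable_preimageT mX mC.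
    have mYD := measurable_preimageT mY mD.
    exact: (product_measure1E P1 P2 mXC mYD).
  apply: (@product_measure_unique _ _ R R R (scaled_normal s) (scaled_normal t)
      (image_measure std_normal2 mk)) => // C D mC mD.
  have mXC := measurable_preimageT (measurable_scale s) mC.
  have mYD := measurable_preimageT (measurable_scale t) mD.
  exact: (product_measure1E std_normal std_normal mXC mYD).
have mS : measurable [set z : R * R | A (z.1 + z.2)].
  apply: (measurable_preimageT (f := fun z : R * R => z.1 + z.2)) => //.
  by apply: measurable_funD; [exact: measurable_fst|exact: measurable_snd].
rewrite (_ : [set w | A _] = h @^-1` [set z | A (z.1 + z.2)]) // hk //.
exact: std_normal2_lin.
Qed.

End independent_sum.

Section normal_sequence.
Context {R : realType}.
Implicit Types (u : R).

Definition tail u : R := even_digits (dbl u).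

Definition normal_pair u : R * R :=
  (quantile std_normal (even_digits u), quantile std_normal (tail u)).

(** Each [tail] keeps the odd digits of what is left, and pair j is made of the even digits of the
    j-th remainder. Different pairs thus use disjoint sets of digits of [u]. *)
Definition normal_seq u (j : nat) : R * R :=
  normal_pair (even_digits (iter j tail u)).

Lemma measurable_tail : measurable_fun setT tail.
Proof. exact: measurableT_comp measurable_even_digits measurable_dbl. Qed.

Lemma measurable_normal_pair : measurable_fun setT normal_pair.
Proof.
apply: measurable_fun_pair; apply: measurableT_comp (measurable_quantile _) _.
  exact: measurable_even_digits.
exact: measurable_tail.
Qed.

Lemma measurable_normal_seq j : measurable_fun setT (normal_seq ^~ j).
Proof.
apply: measurableT_comp measurable_normal_pair _.
apply: measurableT_comp measurable_even_digits _.
elim: j => [|j IH]; first exact: measurable_id.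
exact: measurableT_comp measurable_tail IH.
Qed.

Let msplit : measurable_fun setT (fun u => (even_digits u, tail u)).
Proof.
by apply: measurable_fun_pair; [exact: measurable_even_digits|exact: measurable_tail].
Qed.

Lemma unif_split (B : set (R * R)) : measurable B ->
  unif [set u | B (even_digits u, tail u)] = (unif \x unif)%E B.
Proof.
move=> mB; apply/esym.
apply: (@product_measure_unique _ _ R R R unif unif (image_measure unif msplit)) => //.
exact: unif_digits_indep.
Qed.

Lemma unif_normal_pair (B : set (R * R)) : measurable B ->
  unif (normal_pair @^-1` B) = std_normal2 B.
Proof.
move=> mB; apply/esym.
apply: (@product_measure_unique _ _ R R R std_normal std_normal
  (image_measure unif measurable_normal_pair)) => // C D mC mD.
transitivity (unif (quantile std_normal @^-1` C) *
  unif (quantile std_normal @^-1` D))%E; last by rewrite !unif_quantile.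
apply: unif_digits_indep; exact: (measurable_preimageT (measurable_quantile _)).
Qed.

Lemma normal_seqS u j : normal_seq u j.+1 = normal_seq (tail u) j.
Proof. by rewrite /normal_seq iterSr. Qed.

(** Independence and identical law of the pairs, phrased as a comparison of two rectangles: this is
    what the invariance under rotations asks for, and no finite product measure has to be formed. *)
Lemma unif_normal_seq_eq N (A B : nat -> set (R * R)) :
  (forall i, measurable (A i)) -> (forall i, measurable (B i)) ->
  (forall i, std_normal2 (A i) = std_normal2 (B i)) ->
  unif [set u | forall i, (i < N)%N -> A i (normal_seq u i)] =
  unif [set u | forall i, (i < N)%N -> B i (normal_seq u i)].
Proof.
elim: N A B => [|N IH] A B mA mB AB.
  by congr (unif _); apply/seteqP; split => u.
have step C : (forall i, measurable (C i)) ->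
    unif [set u | forall i, (i < N.+1)%N -> C i (normal_seq u i)] =
    (std_normal2 (C 0%N) *
     unif [set u | forall i, (i < N)%N -> C i.+1 (normal_seq u i)])%E.
  move=> mC; rewrite -unif_normal_pair //.
  rewrite -unif_digits_indep.
  - congr (unif _); apply/seteqP; split => u /=.
      by move=> h; split => [|i iN]; [exact: (h 0%N)|rewrite -normal_seqS; exact: h].
    by move=> [h0 h] [//|i] iN; rewrite normal_seqS; exact: h.
  - exact: (measurable_preimageT measurable_normal_pair).
  - rewrite (_ : mkset _ = \bigcap_(i in `I_N) ((normal_seq ^~ i) @^-1` C i.+1)) //.
    apply: bigcap_measurableType => i _.
    exact: (measurable_preimageT (measurable_normal_seq i)).
rewrite !step // AB; congr (_ * _)%E.
apply: (IH (fun i => A i.+1) (fun i => B i.+1)) => i; first exact: mA.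
  exact: mB.
exact: AB.
Qed.

Definition normal_sum (b c : nat -> R) N u : R :=
  \sum_(j < N) (b j * (normal_seq u j).1 + c j * (normal_seq u j).2).

Lemma measurable_normal_sum b c N : measurable_fun setT (normal_sum b c N).
Proof.
apply: measurable_sum => j; apply: measurable_funD; apply: measurable_funM => //.
  exact: measurableT_comp measurable_fst (measurable_normal_seq j).
exact: measurableT_comp measurable_snd (measurable_normal_seq j).
Qed.

Lemma unif_normal_sum (b c : nat -> R) N (A : set R) : measurable A ->
  unif (normal_sum b c N @^-1` A) =
  scaled_normal (Num.sqrt (\sum_(j < N) (b j ^+ 2 + c j ^+ 2))) A.
Proof.
have sum_ge0 (b' c' : nat -> R) M : 0 <= \sum_(j < M) (b' j ^+ 2 + c' j ^+ 2).
  by apply: sumr_ge0 => j _; rewrite addr_ge0 ?sqr_ge0.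
elim: N b c A => [|N IH] b c A mA.
  rewrite big_ord0 sqrtr0 scaled_normalE // /gaussian_law eqxx diracE.
  case: (boolP (0 \in A)) => [/set_mem A0|/negP A0].
    rewrite (_ : _ @^-1` _ = setT) ?probability_setT //.
    by apply/seteqP; split => x //= _; rewrite /normal_sum big_ord0.
  rewrite (_ : _ @^-1` _ = set0) ?measure0 // -subset0 => x /=.
  by rewrite /normal_sum big_ord0 => /mem_set.
pose b' j := b j.+1; pose c' j := c j.+1.
pose X v := b 0%N * (normal_pair v).1 + c 0%N * (normal_pair v).2.
have E u : normal_sum b c N.+1 u = X (even_digits u) + normal_sum b' c' N (tail u).
  have S : \sum_(j < N) (b (lift ord0 j) * (normal_seq u (lift ord0 j)).1 +
      c (lift ord0 j) * (normal_seq u (lift ord0 j)).2) = normal_sum b' c' N (tail u).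
    by apply: eq_bigr => j _; rewrite lift0 normal_seqS.
  by rewrite {1}/normal_sum big_ord_recl S.
have mX : measurable_fun setT X.
  apply: measurable_funD; apply: measurable_funM => //.
    exact: measurableT_comp measurable_fst measurable_normal_pair.
  exact: measurableT_comp measurable_snd measurable_normal_pair.
have mY := measurable_normal_sum b' c' N.
have mB : measurable [set w : R * R | A (X w.1 + normal_sum b' c' N w.2)].
  apply: (measurable_preimageT (f := fun w : R * R => X w.1 + normal_sum b' c' N w.2)) => //.
  apply: measurable_funD.
    by apply: measurableT_comp mX _; exact: measurable_fst.
  by apply: measurableT_comp mY _; exact: measurable_snd.
rewrite (_ : _ @^-1` _ = [set u | [set w : R * R | A (X w.1 + normal_sum b' c' N w.2)]
    (even_digits u, tail u)]); last first.
  apply/seteqP; split => u /=; by rewrite E.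
rewrite unif_split //.
apply: (@scaled_normal_add _ _ _ _ _ _ _ _ _ (Num.sqrt (b 0%N ^+ 2 + c 0%N ^+ 2))
   (Num.sqrt (\sum_(j < N) (b' j ^+ 2 + c' j ^+ 2)))) => //.
- move=> B mB'; rewrite (_ : X @^-1` B = normal_pair @^-1` [set z | B (b 0%N * z.1 + c 0%N * z.2)]) //.
  rewrite unif_normal_pair; last first.
    apply: (measurable_preimageT (f := fun z : R * R => b 0%N * z.1 + c 0%N * z.2)) => //.
    by apply: measurable_funD; apply: measurable_funM.
  by apply: std_normal2_lin => //; rewrite sqr_sqrtr // addr_ge0 ?sqr_ge0.
- by move=> B mB'; exact: IH.
- by rewrite !sqr_sqrtr ?sum_ge0 ?addr_ge0 ?sqr_ge0 // big_ord_recl.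
Qed.

End normal_sequence.

(** * The probability space of coefficient sequences *)

Section sequence_space.
Context {R : realType}.

Definition seq_rects : set (set (nat -> R * R)) :=
  [set C | exists N (A : nat -> set (R * R)), (forall i, measurable (A i)) /\
    C = [set w | forall i, (i < N)%N -> A i (w i)]].

(** The sample space of the process consists of the sequences themselves and not of [u], because a
    time shift has to act on the sample space: it does so by rotating coordinates, whereas on [u] it
    would correspond to no explicit map. *)
Definition seq_space := g_sigma_algebraType seq_rects.

Lemma seq_rectsI : setI_closed seq_rects.
Proof.
move=> _ _ [N [A [mA ->]]] [M [B [mB ->]]].
exists (maxn N M), (fun i => (if (i < N)%N then A i else setT) `&`
                             (if (i < M)%N then B i else setT)); split.
  by move=> i; apply: measurableI; case: ifP.
apply/seteqP; split => w /=.
  by move=> [hA hB] i _; split; case: ifP => //; [exact: hA|exact: hB].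
by move=> h; split => i iN; have := h i; rewrite iN leq_max iN ?orbT => /(_ isT) [].
Qed.

Lemma measurable_coord i : measurable_fun setT (fun w : seq_space => w i).
Proof.
move=> _ A mA; rewrite setTI; apply: sub_sigma_algebra.
exists i.+1, (fun j => if j == i then A else setT); split.
  by move=> j; case: ifP.
apply/seteqP; split => w /=.
  by move=> Aw j _; case: eqP => // ->.
by move=> /(_ i (ltnSn i)); rewrite eqxx.
Qed.

Lemma measurable_to_seq d (T : measurableType d) (F : T -> seq_space) :
  (forall i, measurable_fun setT (fun t => F t i)) -> measurable_fun setT F.
Proof.
move=> mF; apply: (@measurability _ _ T seq_space setT F seq_rects erefl).
move=> _ [_ [N [A [mA ->]]] <-]; rewrite setTI.
rewrite (_ : _ @^-1` _ = \bigcap_(i in `I_N) ((fun t => F t i) @^-1` A i)) //.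
apply: bigcap_measurableType => i _.
exact: (measurable_preimageT (mF i)).
Qed.

Lemma measurable_normal_seqT :
  measurable_fun setT (normal_seq : R -> seq_space).
Proof. by apply: measurable_to_seq => i; exact: measurable_normal_seq. Qed.

Definition seq_prob : probability seq_space R :=
  image_probability unif measurable_normal_seqT.

Definition seq_rot (c s : nat -> R) (w : seq_space) : seq_space :=
  fun i => rot (c i) (s i) (w i).

Lemma measurable_seq_rot c s : measurable_fun setT (seq_rot c s).
Proof.
apply: measurable_to_seq => i.
exact: measurableT_comp (measurable_rot (c i) (s i)) (measurable_coord i).
Qed.

Lemma seq_prob_rot (c s : nat -> R) (A : set seq_space) :
  (forall i, c i ^+ 2 + s i ^+ 2 = 1) -> measurable A ->
  seq_prob (seq_rot c s @^-1` A) = seq_prob A.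
Proof.
move=> cs mA; have mr := measurable_seq_rot c s.
apply: (@measure_unique _ R seq_space seq_rects (fun=> setT) erefl _ _ _
  (image_measure seq_prob mr) seq_prob _ _ A mA).
- exact: seq_rectsI.
- move=> _; exists 0%N, (fun=> setT); split => //.
  by apply/seteqP; split.
- by rewrite bigcup_const.
- move=> _ [N [B [mB ->]]].
  have mrB i : measurable (rot (c i) (s i) @^-1` B i).
    exact: (measurable_preimageT (measurable_rot _ _)).
  have := @unif_normal_seq_eq R N (fun i => rot (c i) (s i) @^-1` B i) B mrB mB.
  by apply=> i; rewrite std_normal2_rot.
- by move=> _; rewrite -[X in (X < _)%E]/(seq_prob setT) probability_setT ltry.
Qed.

End sequence_space.

(** * Moments and limits of Gaussian laws *)

Section moments.
Context {R : realType}.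
Local Notation T := (measurableTypeR R).
Local Notation mu := (@lebesgue_measure R).

(* Tonelli on the region below the graph of f. *)
Lemma integral_std_normal (f : R -> R) : measurable_fun setT f ->
  (forall x, 0 <= f x) ->
  (\int[std_normal]_x (f x)%:E = \int[mu]_x (f x * normal_pdf 0 1 x)%:E)%E.
Proof.
move=> mf f0.
have len (x : R) : (\int[mu]_t (\1_[set t | 0 <= t < f x] t)%:E = (f x)%:E)%E.
  have -> : [set t | 0 <= t < f x] = `[0, f x[%classic.
    by apply/seteqP; split => t; rewrite /= in_itv.
  transitivity (mu `[0, f x[%classic); first by rewrite integral_indic // setIT.
  rewrite lebesgue_measure_itv /= lte_fin; case: ltP => [_|fx0].
    by rewrite sube0.
  by congr EFin; apply/eqP; rewrite eq_le fx0 f0.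
pose E : set (R * T) := [set z | 0 <= z.2 < f z.1].
have mE : measurable E.
  rewrite (_ : E = (fun z : R * T => (0 <= z.2) && (z.2 < f z.1)) @^-1` [set true]).
    apply: measurable_preimageT => //; apply: measurable_and.
      exact: (@measurable_fun_ler _ (R * T)%type R setT (cst 0) snd
        (measurable_cst _) (@measurable_snd _ _ R T)).
    exact: (@measurable_fun_ltr _ (R * T)%type R setT snd (f \o fst)
      (@measurable_snd _ _ R T) (measurableT_comp mf (@measurable_fst _ _ R T))).
  by apply/seteqP; split => z.
have mI : measurable_fun [set: R * T] (fun z => (\1_E z)%:E : \bar R).
  by apply/measurable_EFinP; exact: measurable_indic.
transitivity (\int[std_normal]_x \int[mu]_t (\1_E (x, t))%:E)%E.
  by apply: eq_integral => x _; rewrite -len.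
rewrite (@fubini_tonelli _ _ R T R std_normal mu (fun z => (\1_E z)%:E)) //.
transitivity (\int[mu]_t \int[mu]_x ((\1_E (x, t) * normal_pdf 0 1 x)%:E))%E.
  apply: eq_integral => t _.
  have mEt : measurable [set x : R | E (x, t)].
    apply: (@measurable_preimageT _ _ R (R * T)%type (fun x => (x, t)) E) => //;
    exact: (@measurable_fun_pair _ _ _ R R T id (cst t)).
  transitivity (std_normal [set x : R | E (x, t)]).
    rewrite -[LHS]/(\int[std_normal]_x (\1_[set x | E (x, t)] x)%:E)%E.
    by rewrite integral_indic // setIT.
  rewrite image_probabilityE /= /normal_prob integral_mkcond.
  apply: eq_integral => x _; rewrite patchE indicE.
  rewrite (_ : (x \in _) = ((x, t) \in E)); last by apply/idP/idP; rewrite !inE.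
  by case: ifP => _; rewrite ?mul1r ?mul0r.
have mg : measurable_fun [set: T * T] (fun z : T * T => (\1_E z * normal_pdf 0 1 z.1)%:E).
  apply/measurable_EFinP; apply: (@measurable_funM _ (T * T)%type R setT).
    exact: (@measurable_indic _ (T * T)%type R).
  apply: (measurableT_comp (@measurable_normal_pdf R 0 1)).
  exact: (@measurable_fst _ _ T T).
have g0 (z : T * T) : (0 <= (\1_E z * normal_pdf 0 1 z.1)%:E)%E.
  by rewrite lee_fin mulr_ge0 ?normal_pdf_ge0.
rewrite -(@fubini_tonelli _ _ T T R mu mu _ mg g0).
apply: eq_integral => x _; rewrite EFinM -len muleC -ge0_integralZl //=.
- by apply: eq_integral => t _; rewrite muleC EFinM.
- apply/measurable_EFinP; apply: measurable_indic.
  exact: (measurable_preimageT (@measurable_pair1 _ _ R T x) mE).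
- by rewrite lee_fin normal_pdf_ge0.
Qed.

(** From y / 4 <= exp(y / 4) with y = x^2 comes x^2 exp(-x^2/2) <= 4 exp(-x^2/4), a multiple of the
    normal density of variance 2. The constant [c] is 4 times the ratio of the two peaks. *)
Lemma integrable_sqr_std_normal :
  std_normal.-integrable setT (fun x : R => (x ^+ 2)%:E).
Proof.
apply/integrableP; split; first by apply/measurable_EFinP; exact: measurable_funX.
under eq_integral => x _ do rewrite gee0_abs ?lee_fin ?sqr_ge0 //.
rewrite integral_std_normal; [|exact: measurable_funX|by move=> x; exact: sqr_ge0].
have s20 : Num.sqrt (2 : R) != 0 by rewrite gt_eqF // sqrtr_gt0.
pose c := 4 * normal_peak 1 / normal_peak (Num.sqrt (2 : R)).
have p2 := @normal_peak_gt0 R _ s20.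
have p1 := @normal_peak_gt0 R 1 (oner_neq0 _).
have c0 : 0 <= c by apply/ltW; rewrite /c divr_gt0 // mulr_gt0.
apply: (@le_lt_trans _ _ (\int[mu]_x (c%:E * (normal_pdf 0 (Num.sqrt 2) x)%:E))%E); last first.
  rewrite ge0_integralZl //.
  - by rewrite integral_normal_pdf mule1 ltry.
  - by apply/measurable_EFinP; exact: measurable_normal_pdf.
  - by move=> x _; rewrite lee_fin normal_pdf_ge0.
apply: ge0_le_integral => //.
- by move=> x _; rewrite lee_fin mulr_ge0 ?sqr_ge0 ?normal_pdf_ge0.
- apply/measurable_EFinP; apply: measurable_funM; first exact: measurable_funX.
  exact: measurable_normal_pdf.
- apply/measurable_EFinP; apply: measurable_funM => //.
  exact: measurable_normal_pdf.
- move=> x _; rewrite -EFinM lee_fin !normal_pdfE ?oner_neq0 // /c.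
  rewrite [leRHS](_ : _ = normal_peak 1 * (4 * normal_fun 0 (Num.sqrt 2) x)); last first.
    by field; rewrite gt_eqF.
  rewrite mulrCA ler_pM2l // /normal_fun !subr0 sqr_sqrtr // expr1n.
  set y := x ^+ 2.
  have -> : - y / (1 *+ 2) = - y / (2 *+ 2) + - y / (2 *+ 2) by field.
  rewrite expRD mulrA ler_pM2r ?expR_gt0 //.
  rewrite mulNr expRN ler_pdivrMr ?expR_gt0 //.
  have := expR_ge1Dx (y / (2 *+ 2)); lra.
Qed.

(* That this constant is 1 is not needed: the amplitudes are divided by its
   square root. *)
Definition normal_var : R := fine (\int[std_normal]_x (x ^+ 2)%:E)%E.

Lemma normal_varE : (\int[std_normal]_x (x ^+ 2)%:E = normal_var%:E)%E.
Proof. by rewrite fineK // integrable_fin_num //; exact: integrable_sqr_std_normal. Qed.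

Lemma normal_var_gt0 : 0 < normal_var.
Proof.
have s20 : (1 : R) != 0 by [].
rewrite -lte_fin -normal_varE integral_std_normal; [|exact: measurable_funX|by move=> x; exact: sqr_ge0].
pose c : R := normal_pdf 0 1 2.
have c0 : 0 < c by rewrite /c normal_pdfE // mulr_gt0 ?normal_peak_gt0 ?expR_gt0.
apply: (@lt_le_trans _ _ (\int[mu]_(x in `[1%R, 2%R]) c%:E)%E).
  rewrite integral_cst //=.
  rewrite lebesgue_measure_itv /= lte_fin ltr1n -EFinB -EFinM lte_fin mulr_gt0 //; lra.
apply: (@le_trans _ _ (\int[mu]_(x in `[1%R, 2%R]) (x ^+ 2 * normal_pdf 0 1 x)%:E)%E).
  apply: ge0_le_integral => //.
  - by move=> x _; rewrite lee_fin ltW.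
  - apply: measurable_funTS; apply/measurable_EFinP; apply: measurable_funM; first exact: measurable_funX.
    exact: measurable_normal_pdf.
  - move=> x /=; rewrite in_itv /= => /andP[x1 x2]; rewrite lee_fin /c !normal_pdfE //.
    rewrite mulrCA ler_pM2l ?normal_peak_gt0 // /normal_fun !subr0.
    apply: (@le_trans _ _ (expR (- x ^+ 2 / (1 ^+ 2 *+ 2)))).
      by rewrite ler_expR ler_pM2r ?invr_gt0 // lerN2; nra.
    by rewrite ler_peMl ?expR_ge0 // exprn_ege1.
apply: ge0_subset_integral => //.
- apply/measurable_EFinP; apply: measurable_funM; first exact: measurable_funX.
  exact: measurable_normal_pdf.
- by move=> x _; rewrite lee_fin mulr_ge0 ?sqr_ge0 ?normal_pdf_ge0.
Qed.

End moments.

Section scaled_law.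
Context {R : realType}.

Lemma std_normal_opp (A : set R) : measurable A ->
  std_normal (-%R @^-1` A) = std_normal A.
Proof.
move=> mA.
have proj (B : set R) : measurable B -> std_normal2 (B `*` setT) = std_normal B.
  move=> mB; transitivity (std_normal B * std_normal setT)%E.
    exact: product_measure1E.
  by rewrite probability_setT mule1.
have mNA : measurable (-%R @^-1` A).
  by apply: measurable_preimageT => //; exact: (@measurable_funN _ R R setT id).
have c1 : (-1 : R) ^+ 2 + 0 ^+ 2 = 1 by rewrite sqrrN expr1n expr0n addr0.
have mAT : measurable (A `*` [set: R]) by exact: measurableX.
transitivity (std_normal2 ((-%R @^-1` A) `*` setT)); first by rewrite proj.
transitivity (std_normal2 (A `*` setT)); last by rewrite proj.
transitivity (std_normal2 (rot (-1) 0 @^-1` (A `*` setT))).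
  congr (std_normal2 _); apply/seteqP.
  by split => -[x y] /=; rewrite mulN1r mul0r subr0.
exact: std_normal2_rot c1 mAT.
Qed.

Lemma integrable_std_normal : std_normal.-integrable setT (fun x : R => x%:E).
Proof.
apply: (@le_integrable _ _ _ _ _ _ _ (fun x : R => (1 + x ^+ 2)%:E)) => //.
- by apply/measurable_EFinP; exact: measurable_id.
- move=> x _ /=; rewrite lee_fin [leRHS]ger0_norm ?addr_ge0 ?sqr_ge0 //.
  by rewrite ler_norml; nra.
- under eq_fun do rewrite EFinD.
  apply: integrableD => //; last exact: integrable_sqr_std_normal.
  apply/integrableP; split => //.
  by rewrite integral_cst //= probability_setT mule1 normr1 ltry.
Qed.

(** By symmetry the integral equals its own opposite; integrability rules out the infinite
    values. *)
Lemma mean_std_normal : (\int[std_normal]_x x%:E = 0 :> \bar R)%E.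
Proof.
have mN : measurable_fun setT (-%R : R -> R) by exact: (@measurable_funN _ R R setT id).
have intN : std_normal.-integrable setT (fun x : R => (- x)%:E).
  by under eq_fun do rewrite EFinN; apply: integrableN; exact: integrable_std_normal.
have E : (\int[std_normal]_x x%:E = - \int[std_normal]_x x%:E :> \bar R)%E.
  rewrite -integralN; last first.
    by apply: integrable_add_def => //; exact: integrable_std_normal.
  transitivity (\int[image_probability std_normal mN]_x x%:E)%E.
    by apply: eq_measure_integral => A mA _; first [exact: std_normal_opp|apply/esym; exact: std_normal_opp].
  by rewrite integral_distribution.
have : (\int[std_normal]_x x%:E)%E \is a @fin_num R.
  by apply: integrable_fin_num => //; exact: integrable_std_normal.
move: E; case: (\int[_]_x _)%E => // r [E] _; congr EFin; lra.
Qed.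

Section law.
Context d (T : measurableType d) (P : probability T R) (X : T -> R) (r : R).
Hypothesis mX : measurable_fun setT X.
Hypothesis lawX : forall B, measurable B -> P (X @^-1` B) = scaled_normal r B.

Lemma ge0_integral_law (g : R -> \bar R) : measurable_fun setT g ->
  (forall x, 0 <= g x)%E ->
  (\int[P]_w g (X w) = \int[std_normal]_x g (r * x)%R)%E.
Proof.
move=> mg g0.
transitivity (\int[image_probability P mX]_x g x)%E.
  by rewrite ge0_integral_distribution.
transitivity (\int[scaled_normal r]_x g x)%E.
  by apply: eq_measure_integral => A mA _; first [exact: lawX|apply/esym; exact: lawX].
by rewrite ge0_integral_distribution.
Qed.

Lemma integrable_law (g : R -> \bar R) : measurable_fun setT g ->
  std_normal.-integrable setT (fun x => g (r * x)) ->
  P.-integrable setT (g \o X).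
Proof.
move=> mg /integrableP[_ ig]; apply/integrableP; split.
  exact: measurableT_comp mg mX.
rewrite (@ge0_integral_law (fun x => `|g x|)%E) //.
exact: measurableT_comp.
Qed.

Lemma integral_law (g : R -> \bar R) : measurable_fun setT g ->
  std_normal.-integrable setT (fun x => g (r * x)) ->
  (\int[P]_w g (X w) = \int[std_normal]_x g (r * x)%R)%E.
Proof.
move=> mg ig.
transitivity (\int[image_probability P mX]_x g x)%E.
  by rewrite integral_distribution //; exact: integrable_law.
transitivity (\int[scaled_normal r]_x g x)%E.
  by apply: eq_measure_integral => A mA _; first [exact: lawX|apply/esym; exact: lawX].
by rewrite integral_distribution.
Qed.

Lemma law_mean : (\int[P]_w (X w)%:E = 0)%E.
Proof.
rewrite (@integral_law EFin).
- under eq_integral do rewrite EFinM.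
  by rewrite integralZl ?mean_std_normal ?mule0 //; exact: integrable_std_normal.
- by apply/measurable_EFinP; exact: measurable_id.
- under eq_fun do rewrite EFinM; apply: integrableZl => //.
  exact: integrable_std_normal.
Qed.

Lemma law_sqr_integrable : P.-integrable setT (fun w => (X w ^+ 2)%:E).
Proof.
apply: (@integrable_law (fun x => (x ^+ 2)%:E)).
  by apply/measurable_EFinP; exact: measurable_funX.
under eq_fun do rewrite exprMn EFinM; apply: integrableZl => //.
exact: integrable_sqr_std_normal.
Qed.

Lemma law_sqr_mean : (\int[P]_w (X w ^+ 2)%:E = (r ^+ 2 * normal_var)%:E)%E.
Proof.
rewrite (@ge0_integral_law (fun x => (x ^+ 2)%:E)).
- under eq_integral do rewrite exprMn EFinM.
  by rewrite integralZl ?normal_varE //; exact: integrable_sqr_std_normal.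
- by apply/measurable_EFinP; exact: measurable_funX.
- by move=> x; rewrite lee_fin sqr_ge0.
Qed.

End law.

End scaled_law.

(** * Limits of normal laws under almost sure convergence *)

Section law_limit.
Context {R : realType}.

Lemma bounded_convergence d (T : measurableType d) (P : probability T R)
    (f_ : nat -> T -> R) (f : T -> R) (M : R) :
  (forall n, measurable_fun setT (f_ n)) -> measurable_fun setT f ->
  (forall n x, `|f_ n x| <= M) ->
  {ae P, forall x, f_ n x @[n --> \oo] --> f x} ->
  (\int[P]_x (f_ n x)%:E @[n --> \oo] --> \int[P]_x (f x)%:E)%E.
Proof.
move=> mf_ mf bf cf.
have [] := @dominated_convergence _ _ _ P setT measurableT
  (fun n x => (f_ n x)%:E) (fun x => (f x)%:E) (fun=> M%:E) => //.
- by move=> n; apply/measurable_EFinP.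
- by apply/measurable_EFinP.
- apply: filterS cf => x cx _; apply/fine_cvgP; split; first exact: nearW.
  exact: cx.
- apply/integrableP; split => //.
  by rewrite integral_cst //= probability_setT mule1 ltry.
- by apply/aeW => x n _; rewrite lee_fin.
Qed.

Lemma clip01E (x : R) : clip01 x = (`|x| - `|x - 1| + 1) / 2.
Proof.
have [x0|x0] := leP x 0.
  by rewrite clip01_le0 // (ler0_norm x0) (ler0_norm (x := x - 1)); lra.
have [x1|x1] := leP 1 x.
  by rewrite clip01_ge1 // (gtr0_norm x0) (ger0_norm (x := x - 1)); lra.
by rewrite clip01_id ?(gtr0_norm x0) ?(ltr0_norm (x := x - 1)); lra.
Qed.

Lemma continuous_clip01 : continuous (@clip01 R).
Proof.
rewrite (_ : @clip01 R = fun x => (`|x| - `|x - 1| + 1) / 2) => [x|]; last first.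
  by apply/funext => x; exact: clip01E.
apply: cvgMl; apply: (@cvgD _ R^o); last exact: cvg_cst.
apply: (@cvgB _ R^o); apply: (@cvg_norm _ R^o); first exact: cvg_id.
by apply: (@cvgB _ R^o); [exact: cvg_id|exact: cvg_cst].
Qed.

Lemma clip01_bounds (x : R) : 0 <= clip01 x <= 1.
Proof. by rewrite /clip01 le_min ler01 le_max lexx ge_min lexx. Qed.

(** A continuous approximation of the indicator of ]-oo, x]: it is 1 up to x and, for k > 0, 0 from
    x + 1/k on. *)
Let ramp (x : R) (k : nat) (y : R) : R := clip01 (k%:R * (x - y) + 1).

Let continuous_ramp x k : continuous (ramp x k).
Proof.
move=> y; apply: (continuous_comp (f := fun y : R => k%:R * (x - y) + 1)).
  apply: (@cvgD _ R^o); last exact: cvg_cst.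
  by apply: cvgMr; apply: (@cvgB _ R^o); [exact: cvg_cst|exact: cvg_id].
exact: continuous_clip01.
Qed.

Let ramp_norm x k y : `|ramp x k y| <= 1.
Proof. by have /andP[r0 r1] := clip01_bounds (k%:R * (x - y) + 1); rewrite ger0_norm. Qed.

Let cvg_ramp x y : ramp x k y @[k --> \oo] --> (\1_`]-oo, x]%classic y : R).
Proof.
rewrite indicE; case: (boolP (y \in _)) => [|].
  rewrite inE /= in_itv /= => yx; apply: cvg_near_cst; apply: nearW => k.
  by apply/eqP; rewrite /ramp clip01_ge1 // lerDr mulr_ge0 // subr_ge0.
rewrite notin_setE /= in_itv /= => /negP; rewrite -ltNge => xy.
apply: cvg_near_cst; near=> k; apply/eqP; rewrite /ramp clip01_le0 //.
rewrite -lerBrDr sub0r -mulrNN opprB mulNr lerN2.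
rewrite -ler_pdivrMr ?subr_gt0 // div1r; near: k.
exact: nbhs_infty_ger.
Unshelve. all: by end_near. Qed.

(** Two limits taken in this order: n goes to infinity for a fixed ramp, where continuity lets
    bounded convergence apply to both sides, and then the ramps converge to the indicator, which
    yields equality of the distribution functions. *)
Lemma law_limit d (T : measurableType d) (P : probability T R)
    (S_ : nat -> T -> R) (S : T -> R) (r_ : nat -> R) (r : R) :
  (forall n, measurable_fun setT (S_ n)) -> measurable_fun setT S ->
  {ae P, forall w, S_ n w @[n --> \oo] --> S w} ->
  (forall n A, measurable A -> P (S_ n @^-1` A) = scaled_normal (r_ n) A) ->
  r_ n @[n --> \oo] --> r ->
  forall A, measurable A -> P (S @^-1` A) = scaled_normal r A.
Proof.
move=> mS_ mS cS lawS cr.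
apply: (@probability_eq_cdf _ (image_probability P mS) (scaled_normal r)) => x.
have mramp k : measurable_fun setT (ramp x k).
  by apply: continuous_measurable_fun; exact: continuous_ramp.
have eq_ramp k : (\int[P]_w (ramp x k (S w))%:E = \int[std_normal]_y (ramp x k (r * y))%:E)%E.
  have c1 : (\int[P]_w (ramp x k (S_ n w))%:E @[n --> \oo] -->
      \int[P]_w (ramp x k (S w))%:E)%E.
    apply: (@bounded_convergence _ _ P (fun n w => ramp x k (S_ n w)) _ 1) => //.
    - by move=> n; exact: measurableT_comp (mramp k) (mS_ n).
    - exact: measurableT_comp (mramp k) mS.
    - by apply: filterS cS => w cw; apply: continuous_cvg cw; exact: continuous_ramp.
  have c2 : (\int[std_normal]_y (ramp x k (r_ n * y))%:E @[n --> \oo] -->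
      \int[std_normal]_y (ramp x k (r * y))%:E)%E.
    apply: (@bounded_convergence _ _ std_normal (fun n y => ramp x k (r_ n * y)) _ 1) => //.
    - by move=> n; exact: measurableT_comp (mramp k) (measurable_scale (r_ n)).
    - exact: measurableT_comp (mramp k) (measurable_scale r).
    - apply/aeW => y; apply: continuous_cvg; first exact: continuous_ramp.
      exact: cvgMl.
  have E n : (\int[P]_w (ramp x k (S_ n w))%:E = \int[std_normal]_y (ramp x k (r_ n * y))%:E)%E.
    apply: (@ge0_integral_law _ _ _ P (S_ n) (r_ n) (mS_ n) (lawS n) (fun y => (ramp x k y)%:E)).
      by apply/measurable_EFinP.
    by move=> y; rewrite lee_fin; case/andP: (clip01_bounds (k%:R * (x - y) + 1)).
  rewrite (funext E) in c1.
  exact: (cvg_unique (@ereal_hausdorff R) c1 c2).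
have lim_cdf d' (T' : measurableType d') (Q : probability T' R) (Y : T' -> R) :
    measurable_fun setT Y ->
    (\int[Q]_w (ramp x k (Y w))%:E @[k --> \oo] --> Q (Y @^-1` `]-oo, x]))%E.
  move=> mY; have -> : Q (Y @^-1` `]-oo, x]) = (\int[Q]_w (\1_`]-oo, x]%classic (Y w))%:E)%E.
    rewrite -[in LHS](setIT (Y @^-1` _)) -integral_indic //.
    exact: (measurable_preimageT mY).
  apply: (@bounded_convergence _ _ Q (fun k w => ramp x k (Y w)) _ 1) => //.
  - by move=> n; exact: measurableT_comp (mramp n) mY.
  - by apply: measurableT_comp mY; exact: measurable_indic.
  - by apply/aeW => w; exact: cvg_ramp.
have c1 := lim_cdf _ _ P S mS.
have c2 := lim_cdf _ _ std_normal _ (measurable_scale r).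
rewrite (funext eq_ramp) in c1.
exact: (cvg_unique (@ereal_hausdorff R) c1 c2).
Qed.

End law_limit.

(** * Random Fourier series *)

Section dominated_series.
Context {R : realType}.
Implicit Types (u v : nat -> R).

Lemma bounded_series_cvg v (M : R) : (forall j, 0 <= v j) ->
  (forall N, series v N <= M) -> cvgn (series v).
Proof.
move=> v0 vM; apply: nondecreasing_is_cvgn.
  by apply/nondecreasing_series => j _ _; exact: v0.
by exists M => _ [N _ <-]; exact: vM.
Qed.

Lemma series_le_lim v N : (forall j, 0 <= v j) -> cvgn (series v) ->
  series v N <= limn (series v).
Proof.
move=> v0 cv; apply: nondecreasing_cvgn_le cv _ => //.
by apply/nondecreasing_series => j _ _; exact: v0.
Qed.

Lemma dominated_series_cvg u v : (forall j, `|u j| <= v j) ->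
  cvgn (series v) -> cvgn (series u).
Proof.
move=> uv cv; apply: normed_cvg.
apply: (@series_le_cvg _ (fun j => `|u j|) v) => // j.
exact: le_trans (normr_ge0 (u j)) (uv j).
Qed.

Lemma dominated_series_tail u v N : (forall j, `|u j| <= v j) ->
  cvgn (series v) ->
  `|limn (series u) - series u N| <= limn (series v) - series v N.
Proof.
move=> uv cv; have cu := dominated_series_cvg uv cv.
have v0 j : 0 <= v j by exact: le_trans (normr_ge0 (u j)) (uv j).
have c1 : `|series u n - series u N| @[n --> \oo] --> `|limn (series u) - series u N|.
  by apply: (@cvg_norm _ R^o); apply: (@cvgB _ R^o) => //; exact: cvg_cst.
have c2 : series v n - series v N @[n --> \oo] --> limn (series v) - series v N.
  by apply: (@cvgB _ R^o) => //; exact: cvg_cst.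
rewrite -(cvg_lim _ c1) // -(cvg_lim _ c2) //.
apply: ler_lim; [by apply/cvg_ex; eexists; exact: c1|by apply/cvg_ex; eexists; exact: c2|].
near=> n; have Nn : (N <= n)%N by near: n; exact: nbhs_infty_ge.
rewrite !sub_series_geq //.
by apply: le_trans (ler_norm_sum _ _ _) _; apply: ler_sum.
Unshelve. all: by end_near. Qed.

End dominated_series.

Section waves.
Context {R : realType}.

(** A bound of [wave l t z] uniform in [t] and invariant under rotations of [z]: the first property
    gives continuous paths, the second the invariance of [good] under time shifts. *)
Definition amp (z : R * R) : R := Num.sqrt (z.1 ^+ 2 + z.2 ^+ 2).

Definition wave (l t : R) (z : R * R) : R :=
  z.1 * cos (2 * pi * l * t) + z.2 * sin (2 * pi * l * t).

Lemma amp_ge0 z : 0 <= amp z. Proof. exact: sqrtr_ge0. Qed.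

Lemma amp_rot c s z : c ^+ 2 + s ^+ 2 = 1 -> amp (rot c s z) = amp z.
Proof.
move=> cs; congr Num.sqrt; rewrite /rot /=.
transitivity ((c ^+ 2 + s ^+ 2) * (z.1 ^+ 2 + z.2 ^+ 2)); first by ring.
by rewrite cs mul1r.
Qed.

Lemma wave_amp l t z : `|wave l t z| <= amp z.
Proof.
rewrite -sqrtr_sqr ler_wsqrtr // /wave.
have := cos2Dsin2 (2 * pi * l * t).
set c := cos _; set s := sin _ => cs.
have -> : z.1 ^+ 2 + z.2 ^+ 2 = (z.1 * c + z.2 * s) ^+ 2 + (z.1 * s - z.2 * c) ^+ 2.
  transitivity ((c ^+ 2 + s ^+ 2) * (z.1 ^+ 2 + z.2 ^+ 2)); last by ring.
  by rewrite cs mul1r.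
by rewrite lerDl sqr_ge0.
Qed.

Lemma wave_shift l t h z :
  wave l (t + h) z = wave l t (rot (cos (2 * pi * l * h)) (- sin (2 * pi * l * h)) z).
Proof. by rewrite /wave /rot /= mulrDr cosD sinD; ring. Qed.

Lemma measurable_amp : measurable_fun setT amp.
Proof.
apply: (measurableT_comp (f := @Num.sqrt R)).
  by apply: nondecreasing_measurable => // x y; exact: ler_wsqrtr.
by apply: measurable_funD; exact: measurable_funX.
Qed.

Lemma measurable_wave l t : measurable_fun setT (wave l t).
Proof. by apply: measurable_funD; exact: measurable_funM. Qed.

Lemma continuous_wave l z : continuous (fun t => wave l t z).
Proof.
move=> t; have lin : (fun t => 2 * pi * l * t) @ t --> 2 * pi * l * t.
  by apply: cvgMr; exact: cvg_id.
apply: (@cvgD _ R^o); apply: cvgMr.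
  by apply: continuous_cvg lin; exact: continuous_cos.
by apply: continuous_cvg lin; exact: continuous_sin.
Qed.

End waves.

Section process.
Context {R : realType}.
Variables (a lam : nat -> R) (C : R).
Hypothesis a0 : forall j, 0 <= a j.
Hypothesis aC : forall N, series a N <= C.

Local Notation P := (@seq_prob R).
Local Notation Omega := (@seq_space R).
Implicit Types (w : Omega) (t : R).

Definition amp_series w (N : nat) : R := series (fun j => a j * amp (w j)) N.

(* This almost sure event depends on the amplitudes only, so that the rotations
   of the coefficients that implement a time shift preserve it. *)
Definition good w : bool := `[< exists M : nat, forall N, amp_series w N <= M%:R >].

Definition partial_process N t w : R := series (fun j => a j * wave (lam j) t (w j)) N.

(** With the value 0 off the event [good], all paths are continuous, as [continuous_process]
    requires of every [w], and [process_shift] holds pointwise rather than almost surely. *)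
Definition process t w : R :=
  if good w then limn (fun N => partial_process N t w) else 0.

Lemma measurable_amp_series N : measurable_fun setT (amp_series ^~ N).
Proof.
apply: measurable_sum => j; apply: measurable_funM => //.
exact: measurableT_comp measurable_amp (measurable_coord j).
Qed.

Lemma measurable_partial_process N t : measurable_fun setT (partial_process N t).
Proof.
apply: measurable_sum => j; apply: measurable_funM => //.
exact: measurableT_comp (measurable_wave _ _) (measurable_coord j).
Qed.

Lemma measurable_good : measurable_fun setT good.
Proof.
apply: (measurable_fun_bool true).
rewrite setTI (_ : _ @^-1` _ =
  \bigcup_M \bigcap_N ((amp_series ^~ N) @^-1` `]-oo, M%:R])).
  apply: bigcupT_measurable => M; apply: bigcapT_measurable => N.
  exact: (measurable_preimageT (measurable_amp_series N)).
apply/seteqP; split => w /=.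
  by move=> /asboolP[M wM]; exists M => // N _; rewrite /= in_itv /=.
move=> [M _ wM]; apply/asboolP; exists M => N.
by have := wM N I; rewrite /= in_itv.
Qed.

Let amp_term_ge0 w j : 0 <= a j * amp (w j).
Proof. by rewrite mulr_ge0 ?amp_ge0. Qed.

Lemma good_cvg w : good w -> cvgn (amp_series w).
Proof. by move=> /asboolP[M wM]; exact: bounded_series_cvg wM. Qed.

Let term_le w t j : `|a j * wave (lam j) t (w j)| <= a j * amp (w j).
Proof. by rewrite normrM ger0_norm // ler_wpM2l // wave_amp. Qed.

Lemma cvg_partial_process w t : good w ->
  partial_process N t w @[N --> \oo] --> process t w.
Proof.
move=> gw; rewrite /process gw.
exact: dominated_series_cvg (term_le w t) (good_cvg gw).
Qed.

Lemma measurable_process t : measurable_fun setT (process t).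
Proof.
apply: (@measurable_fun_cvg _ _ _ _
  (fun N w => if good w then partial_process N t w else 0)) => [N|w _].
  apply: measurable_fun_ifT => //; first exact: measurable_good.
  exact: measurable_partial_process.
rewrite /process; case: ifPn => gw; last exact: cvg_cst.
by have := cvg_partial_process (t := t) gw; rewrite /process gw.
Qed.

Lemma continuous_process_path w : continuous (process ^~ w).
Proof.
rewrite /process; case: (boolP (good w)) => gw; last by move=> t; exact: cvg_cst.
move=> t; apply/cvgrPdist_lt => e e0.
pose L := limn (amp_series w).
have [N _ NL] : \forall N \near \oo, L - e / 3 < amp_series w N.
  apply: cvgr_gt (good_cvg gw) _ _; rewrite ltrBlDr ltrDl; lra.
have tail s : `|limn (fun N => partial_process N s w) - partial_process N s w| < e / 3.
  have := dominated_series_tail N (term_le w s) (good_cvg gw).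
  have := NL N (leqnn N); rewrite /= -/(amp_series w N) -/L => ? ?.
  apply: le_lt_trans; first by eassumption.
  by rewrite -/(amp_series w N); lra.
have cS : partial_process N s w @[s --> t] --> partial_process N t w.
  rewrite /partial_process /series /=; elim: N {NL tail} => [|N IH].
    by under eq_fun do rewrite big_nil; rewrite big_nil; exact: cvg_cst.
  under eq_fun do rewrite big_nat_recr //=; rewrite big_nat_recr //=.
  apply: (@cvgD _ R^o); first exact: IH.
  by apply: cvgMr; exact: continuous_wave.
near=> s.
have : `|partial_process N t w - partial_process N s w| < e / 3.
  by near: s; move/cvgrPdist_lt: cS; apply; lra.
have := tail t; have := tail s; rewrite !ltr_norml; lra.
Unshelve. all: by end_near. Qed.

Lemma process_shift h t w :
  process (t + h) w =
  process t (seq_rot (fun j => cos (2 * pi * lam j * h))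
                     (fun j => - sin (2 * pi * lam j * h)) w).
Proof.
have cs j : cos (2 * pi * lam j * h) ^+ 2 + (- sin (2 * pi * lam j * h)) ^+ 2 = 1.
  by rewrite sqrrN cos2Dsin2.
pose w' := seq_rot (fun j => cos (2 * pi * lam j * h))
                   (fun j => - sin (2 * pi * lam j * h)) w.
have E N : amp_series w' N = amp_series w N.
  by apply: eq_bigr => j _; rewrite /w' /seq_rot amp_rot.
have gE : good w' = good w.
  by apply: asbool_equiv_eq; split => -[M H]; exists M => N; [rewrite -E|rewrite E].
rewrite /process -/w' gE.
case: ifP => // _; congr (limn _); apply/funext => N.
by apply: eq_bigr => j _; rewrite wave_shift.
Qed.

End process.

Lemma cvg_sum_seq (R : realType) (I : Type) (r : seq I) (f : I -> nat -> R) (l : I -> R) :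
  (forall i, f i n @[n --> \oo] --> l i) ->
  \sum_(i <- r) f i n @[n --> \oo] --> \sum_(i <- r) l i.
Proof.
move=> fl; elim: r => [|i r IH].
  by under eq_fun do rewrite big_nil; rewrite big_nil; exact: cvg_cst.
under eq_fun do rewrite big_cons; rewrite big_cons.
by apply: (@cvgD _ R^o).
Qed.

Section seq_prob_laws.
Context {R : realType}.
Local Notation P := (@seq_prob R).
Local Notation Omega := (@seq_space R).

Definition seq_sum (b c : nat -> R) N (w : Omega) : R :=
  \sum_(j < N) (b j * (w j).1 + c j * (w j).2).

Lemma measurable_seq_sum b c N : measurable_fun setT (seq_sum b c N).
Proof.
apply: measurable_sum => j; apply: measurable_funD; apply: measurable_funM => //.
  exact: measurableT_comp measurable_fst (measurable_coord j).
exact: measurableT_comp measurable_snd (measurable_coord j).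
Qed.

Lemma seq_sum_law (b c : nat -> R) N (A : set R) : measurable A ->
  P (seq_sum b c N @^-1` A) =
  scaled_normal (Num.sqrt (\sum_(j < N) (b j ^+ 2 + c j ^+ 2))) A.
Proof. exact: unif_normal_sum. Qed.

Lemma coord_sqr_mean (e : bool) (j : nat) :
  (\int[P]_w ((if e then (w j).1 else (w j).2) ^+ 2)%:E = normal_var%:E)%E.
Proof.
pose b i : R := ((i == j) && e)%:R; pose c i : R := ((i == j) && ~~ e)%:R.
have small (i : 'I_j) : (i == j :> nat) = false by rewrite ltn_eqF.
have E w : (if e then (w j).1 else (w j).2) = seq_sum b c j.+1 w.
  rewrite /seq_sum big_ord_recr big1 => [|i _]; rewrite /b /c /=.
    by rewrite eqxx add0r; case: (e); rewrite /= mul1r mul0r ?addr0 ?add0r.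
  by rewrite small !mul0r addr0.
have r1 : \sum_(i < j.+1) (b i ^+ 2 + c i ^+ 2) = 1.
  rewrite big_ord_recr big1 => [|i _]; rewrite /b /c /=.
    by rewrite eqxx add0r; case: (e); rewrite /= expr1n expr0n ?addr0 ?add0r.
  by rewrite small expr0n addr0.
under eq_integral do rewrite E.
rewrite (@law_sqr_mean _ _ _ P (seq_sum b c j.+1) 1) ?expr1n ?mul1r //.
  exact: measurable_seq_sum.
by move=> B mB; rewrite seq_sum_law // r1 sqrtr1.
Qed.

Variables (a lam : nat -> R) (C : R).
Hypothesis a0 : forall j, 0 <= a j.
Hypothesis aC : forall N, series a N <= C.

Let mterm j : measurable_fun setT (fun w : Omega => (a j * amp (w j))%:E).
Proof.
apply/measurable_EFinP; apply: measurable_funM => //.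
exact: measurableT_comp measurable_amp (measurable_coord j).
Qed.

Let term0 j (w : Omega) : (0 <= (a j * amp (w j))%:E)%E.
Proof. by rewrite lee_fin mulr_ge0 ?amp_ge0. Qed.

Let mean_term j : (\int[P]_w (a j * amp (w j))%:E <= (a j * (1 + 2 * normal_var))%:E)%E.
Proof.
pose g (w : Omega) : R := a j * (1 + ((w j).1 ^+ 2 + (w j).2 ^+ 2)).
have m1 : measurable_fun setT (fun w : Omega => (w j).1 ^+ 2).
  by apply: measurable_funX; exact: measurableT_comp measurable_fst (measurable_coord j).
have m2 : measurable_fun setT (fun w : Omega => (w j).2 ^+ 2).
  by apply: measurable_funX; exact: measurableT_comp measurable_snd (measurable_coord j).
have M1 : measurable_fun setT (fun w : Omega => ((w j).1 ^+ 2)%:E) by exact/measurable_EFinP.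
have M1' : measurable_fun setT (fun w : Omega => ((w j).2 ^+ 2)%:E) by exact/measurable_EFinP.
have M2 := emeasurable_funD M1 M1'.
have M3 := emeasurable_funD (measurable_cst (1%E : \bar R)) M2.
apply: (@le_trans _ _ (\int[P]_w (g w)%:E)%E).
  apply: ge0_le_integral => //.
    by apply/measurable_EFinP; apply: measurable_funM => //; apply: measurable_funD => //; exact: measurable_funD.
  move=> w _; rewrite lee_fin ler_wpM2l // /amp.
  set x := (w j).1 ^+ 2 + _; have x0 : 0 <= x by rewrite addr_ge0 ?sqr_ge0.
  have := sqr_sqrtr x0; have := sqrtr_ge0 x; nra.
rewrite le_eqVlt; apply/orP; left; apply/eqP.
under eq_integral do rewrite EFinM EFinD EFinD.
rewrite ge0_integralZl //; first last.
- by rewrite lee_fin.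
- by move=> w _; rewrite -!EFinD lee_fin !addr_ge0 ?sqr_ge0.
rewrite ge0_integralD //; first last.
- by move=> w _; rewrite -EFinD lee_fin !addr_ge0 ?sqr_ge0.
rewrite ge0_integralD //; first last.
- by move=> w _; rewrite lee_fin sqr_ge0.
- by move=> w _; rewrite lee_fin sqr_ge0.
have -> : (\int[P]_(w in [set: Omega]) (1%E : \bar R) = 1)%E.
  by rewrite integral_cst // mul1e; exact: probability_setT.
rewrite (coord_sqr_mean true j) (coord_sqr_mean false j) -!EFinD -EFinM.
by congr EFin; ring.
Qed.

(** The series of amplitudes has mean at most C (1 + 2 normal_var), since sqrt(x) <= 1 + x bounds
    the mean of [amp]; it is therefore finite almost everywhere. *)
Lemma ae_good : {ae P, forall w, good a w}.
Proof.
pose h (w : Omega) : \bar R := (\sum_(j <oo) (a j * amp (w j))%:E)%E.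
have mh : measurable_fun setT h by exact: ge0_emeasurable_sum.
have v0 : 0 <= 1 + 2 * (normal_var : R) by have := @normal_var_gt0 R; lra.
have ih : P.-integrable setT h.
  apply/integrableP; split => //.
  under eq_integral => w _ do rewrite gee0_abs ?nneseries_ge0 //.
  rewrite /h integral_nneseries //.
  apply: (@le_lt_trans _ _ (C * (1 + 2 * normal_var))%:E); last exact: ltry.
  apply: lime_le; first by apply: is_cvg_nneseries => j _ _; exact: integral_ge0.
  apply: nearW => N.
  apply: (@le_trans _ _ (\sum_(0 <= j < N) (a j * (1 + 2 * normal_var))%:E)%E).
    by apply: lee_sum => j _; exact: mean_term.
  by rewrite sumEFin lee_fin -mulr_suml ler_wpM2r //; exact: aC.
have := integrable_ae measurableT ih; apply: filterS => w /(_ I) fw.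
apply/asboolP; exists (Num.truncn (fine (h w))).+1 => N.
apply: (@le_trans _ _ (fine (h w))); last exact/ltW/truncnS_gt.
rewrite -lee_fin fineK // /amp_series /series /= -sumEFin.
exact: nneseries_lim_ge.
Qed.

End seq_prob_laws.

Section process_law.
Context {R : realType}.
Variables (a lam : nat -> R) (C : R).
Hypothesis a0 : forall j, 0 <= a j.
Hypothesis aC : forall N, series a N <= C.
Local Notation P := (@seq_prob R).
Local Notation Omega := (@seq_space R).

Variables (n : nat) (t c : 'I_n -> R).

Definition cos_coef (l : R) : R := \sum_(i < n) c i * cos (2 * pi * l * t i).
Definition sin_coef (l : R) : R := \sum_(i < n) c i * sin (2 * pi * l * t i).

(** Up to the factor [normal_var], the variance that frequency [lam j] contributes to the linear
    combination: a_j^2 times the squared modulus of the exponential sum with weights c and nodes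
    t. *)
Definition lin_power (j : nat) : R :=
  (a j * cos_coef (lam j)) ^+ 2 + (a j * sin_coef (lam j)) ^+ 2.

Lemma lin_power_ge0 j : 0 <= lin_power j.
Proof. by rewrite addr_ge0 ?sqr_ge0. Qed.

Lemma cvg_lin_power : cvgn (series lin_power).
Proof.
pose K := \sum_(i < n) `|c i|.
have a_le j : a j <= C.
  apply: le_trans (aC j.+1); rewrite /series /= big_nat_recr //= lerDr.
  by rewrite sumr_ge0.
have K0 : 0 <= K by rewrite sumr_ge0.
have cK l : `|cos_coef l| <= K.
  apply: le_trans (ler_norm_sum _ _ _) _; apply: ler_sum => i _.
  by rewrite normrM ler_piMr // ler_norml cos_geN1 cos_le1.
have sK l : `|sin_coef l| <= K.
  apply: le_trans (ler_norm_sum _ _ _) _; apply: ler_sum => i _.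
  by rewrite normrM ler_piMr // ler_norml sin_geN1 sin_le1.
have C0 : 0 <= C by apply: le_trans (a_le 0%N).
apply: (@bounded_series_cvg _ _ (C * (2 * K ^+ 2 * C))); first exact: lin_power_ge0.
move=> N; apply: (@le_trans _ _ (series a N * (2 * K ^+ 2 * C))); last first.
  by rewrite ler_wpM2r // !mulr_ge0 // sqr_ge0.
rewrite /series /= mulr_suml; apply: ler_sum => j _; rewrite /lin_power !exprMn -mulrDr.
have : cos_coef (lam j) ^+ 2 + sin_coef (lam j) ^+ 2 <= 2 * K ^+ 2.
  have sqK x : `|x| <= K -> x ^+ 2 <= K ^+ 2.
    by move=> xK; rewrite -real_normK ?num_real // ler_sqr ?nnegrE.
  by have := sqK _ (cK (lam j)); have := sqK _ (sK (lam j)); lra.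
set x := _ + _; move=> xK.
have x0 : 0 <= x by rewrite addr_ge0 ?sqr_ge0.
by rewrite (expr2 (a j)) -mulrA ler_wpM2l // [leRHS]mulrC ler_pM.
Qed.

Definition lin_var : R := limn (series lin_power).

Lemma lin_var_ge0 : 0 <= lin_var.
Proof.
apply: le_trans (series_le_lim 0 lin_power_ge0 cvg_lin_power).
by rewrite /series /= big_geq.
Qed.

(** Exchanging the two sums turns the combination of partial processes into a [seq_sum], whose law
    is known; [law_limit] carries the law to the limit. *)
Lemma process_lin_law (A : set R) : measurable A ->
  P [set w | A (\sum_(i < n) c i * process a lam (t i) w)] =
  scaled_normal (Num.sqrt lin_var) A.
Proof.
pose b j := a j * cos_coef (lam j); pose d j := a j * sin_coef (lam j).
apply: (@law_limit _ _ _ P (seq_sum b d)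
  (fun w => \sum_(i < n) c i * process a lam (t i) w)
  (fun N => Num.sqrt (\sum_(j < N) (b j ^+ 2 + d j ^+ 2)))).
- exact: measurable_seq_sum.
- apply: measurable_sum => i; apply: measurable_funM => //.
  exact: measurable_process a0 _.
- apply: filterS (ae_good a0 aC) => w gw.
  rewrite (_ : (fun N => _) = (fun N => \sum_(i < n) c i * partial_process a lam N (t i) w)).
    apply: cvg_sum_seq => i; apply: cvgMr.
    exact: (@cvg_partial_process _ a lam a0 w (t i) gw).
  apply/funext => N; rewrite /seq_sum /partial_process /series /=.
  under [RHS]eq_bigr do rewrite mulr_sumr big_mkord.
  rewrite exchange_big /=; apply: eq_bigr => j _.
  rewrite /b /d -!(mulrA (a j)) -mulrDr /cos_coef /sin_coef !mulr_suml -big_split mulr_sumr /=.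
  by apply: eq_bigr => i _; rewrite /wave; ring.
- by move=> N B mB; exact: seq_sum_law.
- apply: continuous_cvg; first exact: sqrt_continuous.
  have := cvg_lin_power; rewrite /lin_var /series /=.
  by under eq_fun do rewrite big_mkord.
Qed.

End process_law.

Section stationary_process.
Context {R : realType}.
Variables (a lam : nat -> R) (C : R).
Hypothesis a0 : forall j, 0 <= a j.
Hypothesis aC : forall N, series a N <= C.
Local Notation P := (@seq_prob R).
Local Notation Omega := (@seq_space R).

Definition process_rv (t : R) : {RV P >-> R} :=
  mfun_Sub (mem_set (@measurable_process R a lam a0 t)).

Let f := process_rv.

Let lin_measurable n (t c : 'I_n -> R) : measurable_fun setT (lin_comb f t c).
Proof.
by apply: measurable_sum => i; apply: measurable_funM.
Qed.

Let lin_law n (t c : 'I_n -> R) (A : set R) : measurable A ->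
  P (lin_comb f t c @^-1` A) = scaled_normal (Num.sqrt (lin_var a lam t c)) A.
Proof. exact: (@process_lin_law R a lam C a0 aC). Qed.

Let lin_var0 n (t c : 'I_n -> R) : 0 <= lin_var a lam t c.
Proof. exact: (@lin_var_ge0 R a lam C a0 aC). Qed.

Let lin_comb1 (t : R) w : lin_comb f (fun _ : 'I_1 => t) (fun=> 1) w = f t w.
Proof. by rewrite /lin_comb big_ord_recl big_ord0 addr0 mul1r. Qed.

Lemma lin_mean n (t c : 'I_n -> R) : ('E_P[lin_comb f t c] = 0)%E.
Proof. by rewrite unlock; exact: law_mean (lin_measurable t c) (lin_law t c). Qed.

Lemma process_rv_variance n (t c : 'I_n -> R) :
  ('V_P[lin_comb f t c] = (lin_var a lam t c * normal_var)%:E)%E.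
Proof.
rewrite /variance unlock lin_mean unlock.
have := law_sqr_mean (lin_measurable t c) (lin_law t c).
rewrite sqr_sqrtr // => <-.
by apply: eq_integral => w _; rewrite -[X in (X ^+ 2)%:E]subr0 expr2.
Qed.

Let cov_lin_power (s x : R) j :
  lin_power a lam (fun i : 'I_2 => if i == ord0 then 0 else x)
    (fun i => if i == ord0 then 1 else s) j =
  a j ^+ 2 * ((1 + s ^+ 2) + 2 * s * cos (2 * pi * lam j * x)).
Proof.
rewrite /lin_power /cos_coef /sin_coef !big_ord_recl !big_ord0 /= !addr0.
rewrite mulr0 cos0 sin0 !mul1r add0r !exprMn -mulrDr; congr (_ * _).
have := cos2Dsin2 (2 * pi * lam j * x).
set u := cos _; set v := sin _ => uv.
transitivity (1 + s ^+ 2 * (u ^+ 2 + v ^+ 2) + 2 * s * u); first by ring.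
by rewrite uv; ring.
Qed.

(** Polarization: the mean of f(0) f(x) is a quarter of the difference of the variances of f(0) +
    f(x) and f(0) - f(x), so the laws of linear combinations suffice. *)
Lemma process_cov_kernel (x : R) :
  cov_kernel f x = normal_var * limn (series (fun j => a j ^+ 2 * cos (2 * pi * lam j * x))).
Proof.
pose tt (i : 'I_2) : R := if i == ord0 then 0 else x.
pose cc (s : R) (i : 'I_2) : R := if i == ord0 then 1 else s.
pose Y s := lin_comb f tt (cc s).
have YE s w : Y s w = f 0 w + s * f x w.
  by rewrite /Y /lin_comb !big_ord_recl big_ord0 /= addr0 mul1r.
have mY s := lin_measurable tt (cc s).
have sqrY s := law_sqr_mean (mY s) (lin_law tt (cc s)).
have isqrY s := law_sqr_integrable (mY s) (lin_law tt (cc s)).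
have E : (\int[P]_w ((f 0 w * f x w)%:E) =
    (4^-1 * (lin_var a lam tt (cc 1) * normal_var - lin_var a lam tt (cc (-1)) * normal_var))%:E)%E.
  have := sqrY 1; have := sqrY (-1); rewrite !sqr_sqrtr // => s1 s2.
  rewrite EFinM EFinB -s1 -s2 -integralB //; try exact: isqrY.
  rewrite -integralZl //.
    apply: eq_integral => w _; rewrite -EFinB -EFinM -/(Y 1 w) -/(Y (-1) w) !YE.
    by congr EFin; field.
  by apply: integrableB => //; exact: isqrY.
rewrite /cov_kernel unlock E /=.
have cv s : cvgn (series (lin_power a lam tt (cc s))) := @cvg_lin_power R a lam C a0 aC _ tt (cc s).
have -> : limn (series (fun j => a j ^+ 2 * cos (2 * pi * lam j * x))) =
    4^-1 * (lin_var a lam tt (cc 1) - lin_var a lam tt (cc (-1))).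
  apply: cvg_lim => //.
  rewrite (_ : series _ = fun N => 4^-1 * (series (lin_power a lam tt (cc 1)) N -
      series (lin_power a lam tt (cc (-1))) N)).
    by apply: cvgMr; apply: (@cvgB _ R^o); exact: cv.
  apply/funext => N; rewrite /series /= -sumrB mulr_sumr.
  by apply: eq_bigr => j _; rewrite !cov_lin_power; field.
by ring.
Qed.

(** The exponential sum with weights c and nodes t is nonzero at some charged frequency; that single
    frequency already makes the variance positive. *)
Hypothesis lam_separates : forall n (t c : 'I_n -> R), injective t ->
  (exists i, c i != 0) ->
  exists2 j, 0 < a j & cos_coef t c (lam j) != 0 \/ sin_coef t c (lam j) != 0.

Lemma process_rv_stationary : stationary_gaussian_process f.
Proof.
split.
- move=> n t c; exists 0, (Num.sqrt (lin_var a lam t c)) => A mA.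
  rewrite -scaled_normalE ?sqrtr_ge0 //.
  exact: lin_law.
- move=> t; rewrite -(lin_mean (fun _ : 'I_1 => t) (fun=> 1)).
  by congr expectation; apply/funext => w; rewrite lin_comb1.
- move=> n t h A mA; rewrite /fin_dim_law /pushforward.
  pose r := @seq_rot R (fun j => cos (2 * pi * lam j * h)) (fun j => - sin (2 * pi * lam j * h)).
  rewrite (_ : _ @^-1` A = r @^-1` ((fun w => [tuple f (t i) w | i < n]) @^-1` A)).
    apply: seq_prob_rot => [j|]; first by rewrite sqrrN cos2Dsin2.
    apply: measurable_preimageT => //; apply/measurable_fun_tnthP => i.
    rewrite (_ : _ \o _ = process a lam (t i)).
      exact: (@measurable_process R a lam a0).
    by apply/funext => w; rewrite /= tnth_mktuple.
  apply/seteqP; split => w /=; rewrite (_ : [tuple f (t i + h) w | i < n] =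
    [tuple f (t i) (r w) | i < n]) //; apply: eq_from_tnth => i;
  by rewrite !tnth_mktuple; exact: process_shift.
- by move=> w; exact: continuous_process_path a0 _.
- move=> n t c tinj /(lam_separates tinj)[j aj0 csj].
  rewrite process_rv_variance lte_fin mulr_gt0 ?normal_var_gt0 //.
  have pj : 0 < lin_power a lam t c j.
    rewrite /lin_power; case: csj => cs0.
      by rewrite ltr_pwDl ?sqr_ge0 // exprn_even_gt0 //= mulf_neq0 // gt_eqF.
    by rewrite ltr_wpDl ?sqr_ge0 // exprn_even_gt0 //= mulf_neq0 // gt_eqF.
  apply: lt_le_trans (series_le_lim j.+1 (lin_power_ge0 a lam t c) (@cvg_lin_power R a lam C a0 aC _ t c)).
  rewrite /series /= big_nat_recr //= ltr_wpDl // sumr_ge0 // => i _.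
  exact: lin_power_ge0.
Qed.

End stationary_process.

(** * Atomic spectral measures and energies *)

Section atomic_measure.
Context {R : realType}.
Variables (m lam : nat -> R) (M : R).
Hypothesis m0 : forall j, 0 <= m j.
Hypothesis mM : forall N, series m N <= M.

Let half_ge0 j : 0 <= m j / 2. Proof. by rewrite divr_ge0. Qed.

Definition atom_pair j : {measure set R -> \bar R} :=
  mscale (NngNum (half_ge0 j)) (measure_add (dirac (lam j)) (dirac (- lam j))).

Definition atomic_measure : set R -> \bar R := mseries atom_pair 0.

HB.instance Definition _ := Measure.on atomic_measure.

Lemma atom_pairE j (A : set R) :
  atom_pair j A = (m j / 2 * (\1_A (lam j) + \1_A (- lam j)))%:E.
Proof.
transitivity ((m j / 2)%:E *
  measure_add (@dirac _ R (lam j) R) (@dirac _ R (- lam j)%R R) A)%E; first by [].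
by rewrite measure_addE /= /dirac -EFinD -EFinM.
Qed.

Lemma atomic_measureE (A : set R) : atomic_measure A =
  (\sum_(j <oo) (m j / 2 * (\1_A (lam j) + \1_A (- lam j)))%:E)%E.
Proof. by apply: eq_eseriesr => j _; exact: atom_pairE. Qed.

Let indic01 (A : set R) x : 0 <= (\1_A x : R) <= 1.
Proof. by rewrite indicE; case: (_ \in _); rewrite lexx ler01. Qed.

Lemma atomic_measure_ub (A : set R) (J : nat) :
  (forall j, (j < J)%N -> ~ A (lam j) /\ ~ A (- lam j)) ->
  (atomic_measure A <= (limn (series m) - series m J)%:E)%E.
Proof.
move=> AJ; rewrite atomic_measureE.
have term0 j : (0 <= (m j / 2 * (\1_A (lam j) + \1_A (- lam j)))%:E)%E.
  have /andP[i0 _] := indic01 A (lam j); have /andP[k0 _] := indic01 A (- lam j).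
  by rewrite lee_fin mulr_ge0 ?addr_ge0.
apply: lime_le; first by apply: is_cvg_nneseries.
near=> N; have JN : (J <= N)%N by near: N; exact: nbhs_infty_ge.
rewrite sumEFin lee_fin (@big_cat_nat _ _ _ J 0 N) //= big_nat big1 ?add0r; last first.
  move=> j /= /AJ[A1 A2]; rewrite !indicE !memNset // addr0 mulr0 //.
apply: (@le_trans _ _ (series m N - series m J)).
  rewrite sub_series_geq //; apply: ler_sum => j _.
  have /andP[_ i1] := indic01 A (lam j); have /andP[_ k1] := indic01 A (- lam j).
  have := m0 j; nra.
by rewrite lerD2r; apply: series_le_lim => //; exact: bounded_series_cvg mM.
Unshelve. all: by end_near. Qed.

Lemma atomic_measure_lb (A : set R) (J : nat) : A (lam J) -> A (- lam J) ->
  ((m J)%:E <= atomic_measure A)%E.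
Proof.
move=> A1 A2; rewrite atomic_measureE.
have term0 j : (0 <= (m j / 2 * (\1_A (lam j) + \1_A (- lam j)))%:E)%E.
  have /andP[i0 _] := indic01 A (lam j); have /andP[k0 _] := indic01 A (- lam j).
  by rewrite lee_fin mulr_ge0 ?addr_ge0.
apply: (@le_trans _ _ (\sum_(0 <= j < J.+1) (m j / 2 * (\1_A (lam j) + \1_A (- lam j)))%:E)%E).
  rewrite big_nat_recr //= !indicE !mem_set // (_ : m J / 2 * (1%:R + 1%:R) = m J); last by field.
  by rewrite leeDr // sume_ge0.
exact: nneseries_lim_ge.
Qed.

Let fin_atomic : fin_num_fun atomic_measure.
Proof.
move=> A mA; rewrite ge0_fin_numE //.
apply: le_lt_trans (ltry (limn (series m) - series m 0)).
exact: atomic_measure_ub.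
Qed.

HB.instance Definition _ := Measure_isFinite.Build _ _ _ atomic_measure fin_atomic.

Definition atomic_finite_measure : {finite_measure set R -> \bar R} := atomic_measure.

Lemma atomic_measure_sym : symmetric_measure atomic_finite_measure.
Proof.
move=> A mA; rewrite -[LHS]/(atomic_measure (-%R @^-1` A)) -[RHS]/(atomic_measure A).
rewrite !atomic_measureE; apply: eq_eseriesr => j _.
have iN (x : R) : \1_(-%R @^-1` A) x = \1_A (- x) :> R.
  by rewrite !indicE; congr (_%:R); congr nat_of_bool; apply/idP/idP; rewrite !inE.
by rewrite !iN opprK addrC.
Qed.

Lemma ge0_integral_atomic (g : R -> R) : measurable_fun setT g ->
  (forall x, 0 <= g x) ->
  (\int[atomic_measure]_x (g x)%:E =
   \sum_(j <oo) (m j / 2 * (g (lam j) + g (- lam j)))%:E)%E.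
Proof.
move=> mg g0; have mg' : measurable_fun setT (EFin \o g) by exact/measurable_EFinP.
have g0' x : setT x -> (0 <= (g x)%:E)%E by rewrite lee_fin.
rewrite ge0_integral_measure_series //; apply: eq_eseriesr => j _.
rewrite ge0_integral_mscale // ge0_integral_measure_add //.
by rewrite !integral_dirac // !diracT !mul1e -EFinD -EFinM.
Qed.

(** As |g| <= 1, both 1 + g and 1 are non-negative and covered by [ge0_integral_atomic]; the result
    is their difference. *)
Lemma Rintegral_atomic (g : R -> R) : measurable_fun setT g ->
  (forall x, `|g x| <= 1) ->
  \int[atomic_measure]_x g x =
  limn (series (fun j => m j / 2 * (g (lam j) + g (- lam j)))).
Proof.
move=> mg g1.
have cm : cvgn (series m) := bounded_series_cvg m0 mM.
have gle x : -1 <= g x <= 1 by rewrite -ler_norml.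
have ge0_int (h : R -> R) : measurable_fun setT h -> (forall x, 0 <= h x <= 2) ->
    \int[atomic_measure]_x h x =
    limn (series (fun j => m j / 2 * (h (lam j) + h (- lam j)))) /\
    cvgn (series (fun j => m j / 2 * (h (lam j) + h (- lam j)))).
  move=> mh h02.
  have ch : cvgn (series (fun j => m j / 2 * (h (lam j) + h (- lam j)))).
    apply: (@dominated_series_cvg _ _ (fun j => 2 * m j)); last first.
      exact: is_cvg_seriesZ.
    move=> j; have /andP[h1 h2] := h02 (lam j); have /andP[h3 h4] := h02 (- lam j).
    have mj := m0 j; rewrite ger0_norm; last by rewrite mulr_ge0 ?divr_ge0 ?addr_ge0.
    rewrite mulrAC ler_pdivrMr // -mulrA mulrCA ler_wpM2l //; lra.
  split => //; rewrite /Rintegral ge0_integral_atomic //; last by move=> x; case/andP: (h02 x).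
  set u := fun j => m j / 2 * (h (lam j) + h (- lam j)).
  suff -> : (\sum_(j <oo) (u j)%:E = (limn (series u))%:E)%E by [].
  apply: cvg_lim => //; rewrite (_ : (fun N => _) = EFin \o series u); last first.
    by apply/funext => N; rewrite /= sumEFin.
  by apply/fine_cvgP; split; [exact: nearW|exact: ch].
have m1g : measurable_fun setT (fun x => 1 + g x) by exact: measurable_funD.
have b1g x : 0 <= 1 + g x <= 2 by have /andP[? ?] := gle x; lra.
have [I1 c1] := ge0_int _ m1g b1g.
have b1 (x : R) : 0 <= (1 : R) <= 2 by lra.
have [I0 c0] := ge0_int (fun=> 1) (measurable_cst _) b1.
have int_bnd (h : R -> R) : measurable_fun setT h -> (forall x, `|h x| <= 1) ->
    atomic_measure.-integrable setT (EFin \o h).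
  move=> mh h1; apply: measurable_bounded_integrable => //.
    by rewrite -ge0_fin_numE //; exact: fin_atomic.
  by exists 1; split => // y y1 x _; apply: le_trans (h1 x) (ltW y1).
have ig := int_bnd g mg g1.
have i1 : atomic_measure.-integrable setT (EFin \o (fun=> 1 : R)).
  by apply: int_bnd => // x; rewrite normr1.
have E : \int[atomic_measure]_x (1 + g x) =
    \int[atomic_measure]_x 1 + \int[atomic_measure]_x g x by exact: RintegralD.
transitivity (\int[atomic_measure]_x (1 + g x) - \int[atomic_measure]_x 1).
  by rewrite E addrAC subrr add0r.
rewrite I1 I0 -lim_seriesB //; congr (limn _); apply/funext => N.
by apply: eq_bigr => j _; rewrite -[LHS]/(_ - _); field.
Qed.

End atomic_measure.

Lemma spectral_atomic (R : realType) (m lam : nat -> R) (M : R)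
    (m0 : forall j, 0 <= m j) (mM : forall N, series m N <= M) :
  spectral_measure (fun x => limn (series (fun j => m j * cos (2 * pi * lam j * x))))
    (atomic_finite_measure lam m0 mM).
Proof.
split; first exact: atomic_measure_sym.
move=> x; rewrite /fourier /cintegral /cexpi /=.
have mlin : measurable_fun setT (fun l : R => - (2 * pi * l * x)).
  rewrite (_ : (fun l : R => _) = ( *%R (- (2 * pi * x)))).
    exact: (@measurable_funM _ R R setT (cst _) id).
  by apply/funext => l; ring.
have mcos : measurable_fun setT (fun l : R => cos (- (2 * pi * l * x))).
  apply: measurableT_comp mlin; apply: continuous_measurable_fun.
  exact: continuous_cos.
have msin : measurable_fun setT (fun l : R => sin (- (2 * pi * l * x))).
  apply: measurableT_comp mlin; apply: continuous_measurable_fun.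
  exact: continuous_sin.
rewrite (Rintegral_atomic lam m0 mM mcos); last first.
  by move=> y; rewrite ler_norml cos_geN1 cos_le1.
rewrite (Rintegral_atomic lam m0 mM msin); last first.
  by move=> y; rewrite ler_norml sin_geN1 sin_le1.
congr (_ +i* _)%C.
  congr (limn _); apply/funext => N; apply: eq_bigr => j _.
  by rewrite mulrN mulNr opprK !cosN; field.
rewrite (_ : series _ = fun=> 0); first by rewrite lim_cst.
apply/funext => N; rewrite /series /= big1 // => j _.
by rewrite mulrN mulNr opprK sinN; ring.
Qed.

Section bounded_integral.
Context {R : realType}.
Variables (nu : probability R R) (D : set R).
Hypotheses (mD : measurable D) (nuD : nu D = 1%E).

Local Notation I g := (\int[nu]_(x in D) g x).

Lemma bounded_integrable (g : R -> R) (B : R) : measurable_fun setT g ->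
  (forall x, `|g x| <= B) -> nu.-integrable D (EFin \o g).
Proof.
move=> mg gB; apply: measurable_bounded_integrable => //.
- by apply: le_lt_trans (probability_le1 nu mD) (ltry _).
- exact: measurable_funTS.
- exists B; split; first exact: num_real.
  by move=> y By x _; apply: le_trans (gB x) (ltW By).
Qed.

Lemma bounded_integrableZl (c : R) (g : R -> R) (B : R) : measurable_fun setT g ->
  (forall x, `|g x| <= B) -> nu.-integrable D (EFin \o (fun x => c * g x)).
Proof.
move=> mg gB; apply: (@bounded_integrable _ (`|c| * B)).
  exact: measurable_funM.
by move=> x; rewrite normrM ler_wpM2l.
Qed.

Lemma Rintegral_prob_cst (c : R) : \int[nu]_(x in D) c = c.
Proof. by rewrite Rintegral_cst // -[X in fine X]/(nu D) nuD mulr1. Qed.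

Lemma Rintegral_near (g h : R -> R) (B tau : R) :
  measurable_fun setT g -> measurable_fun setT h ->
  (forall x, `|g x| <= B) -> (forall x, `|g x - h x| <= tau) ->
  `|I g - I h| <= tau.
Proof.
move=> mg mh gB ght.
have ig := bounded_integrable mg gB.
have hB x : `|h x| <= B + tau.
  have -> : h x = g x - (g x - h x) by ring.
  by apply: le_trans (ler_normB _ _) _; rewrite lerD.
have ih := bounded_integrable mh hB.
rewrite -RintegralB //.
have mgh : measurable_fun setT (fun x => g x - h x) by exact: measurable_funB.
have igh := bounded_integrable mgh ght.
apply: le_trans (le_normr_Rintegral mD igh) _.
rewrite -[leRHS]Rintegral_prob_cst; apply: le_Rintegral => //.
- apply: (@bounded_integrable (fun x => `|g x - h x|) tau).
    exact: measurableT_comp (@normr_measurable R setT) mgh.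
  by move=> x; rewrite normr_id.
- by apply: (@bounded_integrable (fun=> tau) `|tau|).
Qed.

Lemma Rintegral_series (g : nat -> R -> R) (B : nat -> R) (c : nat -> R) J :
  (forall j, measurable_fun setT (g j)) -> (forall j x, `|g j x| <= B j) ->
  I (fun x => series (fun j => c j * g j x) J) = series (fun j => c j * I (g j)) J.
Proof.
move=> mg gB; rewrite /series /=; elim: J => [|J IH].
  by under eq_Rintegral do rewrite big_nil; rewrite big_nil Rintegral_prob_cst.
under eq_Rintegral do rewrite big_nat_recr //=.
have bS x : `|\sum_(0 <= j < J) c j * g j x| <= \sum_(0 <= j < J) `|c j| * B j.
  apply: le_trans (ler_norm_sum _ _ _) _; apply: ler_sum => j _.
  by rewrite normrM ler_wpM2l.
have mS : measurable_fun setT (fun x => \sum_(0 <= j < J) c j * g j x).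
  by apply: measurable_sum => j; exact: measurable_funM.
rewrite RintegralD //; last 2 first.
- exact: bounded_integrable bS.
- exact: bounded_integrableZl (gB J).
rewrite IH RintegralZl // ?big_nat_recr //.
exact: bounded_integrable (gB J).
Qed.

End bounded_integral.

Section energy_of_atoms.
Context {R : realType}.
Variables (m lam : nat -> R) (M : R).
Hypothesis m0 : forall j, 0 <= m j.
Hypothesis mM : forall N, series m N <= M.

Definition atomic_kernel (x : R) : R :=
  limn (series (fun j => m j * cos (2 * pi * lam j * x))).

Let K_ (J : nat) (x : R) : R := series (fun j => m j * cos (2 * pi * lam j * x)) J.

Let tau J : R := limn (series m) - series m J.

Let cm : cvgn (series m) := bounded_series_cvg m0 mM.

Let cos_dom x j : `|m j * cos (2 * pi * lam j * x)| <= m j.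
Proof. by rewrite normrM ger0_norm // ler_piMr // ler_norml cos_geN1 cos_le1. Qed.

Let K_near J x : `|atomic_kernel x - K_ J x| <= tau J.
Proof. exact: dominated_series_tail (cos_dom x) cm. Qed.

Let tau_cvg : tau J @[J --> \oo] --> 0.
Proof.
rewrite -[X in _ --> X](subrr (limn (series m))).
by apply: (@cvgB _ R^o); [exact: cvg_cst|exact: cm].
Qed.

Let measurable_trig (trig : R -> R) (c : R) : continuous trig ->
  measurable_fun setT (fun x => trig (c * x)).
Proof.
move=> ct; apply: measurableT_comp; first exact: continuous_measurable_fun.
exact: (@measurable_funM _ R R setT (cst c) id).
Qed.

Let mcos j : measurable_fun setT (fun x => cos (2 * pi * lam j * x)).
Proof. exact: measurable_trig (@continuous_cos R). Qed.

Let msin j : measurable_fun setT (fun x => sin (2 * pi * lam j * x)).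
Proof. exact: measurable_trig (@continuous_sin R). Qed.

Let mK_ J : measurable_fun setT (K_ J).
Proof. by apply: measurable_sum => j; exact: measurable_funM. Qed.

Let mK : measurable_fun setT atomic_kernel.
Proof.
apply: (measurable_fun_cvg (h := K_)) => // x _.
exact: dominated_series_cvg (cos_dom x) cm.
Qed.

Let K_bnd x : `|atomic_kernel x| <= tau 0.
Proof. by have := K_near 0 x; rewrite /K_ /series /= big_geq // subr0. Qed.

Variables (nu : probability R R) (D : set R).
Hypotheses (mD : measurable D) (nuD : nu D = 1%E).

Definition cos_mean j : R := \int[nu]_(x in D) cos (2 * pi * lam j * x).
Definition sin_mean j : R := \int[nu]_(x in D) sin (2 * pi * lam j * x).

Definition atom_energy j : R := m j * (cos_mean j ^+ 2 + sin_mean j ^+ 2).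

Let inner (x : R) : R := \int[nu]_(y in D) atomic_kernel (x - y).

Let inner_ J (x : R) : R := series (fun j => m j *
  (cos (2 * pi * lam j * x) * cos_mean j + sin (2 * pi * lam j * x) * sin_mean j)) J.

Let cos1 j x : `|cos (2 * pi * lam j * x)| <= 1 :> R.
Proof. by rewrite ler_norml cos_geN1 cos_le1. Qed.

Let sin1 j x : `|sin (2 * pi * lam j * x)| <= 1 :> R.
Proof. by rewrite ler_norml sin_geN1 sin_le1. Qed.

Let measurable_sub x : measurable_fun setT (fun y : R => x - y).
Proof. exact: (@measurable_funB _ R R setT (cst x) id). Qed.

Let inner_E J x : \int[nu]_(y in D) K_ J (x - y) = inner_ J x.
Proof.
pose g j y : R := cos (2 * pi * lam j * (x - y)).
rewrite (@Rintegral_series _ nu D mD nuD g (fun=> 1) m).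
- apply: eq_bigr => j _; congr (_ * _).
  transitivity (\int[nu]_(y in D) (cos (2 * pi * lam j * x) * cos (2 * pi * lam j * y) +
     sin (2 * pi * lam j * x) * sin (2 * pi * lam j * y))).
    by apply: eq_Rintegral => y _; rewrite /g mulrBr cosB.
  have ic := @bounded_integrable R nu D mD _ 1 (mcos j) (cos1 j).
  have is_ := @bounded_integrable R nu D mD _ 1 (msin j) (sin1 j).
  rewrite RintegralD ?RintegralZl //.
  + exact: (@bounded_integrableZl R nu D mD _ _ 1 (mcos j) (cos1 j)).
  + exact: (@bounded_integrableZl R nu D mD _ _ 1 (msin j) (sin1 j)).
- by move=> j; exact: measurableT_comp (mcos j) (measurable_sub x).
- by move=> j y; rewrite ler_norml cos_geN1 cos_le1.
Qed.

Let inner_near J x : `|inner x - inner_ J x| <= tau J.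
Proof.
rewrite -inner_E; apply: (@Rintegral_near _ nu D mD nuD _ _ (tau 0)) => //.
- exact: measurableT_comp mK (measurable_sub x).
- exact: measurableT_comp (mK_ J) (measurable_sub x).
Qed.

Let m_inner_ J : measurable_fun setT (inner_ J).
Proof.
apply: measurable_sum => j; apply: measurable_funM => //.
by apply: measurable_funD; exact: measurable_funM.
Qed.

Let m_inner : measurable_fun setT inner.
Proof.
apply: (measurable_fun_cvg (h := inner_)) => // x _.
apply/cvgrPdist_le => e e0; near=> J.
apply: le_trans (inner_near J x) _; apply: le_trans (ler_norm _) _.
by near: J; move/cvgr0_norm_le: tau_cvg; apply.
Unshelve. all: by end_near. Qed.

Let inner_bnd x : `|inner x| <= tau 0.
Proof. by have := inner_near 0 x; rewrite /inner_ /series /= big_geq // subr0. Qed.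

Let inner_int J : \int[nu]_(x in D) inner_ J x = series atom_energy J.
Proof.
pose g j x : R := cos (2 * pi * lam j * x) * cos_mean j + sin (2 * pi * lam j * x) * sin_mean j.
have ic j := @bounded_integrable R nu D mD _ 1 (mcos j) (cos1 j).
have is_ j := @bounded_integrable R nu D mD _ 1 (msin j) (sin1 j).
rewrite (@Rintegral_series _ nu D mD nuD g (fun j => `|cos_mean j| + `|sin_mean j|) m).
- apply: eq_bigr => j _; congr (_ * _).
  rewrite /g; under eq_Rintegral do rewrite mulrC [X in _ + X]mulrC.
  rewrite RintegralD ?RintegralZl ?expr2 //.
  + exact: (@bounded_integrableZl R nu D mD _ _ 1 (mcos j) (cos1 j)).
  + exact: (@bounded_integrableZl R nu D mD _ _ 1 (msin j) (sin1 j)).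
- by move=> j; apply: measurable_funD; exact: measurable_funM.
- move=> j x; apply: le_trans (ler_normD _ _) _; rewrite !normrM.
  by rewrite lerD // ler_piMl.
Qed.

(** The addition formula for cos(a - b) splits the double integral of a truncated kernel into
    squares of cosine and sine means. The truncation changes the kernel by at most the remaining
    mass, uniformly, and integrating twice against a probability measure does not enlarge this
    error. *)
Lemma energy_approx : exists e : R, energy atomic_kernel D nu = e%:E /\
  forall J, `|e - series atom_energy J| <= limn (series m) - series m J.
Proof.
exists (\int[nu]_(x in D) inner x); split; last first.
  by move=> J; rewrite -inner_int; apply: (@Rintegral_near _ nu D mD nuD _ _ (tau 0)).
rewrite /energy /Rintegral fineK; last first.
  by apply: integrable_fin_num => //; exact: bounded_integrable inner_bnd.
apply: eq_integral => x _; rewrite /inner /Rintegral fineK //.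
apply: integrable_fin_num => //.
apply: (@bounded_integrable _ nu D mD (fun y => atomic_kernel (x - y)) (tau 0)) => //.
exact: measurableT_comp mK (measurable_sub x).
Qed.

End energy_of_atoms.

(** * The lacunary atoms *)

Section trig_bound.
Context {R : realType}.
Implicit Types (phi psi x y : R).

Lemma sin_le_id x : 0 <= x -> sin x <= x.
Proof.
rewrite le_eqVlt => /orP[/eqP<-|x0]; first by rewrite sin0.
have drv y : y \in `]0, x[ -> is_derive y 1 sin (cos y) by move=> _; exact: is_derive_sin.
have cnt : {within `[0, x], continuous sin}.
  by apply: continuous_subspaceT => y; exact: continuous_sin.
have [c _] := MVT x0 drv cnt.
rewrite sin0 !subr0 => ->.
by rewrite ler_piMl ?cos_le1 // ltW.
Qed.

(** Telescoping of sin(a + b) sin(a - b) = sin^2 a - sin^2 b with a = (K+1) phi and b = K phi. *)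
Lemma sum_sin_odd K phi :
  sin phi * \sum_(k < K) sin (k.*2.+1%:R * phi) = sin (K%:R * phi) ^+ 2.
Proof.
elim: K => [|K IH]; first by rewrite big_ord0 mulr0 mul0r sin0 expr0n.
rewrite big_ord_recr /= mulrDr IH.
have -> : K.*2.+1%:R * phi = K.+1%:R * phi + K%:R * phi.
  by rewrite -mulrDl -natrD addSn addnn.
have -> : sin phi = sin (K.+1%:R * phi - K%:R * phi).
  by congr sin; rewrite -natr1; ring.
rewrite sinB sinD.
have := cos2Dsin2 (K.+1%:R * phi); have := cos2Dsin2 (K%:R * phi).
set a := sin (_.+1%:R * phi); set b := sin _; set c := cos (_.+1%:R * phi); set d := cos _.
move=> bd ac.
transitivity (b ^+ 2 + (a ^+ 2 * d ^+ 2 - c ^+ 2 * b ^+ 2)); first by ring.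
have -> : d ^+ 2 = 1 - b ^+ 2 by rewrite -bd addrK.
have -> : c ^+ 2 = 1 - a ^+ 2 by rewrite -ac addrK.
by ring.
Qed.

Lemma sin_natpiB n y : sin (n%:R * pi - y) = - (-1) ^+ n * sin y.
Proof.
rewrite addrC mulr_natl (alternatingn (@sinDpi R)) sinN; ring.
Qed.

Lemma sin_pihalfB_odd k y :
  sin (k.*2.+1%:R * (pi / 2 - y)) = (-1) ^+ k * cos (k.*2.+1%:R * y).
Proof.
have -> : k.*2.+1%:R * (pi / 2 - y) = (pi / 2 - k.*2.+1%:R * y) + pi *+ k.
  by rewrite -natr1 -mul2n natrM -mulr_natr; field.
by rewrite (alternatingn (@sinDpi R)) sinB sin_pihalf cos_pihalf mul1r mul0r subr0.
Qed.

Lemma dyadic_scale psi I : 0 < psi <= pi / 2 -> pi / 2 < 2 ^+ I * psi ->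
  exists2 i, (i < I)%N & pi / 4 <= 2 ^+ i * psi <= pi / 2.
Proof.
move=> /andP[p0 p1] pI.
have ex : exists i, pi / 2 < 2 ^+ i * psi by exists I.
case: (ex_minnP ex) => -[|j] pj jmin.
  by move: pj; rewrite expr0 mul1r ltNge p1.
exists j; first exact: jmin.
apply/andP; split; last first.
  by rewrite leNgt; apply/negP => /jmin; rewrite ltnn.
by move: pj; rewrite exprS; lra.
Qed.

Lemma sqr_sin_ge_half y : pi / 4 <= y <= pi / 2 -> 2^-1 <= sin y ^+ 2.
Proof.
move=> /andP[y0 y1].
have c0 : cos (y *+ 2) <= 0.
  rewrite -[y *+ 2](addrNK pi) cosDpi oppr_le0 cos_ge0_pihalf //.
  by rewrite -mulr_natr; lra.
have := cos2Dsin2 y; move: c0; rewrite cos_mulr2n mulr2n.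
by move: (cos y ^+ 2) (sin y ^+ 2) => u v; lra.
Qed.

(* The inner sums are sin^2 (2^i phi) / sin phi >= 0, and for the dyadic scale
   2^i at which sin^2 (2^i phi) >= 1/2 the weighted one is at least 1/4. *)
Lemma odd_sine_bound I phi : 2^-1 ^+ I * pi <= phi <= pi - 2^-1 ^+ I * pi ->
  4^-1 <= \sum_(i < I.+1) 2^-1 ^+ i * \sum_(k < 2 ^ i) sin (k.*2.+1%:R * phi).
Proof.
move=> /andP[phi0 phi1].
have pi0 := @pi_gt0 R.
have e0 : 0 < (2^-1 : R) ^+ I by rewrite exprn_gt0.
have eM : 2 ^+ I * 2^-1 ^+ I = 1 :> R by rewrite -exprMn divff // expr1n.
have ep : 0 < 2^-1 ^+ I * pi :> R by rewrite mulr_gt0.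
have sphi : 0 < sin phi by apply: sin_gt0_pi; apply/andP; split; lra.
have sum_eq i : \sum_(k < 2 ^ i) sin (k.*2.+1%:R * phi) = sin (2 ^+ i * phi) ^+ 2 / sin phi.
  apply: (mulfI (lt0r_neq0 sphi)); rewrite sum_sin_odd mulrCA divff ?lt0r_neq0 // mulr1.
  by rewrite natrX.
(* Folding about pi / 2 preserves sin phi and all the sin^2 (2^i phi), and brings the angle into the
   range of [dyadic_scale]. *)
pose psi := Num.min phi (pi - phi).
have psi0 : 2^-1 ^+ I * pi <= psi by rewrite le_min phi0; lra.
have psi1 : psi <= pi / 2 by rewrite ge_min; apply/orP; have [|] := leP phi (pi / 2); [left|right]; lra.
have sin_psi : sin psi = sin phi.
  rewrite /psi /Num.min; case: ifP => // _.
  by have := sin_natpiB 1 phi; rewrite mul1r expr1 opprK mul1r.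
have sqr_psi i : sin (2 ^+ i * psi) ^+ 2 = sin (2 ^+ i * phi) ^+ 2.
  rewrite /psi /Num.min; case: ifP => // _.
  rewrite mulrBr -natrX sin_natpiB exprMn sqrrN -exprM mulnC exprM sqrrN expr1n.
  by rewrite expr1n mul1r.
have psi_rng : 0 < psi <= pi / 2 by apply/andP; split; lra.
have psi_big : pi / 2 < 2 ^+ I * psi.
  have : 2 ^+ I * (2^-1 ^+ I * pi) <= 2 ^+ I * psi by rewrite ler_pM2l ?exprn_gt0.
  by rewrite mulrA eM mul1r; lra.
have [i iI /andP[i0 i1]] := dyadic_scale psi_rng psi_big.
have iI' : (i < I.+1)%N by rewrite ltnS ltnW.
rewrite (bigD1 (Ordinal iI')) //= -[leLHS]addr0 lerD //; last first.
  apply: sumr_ge0 => j _; rewrite sum_eq mulr_ge0 ?exprn_ge0 //.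
  by rewrite divr_ge0 ?sqr_ge0 // ltW.
rewrite sum_eq -sqr_psi -sin_psi.
have half : 2^-1 <= sin (2 ^+ i * psi) ^+ 2 by apply: sqr_sin_ge_half; rewrite i0.
have psi_gt0 : 0 < psi by apply: lt_le_trans psi0.
have s_le : sin psi <= psi by apply: sin_le_id; exact: ltW.
have s_gt0 : 0 < sin psi by rewrite sin_psi.
have pi4 : pi <= 4 :> R.
  by have := @pihalf_lt2 R; lra.
rewrite mulrA ler_pdivlMr //.
have a0 : 0 < (2^-1 : R) ^+ i by rewrite exprn_gt0.
have aM : 2^-1 ^+ i * 2 ^+ i = 1 :> R by rewrite -exprMn mulVf // expr1n.
(* Since 2^i psi <= pi / 2 <= 2, the selected term is at least 2^(-i) (1/2) / psi >= 1/4. *)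
have psi_le : psi <= 2^-1 ^+ i * 2.
  have -> : psi = 2^-1 ^+ i * (2 ^+ i * psi) by rewrite mulrA aM mul1r.
  by rewrite ler_pM2l //; lra.
apply: (@le_trans _ _ (2^-1 ^+ i * 2^-1)); last by rewrite ler_pM2l.
by lra.
Qed.

(** With phi = pi (1/2 - x / S) the alternating cosines become sines of odd multiples of phi, and
    the distance S 2^(-I) from the ends +/- S / 2 becomes the distance 2^(-I) pi from 0 and pi. *)
Lemma odd_cosine_bound (S x : R) I : 0 < S -> `|x| <= S / 2 - S * 2^-1 ^+ I ->
  4^-1 <= \sum_(i < I.+1) 2^-1 ^+ i *
    \sum_(k < 2 ^ i) (-1) ^+ k * cos (2 * pi * (k.*2.+1%:R / (2 * S)) * x).
Proof.
move=> S0; rewrite ler_norml => /andP[x0 x1].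
have pi0 := @pi_gt0 R.
have -> : \sum_(i < I.+1) 2^-1 ^+ i *
    \sum_(k < 2 ^ i) (-1) ^+ k * cos (2 * pi * (k.*2.+1%:R / (2 * S)) * x) =
  \sum_(i < I.+1) 2^-1 ^+ i * \sum_(k < 2 ^ i) sin (k.*2.+1%:R * (pi / 2 - pi * (x / S))).
  apply: eq_bigr => i _; congr (_ * _); apply: eq_bigr => k _.
  rewrite sin_pihalfB_odd; congr (_ * cos _); field.
  by rewrite gt_eqF.
apply: odd_sine_bound.
have : `|x / S| <= 2^-1 - 2^-1 ^+ I.
  rewrite normrM normfV (gtr0_norm S0) ler_pdivrMr // ler_norml; lra.
rewrite ler_norml => /andP[y0 y1].
have -> : pi / 2 - pi * (x / S) = pi * (2^-1 - x / S) by ring.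
have -> : pi - 2^-1 ^+ I * pi = pi * (1 - 2^-1 ^+ I) :> R by ring.
have -> : 2^-1 ^+ I * pi = pi * 2^-1 ^+ I :> R by rewrite mulrC.
by rewrite !ler_pM2l //; apply/andP; split; lra.
Qed.

End trig_bound.

(** * Enumeration of a sequence of finite blocks *)

Section layout.
Variables (T : eqType) (x0 : T) (s : nat -> seq T).
Hypothesis s_gt0 : forall n, (0 < size (s n))%N.

Definition layout_prefix N : seq T := flatten [seq s n | n <- iota 0 N].

(** The first j + 1 blocks have more than j entries because no block is empty, so the default [x0]
    is never read. *)
Definition layout j : T := nth x0 (layout_prefix j.+1) j.

Lemma layout_prefixD N M :
  layout_prefix (N + M) = layout_prefix N ++ flatten [seq s n | n <- iota N M].
Proof. by rewrite /layout_prefix iotaD map_cat flatten_cat. Qed.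

Lemma layout_prefixS N : layout_prefix N.+1 = layout_prefix N ++ s N.
Proof. by rewrite -addn1 layout_prefixD /= cats0. Qed.

Lemma leq_size_layout_prefix N : (N <= size (layout_prefix N))%N.
Proof.
elim: N => // N IH; rewrite layout_prefixS size_cat -addn1.
exact: leq_add (s_gt0 N).
Qed.

Lemma nth_layout_prefix N j : (j < size (layout_prefix N))%N ->
  nth x0 (layout_prefix N) j = layout j.
Proof.
move=> jN; rewrite /layout; have jj := leq_size_layout_prefix j.+1.
have [NJ|/ltnW JN] := leqP N j.+1.
  by rewrite -(subnKC NJ) layout_prefixD nth_cat jN.
by rewrite -(subnKC JN) layout_prefixD nth_cat jj.
Qed.

Lemma layout_sum (V : nmodType) (F : T -> V) N :
  \sum_(0 <= j < size (layout_prefix N)) F (layout j) =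
  \sum_(0 <= n < N) \sum_(x <- s n) F x.
Proof.
transitivity (\sum_(x <- layout_prefix N) F x).
  rewrite (big_nth x0) !big_nat; apply: eq_bigr => j jN.
  by rewrite nth_layout_prefix.
elim: N => [|N IH]; first by rewrite big_nil big_geq.
by rewrite layout_prefixS big_cat IH big_nat_recr.
Qed.

Lemma layout_lt N j : (j < size (layout_prefix N))%N ->
  exists2 n, (n < N)%N & layout j \in s n.
Proof.
move=> jN; have : layout j \in layout_prefix N.
  by rewrite -(nth_layout_prefix jN) mem_nth.
by case/flatten_mapP => n; rewrite mem_iota /= add0n; exists n.
Qed.

Lemma layout_surj n x : x \in s n -> exists j, layout j = x.
Proof.
move=> xs; have xp : x \in layout_prefix n.+1.
  by rewrite layout_prefixS mem_cat xs orbT.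
exists (index x (layout_prefix n.+1)).
by rewrite -(@nth_layout_prefix n.+1) ?index_mem // nth_index.
Qed.

End layout.

Section layout_series.
Variables (R : realType) (T : eqType) (x0 : T) (s : nat -> seq T).
Hypothesis s_gt0 : forall n, (0 < size (s n))%N.
Variable F : T -> R.
Hypothesis F0 : forall n x, x \in s n -> 0 <= F x.

Local Notation u := (fun j => F (layout x0 s j)).
Local Notation J N := (size (layout_prefix s N)).

Lemma layout_ge0 j : 0 <= u j.
Proof.
have [n _] := layout_lt x0 s_gt0 (leq_size_layout_prefix s_gt0 j.+1).
exact: F0.
Qed.

Lemma series_layout N : series u (J N) = \sum_(0 <= n < N) \sum_(x <- s n) F x.
Proof. exact: layout_sum. Qed.

Lemma series_layout_tail (tau : R) n N :
  (forall N', \sum_(n <= k < N') \sum_(x <- s k) F x <= tau) ->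
  series u N - series u (J n) <= tau.
Proof.
move=> tauP; have u0 := layout_ge0.
have nd : nondecreasing_seq (series u) by apply/nondecreasing_series => j _ _; exact: u0.
pose N' := maxn n N.
have NN' : (N <= J N')%N by rewrite (leq_trans _ (leq_size_layout_prefix s_gt0 N')) ?leq_maxr.
apply: (@le_trans _ _ (series u (J N') - series u (J n))).
  by rewrite lerD2r; exact: nd.
rewrite !series_layout (@big_cat_nat _ _ _ n 0 N') ?leq_maxl //=.
by rewrite addrAC subrr add0r; exact: tauP.
Qed.

Lemma series_layout_le (M : R) N :
  (forall N', \sum_(0 <= k < N') \sum_(x <- s k) F x <= M) -> series u N <= M.
Proof. by move=> /(@series_layout_tail M 0 N); rewrite {2}/series /= big_geq ?subr0. Qed.

Lemma limn_layout_tail (tau : R) n :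
  (forall N', \sum_(n <= k < N') \sum_(x <- s k) F x <= tau) ->
  limn (series u) - series u (J n) <= tau.
Proof.
move=> tauP; have u0 := layout_ge0.
have bnd N : series u N <= tau + series u (J n) by rewrite -lerBlDr series_layout_tail.
rewrite lerBlDr; apply: limr_le; first exact: bounded_series_cvg bnd.
by apply: nearW.
Qed.

End layout_series.

(** * Scales, masses and frequencies of the levels *)

Section levels.
Context {R : realType}.
Variables (p : nat) (u : R).
Hypothesis u_rng : 0 < u <= 9^-1.

Definition scale n : R := (3 ^ (p * n ^ 2))%:R.

(* The triple (n, i, k) encodes the pair of atoms at +/- (2k+1) / (2 S_n), where
   S_n is [scale n], of total mass u^(2 n^2) / 2^i. The block i of level n has
   2^i atoms, hence a mass that does not depend on i. *)
Definition level n : seq (nat * nat * nat) :=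
  [seq (n, i, k) | i <- iota 0 (n ^ 2).+1, k <- iota 0 (2 ^ i)].

(** The parameter [u] stands for S_1^(-alpha/2), so that u^(2 n^2) is S_n^(-alpha). Taking half the
    exponent as parameter makes u^(n^2) a bound for the square roots of the masses. *)
Definition mass (x : nat * nat * nat) : R := u ^+ (2 * x.1.1 ^ 2) * 2^-1 ^+ x.1.2.

Definition freq (x : nat * nat * nat) : R := x.2.*2.+1%:R / (2 * scale x.1.1).

Definition weight n : R := u ^+ (2 * n ^ 2) * (n ^ 2).+1%:R.

Lemma u_gt0 : 0 < u. Proof. by case/andP: u_rng. Qed.

Lemma scale_gt0 n : 0 < scale n. Proof. by rewrite ltr0n expn_gt0. Qed.

Lemma mass_gt0 x : 0 < mass x.
Proof. by rewrite mulr_gt0 // exprn_gt0 // u_gt0. Qed.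

Lemma weight_gt0 n : 0 < weight n.
Proof. by rewrite mulr_gt0 // exprn_gt0 // u_gt0. Qed.

Lemma mem_level n i k : ((n, i, k) \in level n) = (i <= n ^ 2)%N && (k < 2 ^ i)%N.
Proof.
apply/allpairsPdep/andP => [[i' [k' [ii' kk' [-> ->]]]]|[ii kk]].
  by move: ii' kk'; rewrite !mem_iota.
by exists i, k; rewrite !mem_iota.
Qed.

Lemma levelP n x : x \in level n ->
  exists i k, [/\ (i <= n ^ 2)%N, (k < 2 ^ i)%N & x = (n, i, k)].
Proof.
case/allpairsPdep => i [k [ii kk ->]]; exists i, k.
by move: ii kk; rewrite !mem_iota.
Qed.

Lemma level_gt0 n : (0 < size (level n))%N.
Proof.
by rewrite -has_predT; apply/hasP; exists (n, 0, 0)%N => //; rewrite mem_level leq0n.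
Qed.

Lemma level_sum (V : nmodType) (F : nat * nat * nat -> V) n :
  \sum_(x <- level n) F x = \sum_(i < (n ^ 2).+1) \sum_(k < 2 ^ i) F (n, i : nat, k : nat).
Proof.
have iotaE m (G : nat -> V) : \sum_(i <- iota 0 m) G i = \sum_(i < m) G i.
  by rewrite -(big_mkord xpredT) /index_iota subn0.
by rewrite big_allpairs_dep iotaE; apply: eq_bigr => i _; exact: iotaE.
Qed.

Lemma sum_dyadic_block i : \sum_(k < 2 ^ i) 2^-1 ^+ i = 1 :> R.
Proof. by rewrite sumr_const card_ord -[_ *+ (2 ^ i)]mulr_natl natrX -exprMn divff // expr1n. Qed.

Lemma level_mass n : \sum_(x <- level n) mass x = weight n.
Proof.
rewrite level_sum (eq_bigr (fun=> u ^+ (2 * n ^ 2))).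
  by rewrite sumr_const card_ord -[LHS]mulr_natr.
by move=> i _; rewrite /mass /= -mulr_sumr sum_dyadic_block mulr1.
Qed.

Lemma weight_halving n : weight n.+1 <= weight n / 2.
Proof.
have u0 := u_gt0; have /andP[_ u9] := u_rng.
rewrite /weight (_ : 2 * n.+1 ^ 2 = 2 * n ^ 2 + (4 * n).+2)%N; last first.
  by rewrite -!mulnn; nia.
have : u ^+ (4 * n).+2 <= 81^-1.
  apply: (@le_trans _ _ (u ^+ 2)); first by rewrite ler_wiXn2l //; lra.
  by rewrite expr2; nra.
rewrite exprD; move: (u ^+ (4 * n).+2) => v v81.
rewrite -!mulrA ler_pM2l ?exprn_gt0 //.
have n1 : (n.+1 ^ 2).+1%:R <= 3 * (n ^ 2).+1%:R :> R.
  by rewrite -natrM ler_nat -!mulnn; nia.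
apply: (@le_trans _ _ (81^-1 * (n.+1 ^ 2).+1%:R)); first by rewrite ler_wpM2r.
by have : 0 <= (n ^ 2).+1%:R :> R by []; lra.
Qed.

Lemma weight_sum n N : \sum_(n <= k < N) weight k <= 2 * weight n.
Proof.
have [nN|Nn] := leqP n N; last first.
  by rewrite big_geq 1?ltnW // mulr_ge0 // ltW // weight_gt0.
suff : \sum_(n <= k < N) weight k <= 2 * weight n - 2 * weight N.
  by have := weight_gt0 N; lra.
rewrite -(subnKC nN); elim: (N - n)%N => [|d IH]; first by rewrite addn0 big_geq // subrr.
rewrite addnS big_nat_recr ?leq_addr //=.
by have := weight_halving (n + d); lra.
Qed.

(** The amplitudes are proportional to these square roots, and the random series needs them
    summable. Fewer than 2^(n^2+1) terms, each at most u^(n^2), give 2 (2u)^(n^2), and 2u <= 1/2. *)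
Lemma level_sqrt n : \sum_(x <- level n) Num.sqrt (mass x) <= 2 * 2^-1 ^+ n.
Proof.
have u0 := u_gt0; have /andP[_ u9] := u_rng.
rewrite level_sum; apply: (@le_trans _ _ (\sum_(i < (n ^ 2).+1) (2 ^ i)%:R * u ^+ (n ^ 2))).
  apply: ler_sum => i _; rewrite mulr_natl -[X in _ *+ X]card_ord -sumr_const.
  apply: ler_sum => k _.
  rewrite -[leRHS]ger0_norm; last by rewrite exprn_ge0 // ltW.
  rewrite -sqrtr_sqr ler_wsqrtr // /mass /= mulnC exprM ler_piMr ?sqr_ge0 //.
  by apply: exprn_ile1; lra.
rewrite -mulr_suml -natr_sum.
have -> : (\sum_(i < (n ^ 2).+1) 2 ^ i = (2 ^ (n ^ 2).+1).-1)%N.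
  by have := predn_exp 2 (n ^ 2).+1; rewrite mul1n.
apply: (@le_trans _ _ (2 * (2 * u) ^+ (n ^ 2))).
  rewrite exprMn mulrA ler_wpM2r //; first by rewrite exprn_ge0 // ltW.
  by rewrite -exprS -natrX ler_nat leq_pred.
rewrite ler_pM2l //; apply: (@le_trans _ _ (2^-1 ^+ (n ^ 2))).
  by rewrite lerXn2r ?nnegrE //; lra.
by apply: ler_wiXn2l; [lra|lra|rewrite -mulnn; nia].
Qed.

Lemma level_sqrt_sum N : \sum_(0 <= n < N) \sum_(x <- level n) Num.sqrt (mass x) <= 4.
Proof.
apply: (@le_trans _ _ (4 - 4 * 2^-1 ^+ N)); last first.
  by rewrite gerBl mulr_ge0 // exprn_ge0.
elim: N => [|N IH]; first by rewrite big_geq // expr0 mulr1 subrr.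
rewrite big_nat_recr //= exprS.
by have := level_sqrt N; lra.
Qed.

End levels.

Section energy_ge.
Context {R : realType}.
Variables (m lam : nat -> R) (M : R).
Hypothesis m0 : forall j, 0 <= m j.
Hypothesis mM : forall N, series m N <= M.
Variables (nu : probability R R) (D : set R).
Hypotheses (mD : measurable D) (nuD : nu D = 1%E).

Lemma atom_energy_ge0 j : 0 <= atom_energy m lam nu D j.
Proof. by rewrite mulr_ge0 // addr_ge0 // sqr_ge0. Qed.

(** The terms are non-negative, so their partial sums increase, and the truncation error of
    [energy_approx] tends to 0. *)
Lemma energy_ge J :
  ((series (atom_energy m lam nu D) J)%:E <= energy (atomic_kernel m lam) D nu)%E.
Proof.
have [e [-> near_e]] := energy_approx lam m0 mM mD nuD.
have nd : nondecreasing_seq (series (atom_energy m lam nu D)).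
  by apply/nondecreasing_series => j _ _; exact: atom_energy_ge0.
have tau0 : e + (limn (series m) - series m N) @[N --> \oo] --> e.
  rewrite -[X in _ --> X]addr0 -[X in _ --> e + X](subrr (limn (series m))).
  apply: (@cvgD _ R^o); first exact: cvg_cst.
  by apply: (@cvgB _ R^o); [exact: cvg_cst|exact: bounded_series_cvg m0 mM].
rewrite lee_fin -(cvg_lim (@Rhausdorff R) tau0).
apply: limr_ge; first by apply/cvg_ex; exists e.
near=> N; apply: (@le_trans _ _ (series (atom_energy m lam nu D) N)).
  by apply: nd; near: N; exact: nbhs_infty_ge.
by have := near_e N; rewrite ler_norml => /andP[+ _]; lra.
Unshelve. all: by end_near. Qed.

Lemma Rintegral_sum (I : Type) (s : seq I) (c : I -> R) (g : I -> R -> R) (B : R) :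
  (forall i, measurable_fun setT (g i)) -> (forall i x, `|g i x| <= B) ->
  \int[nu]_(x in D) (\sum_(i <- s) c i * g i x) =
  \sum_(i <- s) c i * \int[nu]_(x in D) g i x.
Proof.
move=> mg gB; case: s => [|i0 s'].
  by under eq_Rintegral do rewrite big_nil; rewrite Rintegral_cst // mul0r big_nil.
set s := i0 :: s'; rewrite (big_nth i0).
transitivity (\int[nu]_(x in D)
    series (fun j => c (nth i0 s j) * g (nth i0 s j) x) (size s)).
  by apply: eq_Rintegral => x _; rewrite (big_nth i0).
exact: (Rintegral_series mD nuD (g := fun j => g (nth i0 s j)) (B := fun=> B)).
Qed.

End energy_ge.

Section level_energy.
Context {R : realType}.
Variables (p : nat) (u : R).
Hypothesis u_rng : 0 < u <= 9^-1.

Definition atom_mass j : R := mass u (layout (0, 0, 0)%N level j).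
Definition atom_freq j : R := freq p (layout (0, 0, 0)%N level j).

Local Notation J n := (size (layout_prefix level n)).
Local Notation K := (atomic_kernel atom_mass atom_freq).
Local Notation S := (@scale R p).

Lemma atom_mass_gt0 j : 0 < atom_mass j.
Proof. exact: mass_gt0. Qed.

Lemma atom_mass_ge0 j : 0 <= atom_mass j.
Proof. exact: ltW (atom_mass_gt0 j). Qed.

Let level_mass_tail n N : \sum_(n <= k < N) \sum_(x <- level k) mass u x <= 2 * weight u n.
Proof.
rewrite (eq_bigr (weight u)); first exact: weight_sum.
by move=> k _; exact: level_mass.
Qed.

Let mass_ge0 n x : x \in level n -> 0 <= mass u x.
Proof. by move=> _; exact: ltW (mass_gt0 u_rng x). Qed.

Lemma atom_mass_bound N : series atom_mass N <= 2 * weight u 0.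
Proof. exact: (@series_layout_le _ _ (0, 0, 0)%N _ level_gt0 _ mass_ge0 _ N (level_mass_tail 0)). Qed.

Lemma atom_mass_tail n : limn (series atom_mass) - series atom_mass (J n) <= 2 * weight u n.
Proof. exact: (@limn_layout_tail _ _ (0, 0, 0)%N _ level_gt0 _ mass_ge0 _ _ (level_mass_tail n)). Qed.

Section lower.
Variables (nu : probability R R) (D : set R).
Hypotheses (mD : measurable D) (nuD : nu D = 1%E).

Let C (x : nat * nat * nat) : R := \int[nu]_(y in D) cos (2 * pi * freq p x * y).
Let Sn (x : nat * nat * nat) : R := \int[nu]_(y in D) sin (2 * pi * freq p x * y).

Let mcos x : measurable_fun setT (fun y : R => cos (2 * pi * freq p x * y)).
Proof.
apply: measurableT_comp; first exact: continuous_measurable_fun (@continuous_cos R).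
exact: (@measurable_funM _ R R setT (cst (2 * pi * freq p x)) id).
Qed.

Let cos1 x y : `|cos (2 * pi * freq p x * y)| <= 1 :> R.
Proof. by rewrite ler_norml cos_geN1 cos_le1. Qed.

(** Integrating [odd_cosine_bound] against [nu] gives a weighted sum of cosine means that is at
    least 1/4, with absolute weights [v] of total L. Cauchy-Schwarz appears as a termwise AM-GM with
    equality at 1/(4L), the optimal choice, so A >= 1/(16 L) is reached without loss. *)
Lemma energy_lower n :
  (forall x, D x -> `|x| <= S n / 2 - S n * 2^-1 ^+ (n ^ 2)) ->
  ((u ^+ (2 * n ^ 2) / (16 * (n ^ 2).+1%:R))%:E <= energy K D nu)%E.
Proof.
move=> Dn.
apply: le_trans (energy_ge atom_freq atom_mass_ge0 atom_mass_bound mD nuD (J n.+1)).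
rewrite lee_fin.
have -> : series (atom_energy atom_mass atom_freq nu D) (J n.+1) =
    \sum_(0 <= k < n.+1) \sum_(x <- level k) mass u x * (C x ^+ 2 + Sn x ^+ 2).
  exact: (layout_sum (0, 0, 0)%N level_gt0 (fun x => mass u x * (C x ^+ 2 + Sn x ^+ 2))).
rewrite big_nat_recr //= -[leLHS]add0r lerD //.
  apply: sumr_ge0 => k _; apply: sumr_ge0 => x _.
  by rewrite mulr_ge0 ?addr_ge0 ?sqr_ge0 // ltW // mass_gt0.
pose v (x : nat * nat * nat) : R := 2^-1 ^+ x.1.2.
pose w (x : nat * nat * nat) : R := v x * (-1) ^+ x.2.
pose L : R := (n ^ 2).+1%:R.
have L0 : 0 < L by rewrite ltr0n.
have v0 x : 0 <= v x by rewrite exprn_ge0.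
have un0 : 0 < u ^+ (2 * n ^ 2) by rewrite exprn_gt0 // (u_gt0 u_rng).
have sum_v : \sum_(x <- level n) v x = L.
  rewrite level_sum (eq_bigr (fun=> 1)); first by rewrite sumr_const card_ord.
  by move=> i _; rewrite /v /= sum_dyadic_block.
have sum_w : 4^-1 <= \sum_(x <- level n) w x * C x.
  rewrite -(Rintegral_sum mD nuD _ _ mcos cos1) -[leLHS](Rintegral_prob_cst mD nuD).
  apply: le_Rintegral => //.
  - apply: (@bounded_integrable R nu D mD (fun=> 4^-1) 4^-1) => // x.
    by rewrite ger0_norm.
  - apply: (@bounded_integrable R nu D mD
      (fun y => \sum_(x <- level n) w x * cos (2 * pi * freq p x * y))
      (\sum_(x <- level n) `|w x|)).
      by apply: measurable_sum => x; exact: measurable_funM.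
    move=> y; apply: le_trans (ler_norm_sum _ _ _) _; apply: ler_sum => x _.
    by rewrite normrM ler_piMr.
  - move=> y /Dn Dy; apply: le_trans (odd_cosine_bound (scale_gt0 p n) Dy) _.
    rewrite level_sum le_eqVlt; apply/orP; left; apply/eqP.
    apply: eq_bigr => i _; rewrite mulr_sumr; apply: eq_bigr => k _.
    by rewrite /w /v /freq /= mulrA.
pose A : R := \sum_(x <- level n) v x * C x ^+ 2.
have AL : 8^-1 <= 2 * L * A.
  suff : 4^-1 <= 2 * L * A + L / (8 * L).
    have -> : L / (8 * L) = 8^-1 by field; rewrite lt0r_neq0.
    by lra.
  apply: le_trans sum_w _; rewrite -{2}sum_v mulr_sumr mulr_suml -big_split /=.
  apply: ler_sum => x _.
  (* AM-GM: [c <= 2 L c^2 + 1 / (8 L)] *)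
  have amgm (c : R) : c <= 2 * L * c ^+ 2 + (8 * L)^-1.
    rewrite -subr_ge0.
    have -> : 2 * L * c ^+ 2 + (8 * L)^-1 - c = 2 * L * (c - (4 * L)^-1) ^+ 2.
      by field; rewrite lt0r_neq0.
    by rewrite mulr_ge0 ?sqr_ge0 // mulr_ge0 // ltW.
  have -> : w x * C x = v x * ((-1) ^+ x.2 * C x) by rewrite mulrA.
  have -> : 2 * L * (v x * C x ^+ 2) + v x / (8 * L) =
      v x * (2 * L * ((-1) ^+ x.2 * C x) ^+ 2 + (8 * L)^-1).
    by rewrite exprMn sqrr_sign mul1r; ring.
  by rewrite ler_wpM2l.
apply: (@le_trans _ _ (u ^+ (2 * n ^ 2) * A)).
  rewrite ler_pM2l // -/L -[leLHS]mul1r ler_pdivrMr ?mulr_gt0 //.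
  have -> : A * (16 * L) = 8 * (2 * L * A) by ring.
  by lra.
rewrite mulr_sumr big_seq [leRHS]big_seq; apply: ler_sum => x /levelP[i [k [_ _ ->]]].
rewrite /mass /v /= mulrA ler_wpM2l ?lerDl ?sqr_ge0 // mulr_ge0 ?exprn_ge0 //.
by rewrite ltW // (u_gt0 u_rng).
Qed.

End lower.

End level_energy.

Section two_point.
Context {R : realType}.
Variable a : R.

(** Only index 0 is charged: the two-point measure is an instance of [atomic_measure], and its
    integrals come from [Rintegral_atomic]. *)
Let m (j : nat) : R := (j == 0)%:R.

Let m0 j : 0 <= m j. Proof. exact: ler0n. Qed.

Let limn_head (v : nat -> R) : limn (series (fun j => m j * v j)) = v 0.
Proof.
apply: cvg_lim => //; apply: cvg_near_cst; exists 1%N => // N /= N0.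
by rewrite /series /= (@big_cat_nat _ _ _ 1) //= big_nat1 /m eqxx mul1r big_nat big1 ?addr0 // => j /andP[+ _];
  case: j => // j _; rewrite mul0r.
Qed.

Let mM N : series m N <= 1.
Proof.
case: N => [|N]; first by rewrite /series /= big_geq.
rewrite /series /= (@big_cat_nat _ _ _ 1) //= big_nat1 /m eqxx big_nat big1 ?addr0 //.
by case.
Qed.

Definition two_point : set R -> \bar R := atomic_measure (fun=> a) m0.

HB.instance Definition _ := Measure.on two_point.

Let two_point_setT : two_point setT = 1%E.
Proof.
rewrite /two_point atomic_measureE; apply: cvg_lim => //; apply: cvg_near_cst.
exists 1%N => // N /= N0; rewrite (@big_cat_nat _ _ _ 1) //= big_nat1 big_nat big1.
  by rewrite adde0 !indicE !in_setT /m eqxx; congr (_%:E); rewrite /=; field.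
by case=> // j _; rewrite /m /= mul0r mul0r.
Qed.

HB.instance Definition _ := Measure_isProbability.Build _ _ _ two_point two_point_setT.

Definition two_point_prob : probability R R := two_point.

Lemma two_point_supp (D : set R) : D a -> D (- a) -> two_point_prob D = 1%E.
Proof.
move=> Da DNa; rewrite -[LHS]/(atomic_measure (fun=> a) m0 D).
transitivity (two_point setT); last exact: two_point_setT.
by rewrite /two_point !atomic_measureE; apply: eq_eseriesr => j _; rewrite !indicE !mem_set.
Qed.

Lemma Rintegral_two_point (D : set R) (g : R -> R) : measurable D -> D a -> D (- a) ->
  measurable_fun setT g -> (forall x, `|g x| <= 1) ->
  \int[two_point_prob]_(x in D) g x = (g a + g (- a)) / 2.
Proof.
move=> mD Da DNa mg g1; rewrite Rintegral_mkcond.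
have mgD : measurable_fun setT (g \_ D).
  by apply/(measurable_restrictT _ mD); exact: measurable_funTS.
have gD1 x : `|(g \_ D) x| <= 1 by rewrite patchE; case: ifP => //; rewrite normr0.
transitivity (\int[atomic_measure (fun=> a) m0]_x (g \_ D) x); first by [].
rewrite (Rintegral_atomic (fun=> a) m0 mM mgD gD1).
rewrite !patchE !mem_set // -[RHS](limn_head (fun=> (g a + g (- a)) / 2)).
by congr (limn (series _)); apply/funext => j; rewrite -mulrA [2^-1 * _]mulrC.
Qed.

End two_point.

Section level_energy_upper.
Context {R : realType}.
Variables (p : nat) (u : R).
Hypothesis u_rng : 0 < u <= 9^-1.

Local Notation J n := (size (layout_prefix level n)).
Local Notation K := (atomic_kernel (atom_mass u) (atom_freq p)).
Local Notation S := (@scale R p).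

Lemma cos_odd_pihalf q : odd q -> cos (q%:R * (pi / 2)) = 0 :> R.
Proof.
move=> oq; have -> : q%:R * (pi / 2) = pi / 2 + pi *+ q./2 :> R.
  have -> : q%:R = 1 + 2 * q./2%:R :> R.
    by rewrite -[in LHS](odd_double_half q) oq natrD -mul2n natrM.
  by rewrite -[pi *+ _]mulr_natr; field.
by rewrite (alternatingn (@cosDpi R)) cos_pihalf mulr0.
Qed.

(* The ratio S_n / S_i is an odd integer. *)
Lemma cos_level_node i n x : x \in level i -> (i <= n)%N ->
  cos (2 * pi * freq p x * (S n / 2)) = 0 :> R.
Proof.
move=> /levelP[i' [k [_ _ ->]]] i_n.
have expE : (p * n ^ 2 = p * i ^ 2 + p * (n ^ 2 - i ^ 2))%N.
  by rewrite -mulnDr subnKC // leq_exp2r.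
have -> : 2 * pi * freq p (i, i', k) * (S n / 2) =
    (k.*2.+1 * 3 ^ (p * (n ^ 2 - i ^ 2)))%N%:R * (pi / 2) :> R.
  rewrite /freq /scale /= expE expnD !natrM; field.
  by rewrite pnatr_eq0 expn_eq0.
by apply: cos_odd_pihalf; rewrite oddM /= odd_double oddX orbT.
Qed.

(** For the equal atoms at +/- S_n / 2, all sine means vanish by symmetry and the cosine means of
    levels up to n vanish by [cos_level_node]; what is left is at most the mass of the higher
    levels. *)
Lemma energy_upper n (r : R) : S n / 2 <= r ->
  exists2 nu : probability R R, nu (centred_itv r) = 1%E &
    (energy K (centred_itv r) nu <= (2 * weight u n.+1)%:E)%E.
Proof.
move=> Sr; have S0 := @scale_gt0 R p n.
set D := centred_itv r; pose a := S n / 2.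
have mD : measurable D by exact: measurable_itv.
have Da : D a by rewrite /D /centred_itv /= in_itv /= /a; apply/andP; split; lra.
have DNa : D (- a) by rewrite /D /centred_itv /= in_itv /= /a; apply/andP; split; lra.
exists (two_point_prob a); first exact: two_point_supp.
have nuD := two_point_supp Da DNa.
have [e [-> near_e]] := energy_approx (atom_freq p) (atom_mass_ge0 u_rng)
  (atom_mass_bound u_rng) mD nuD.
rewrite lee_fin.
have mtrig (trig : R -> R) (c : R) : continuous trig ->
    measurable_fun setT (fun x : R => trig (c * x)).
  move=> ct; apply: measurableT_comp; first exact: continuous_measurable_fun.
  exact: (@measurable_funM _ R R setT (cst c) id).
(* The indices below [J n.+1] are exactly those of the levels 0, ..., n. *)
have cm0 j : (j < J n.+1)%N -> cos_mean (atom_freq p) (two_point_prob a) D j = 0.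
  move=> jJ; have [i i_n ij] := layout_lt (0, 0, 0)%N level_gt0 jJ.
  rewrite /cos_mean Rintegral_two_point //.
  - by rewrite mulrN cosN (cos_level_node ij) // addr0 mul0r.
  - exact: mtrig (@continuous_cos R).
  - by move=> x; rewrite ler_norml cos_geN1 cos_le1.
have sm0 j : sin_mean (atom_freq p) (two_point_prob a) D j = 0.
  rewrite /sin_mean Rintegral_two_point //.
  - by rewrite mulrN sinN subrr mul0r.
  - exact: mtrig (@continuous_sin R).
  - by move=> x; rewrite ler_norml sin_geN1 sin_le1.
have := near_e (J n.+1); rewrite [X in `|_ - X|](_ : _ = 0); last first.
  rewrite /series /= big_nat big1 // => j /andP[_ jJ].
  by rewrite /atom_energy cm0 // sm0 expr0n /= addr0 mulr0.
rewrite subr0 => /(le_trans (ler_norm _)) /le_trans; apply.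
exact: atom_mass_tail.
Qed.

End level_energy_upper.

(** * Capacities and the spectral exponent *)

Lemma ltn_sqr_expn4 n : (n ^ 2 < 4 ^ n)%N.
Proof.
have := ltn_expl n (isT : 1 < 2)%N; rewrite (_ : 4 = 2 ^ 2)%N // -expnM mulnC expnM.
by rewrite -!mulnn; move: (2 ^ n)%N => k; nia.
Qed.

Section capacity_ratio.
Context {R : realType}.
Variables (p : nat) (u : R).
Hypothesis p_gt0 : (0 < p)%N.
Hypothesis u_rng : 0 < u <= 9^-1.

Local Notation K := (atomic_kernel (atom_mass u) (atom_freq p)).
Local Notation S := (@scale R p).

Lemma scale_ge n : n%:R <= S n.
Proof.
rewrite ler_nat; apply: leq_trans (_ : 3 ^ n <= _)%N; first exact: ltnW (ltn_expl _ _).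
rewrite leq_exp2l //; case: n => // n.
by rewrite -mulnn mulnA leq_pmull // muln_gt0 p_gt0.
Qed.

(** Passing to level n + 1 gains u^(4n+2) <= 81^(-(2n+1)), which beats the two polynomial factors,
    bounded by powers of 4, and the constant 64 = 2 * 2 * 16. *)
Lemma weight_gap n : (0 < n)%N ->
  2 * (2 * weight u n.+1) <= u ^+ (2 * n ^ 2) / (16 * (n ^ 2).+1%:R).
Proof.
move=> n0; have u0 := u_gt0 u_rng; have /andP[_ u9] := u_rng.
have nat_bound : (64 * (n.+1 ^ 2).+1 * (n ^ 2).+1 <= 81 ^ (2 * n).+1)%N.
  have b1 := ltn_sqr_expn4 n; have b2 := ltn_sqr_expn4 n.+1.
  have b3 : (4 ^ n * 4 ^ n * 4 <= 81 ^ (2 * n))%N.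
    rewrite expnM (_ : 81 ^ 2 = 4 * 4 * 4 + 6497)%N //.
    apply: (@leq_trans ((4 * 4 * 4) ^ n)); last by rewrite leq_exp2r ?leq_addr.
    by rewrite !expnMn leq_mul2l -[X in (X <= _)%N]expn1 leq_pexp2l // orbT.
  rewrite (expnS 81); apply: leq_trans (_ : 64 * 4 ^ n.+1 * 4 ^ n <= _)%N.
    by apply: leq_mul => //; rewrite leq_mul2l.
  by rewrite (expnS 4); move: b3; move: (4 ^ n)%N (81 ^ (2 * n))%N => k l; nia.
have L0 : 0 < (n ^ 2).+1%:R :> R by rewrite ltr0n.
rewrite ler_pdivlMr ?mulr_gt0 // /weight.
rewrite (_ : 2 * n.+1 ^ 2 = 2 * n ^ 2 + 2 * (2 * n).+1)%N; last first.
  by rewrite -!mulnn; nia.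
have : u ^+ (2 * (2 * n).+1) <= (81 ^+ (2 * n).+1)^-1.
  rewrite exprM -exprVn lerXn2r ?nnegrE ?sqr_ge0 //.
  by rewrite expr2; nra.
rewrite exprD; move: (u ^+ (2 * (2 * n).+1)) => v v81.
have uu0 : 0 < u ^+ (2 * n ^ 2) by rewrite exprn_gt0.
move: nat_bound; rewrite -(ler_nat R) !natrM natrX.
move: v81; set d := 81 ^+ _; set x := (n.+1 ^ 2).+1%:R; set y := (n ^ 2).+1%:R.
move=> v81 xyd.
have d0 : 0 < d by rewrite exprn_gt0.
have -> : 2 * (2 * (u ^+ (2 * n ^ 2) * v * x)) * (16 * y) = u ^+ (2 * n ^ 2) * (v * (64 * x * y)).
  by ring.
rewrite ger_pMr //; apply: (@le_trans _ _ (d^-1 * d)); last by rewrite mulVf ?lt0r_neq0.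
apply: (@le_trans _ _ (d^-1 * (64 * x * y))); last by rewrite ler_pM2l ?invr_gt0.
by rewrite ler_wpM2r // !mulr_ge0.
Qed.

Lemma energy_atomic_ge0 (D : set R) (nu : probability R R) : measurable D ->
  nu D = 1%E -> (0 <= energy K D nu)%E.
Proof.
move=> mD nuD.
have := energy_ge (atom_freq p) (atom_mass_ge0 u_rng) (atom_mass_bound u_rng) mD nuD 0.
by rewrite /series /= big_geq.
Qed.

Lemma capacity_ratio n (T r : R) : (0 < n)%N ->
  T <= S n / 2 - S n * 2^-1 ^+ (n ^ 2) -> S n / 2 <= r ->
  (2%:E <= capacity K (centred_itv r) / capacity K (centred_itv T))%E.
Proof.
move=> n0 Tn rn.
pose E x : set (\bar R) := [set energy K (centred_itv x) nu | nu in
  [set nu : probability R R | nu (centred_itv x) = 1%E]].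
rewrite (_ : (_ / _)%E = ((ereal_inf (E r))^-1 * ereal_inf (E T))%E); last first.
  by rewrite /capacity inveK.
pose L := u ^+ (2 * n ^ 2) / (16 * (n ^ 2).+1%:R); pose U := 2 * weight u n.+1.
have mD x : measurable (centred_itv x : set R) by exact: measurable_itv.
have U0 : 0 < U by rewrite mulr_gt0 // (weight_gt0 u_rng).
have LU : 2 * U <= L by exact: weight_gap.
have infr0 : (0 <= ereal_inf (E r))%E.
  by apply: le_ereal_inf_tmp => _ [nu /= nuD <-]; exact: energy_atomic_ge0.
have infrU : (ereal_inf (E r) <= U%:E)%E.
  have [nu nuD nuU] := energy_upper u_rng rn.
  by apply: le_trans nuU; apply: ereal_inf_lbound; exists nu.
have Linf : (L%:E <= ereal_inf (E T))%E.
  apply: le_ereal_inf_tmp => _ [nu /= nuD <-]; apply: energy_lower => // x.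
  by rewrite /centred_itv /= in_itv /= -ler_norml => /le_trans; apply.
apply: (@le_trans _ _ ((U^-1)%:E * L%:E)%E).
  by rewrite -EFinM lee_fin ler_pdivlMl // mulrC.
apply: lee_pmul => //; rewrite ?lee_fin ?invr_ge0 ?(ltW U0) //.
  by apply: le_trans LU; rewrite mulr_ge0 // ltW.
have -> : (U^-1)%:E = (U%:E^-1)%E by rewrite inver gt_eqF.
(* Only x >= 0 is known here; inversion reverses the order on [0, +oo] with 0^-1 = +oo. *)
move: infr0 infrU; move: (ereal_inf (E r)) => x x0 xU.
by rewrite lee_pV2 ?inE // lee_fin ltW.
Qed.

(** With eps = 1/(4p), S_n^eps = 3^(n^2/4) <= 2^(n^2/2) <= 2^(n^2) / 4, the last step because n^2 >=
    4. Together with S_n / 4 <= T <= S_n this gives T^(1-eps) >= S_n 2^(-n^2), the missing distance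
    to S_n / 2. *)
Lemma gap_powR n : (1 < n)%N ->
  let T := S n / 2 - S n * 2^-1 ^+ (n ^ 2) in
  S n / 4 <= T /\ S n / 2 <= T + T `^ (1 - (4 * p%:R)^-1).
Proof.
move=> n1 T; have S0 := @scale_gt0 R p n; set eps := (4 * p%:R)^-1.
have p0 : 0 < p%:R :> R by rewrite ltr0n.
have eps0 : 0 < eps by rewrite invr_gt0 mulr_gt0.
have n4 : (4 <= n ^ 2)%N by rewrite -mulnn; nia.
have e0 : (2^-1 : R) ^+ (n ^ 2) <= 4^-1.
  apply: (@le_trans _ _ (2^-1 ^+ 2)); last by rewrite expr2; lra.
  by apply: ler_wiXn2l; [lra|lra|lia].
have T4 : S n / 4 <= T by rewrite /T; nra.
split=> //; have T0 : 0 < T by apply: lt_le_trans T4; rewrite divr_gt0.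
have TS : T <= S n.
  have : 0 < S n * 2^-1 ^+ (n ^ 2) by rewrite mulr_gt0 ?exprn_gt0.
  by rewrite /T; lra.
suff : S n * 2^-1 ^+ (n ^ 2) <= T `^ (1 - eps) by rewrite /T; lra.
have Seps : S n `^ eps <= 2 ^+ (n ^ 2) / 4.
  have S2 : S n <= 2 `^ (2 * (p%:R * (n ^ 2)%:R)).
    rewrite -natrM -[2 * _]/(2%:R * _) -natrM powR_mulrn // /scale -natrX ler_nat.
    by rewrite (expnM 2 2) leq_exp2r // muln_gt0 p_gt0 expn_gt0 (ltn_trans _ n1).
  apply: (@le_trans _ _ ((2 `^ (2 * (p%:R * (n ^ 2)%:R))) `^ eps)).
    by rewrite ge0_ler_powR ?nnegrE ?(ltW S0) ?powR_ge0 // ltW.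
  rewrite -powRrM (_ : _ * eps = (n ^ 2)%:R / 2); last first.
    by rewrite /eps; field; rewrite lt0r_neq0.
  apply: (@le_trans _ _ (2 `^ ((n ^ 2)%:R - 2%:R))).
    rewrite ler_powR //; first by rewrite ler1n.
    have : 4 <= (n ^ 2)%:R :> R by rewrite ler_nat.
    by lra.
  rewrite powRD; last by rewrite pnatr_eq0 /= implybT.
  by rewrite powRN !powR_mulrn // expr2 -natrM.
rewrite powRD; last by rewrite lt0r_neq0 // implybT.
rewrite powRr1 ?(ltW T0) // powRN.
have Teps : T `^ eps <= 2 ^+ (n ^ 2) / 4.
  by apply: le_trans Seps; rewrite ge0_ler_powR ?nnegrE ?(ltW S0) ?(ltW T0) // ltW.
have Te0 : 0 < T `^ eps by exact: powR_gt0.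
rewrite ler_pdivlMr //.
have x0 : 0 < (2 : R) ^+ (n ^ 2) by rewrite exprn_gt0.
apply: le_trans T4; rewrite exprVn -mulrA ler_pM2l // mulrC ler_pdivrMr // mulrC.
by rewrite -[_ * 4^-1]/(_ / 4).
Qed.

Lemma capacity_not_equiv : ~ (forall eps : R, 0 < eps ->
  asymp_equiv (fun T => capacity K (centred_itv (T + T `^ (1 - eps))))
    (fun T => capacity K (centred_itv T))).
Proof.
have eps0 : 0 < (4 * p%:R)^-1 :> R by rewrite invr_gt0 mulr_gt0 // ltr0n.
move=> /(_ _ eps0) H.
have /H[A [_ HA]] : nbhs (1%:E : \bar R) [set y | (y < 2%:E)%E].
  apply: open_nbhs_nbhs; split; last by rewrite /= lte_fin ltr1n.
  exact: open_ereal_lt_ereal.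
(* Large enough that T >= S_n / 4 >= n / 4 exceeds the threshold [A], and at least 2 for
   [gap_powR]. *)
pose n := maxn 2 (Num.truncn (4 * `|A|)).+1.
have n1 : (1 < n)%N by rewrite leq_max.
have nA : 4 * `|A| < n%:R.
  apply: (lt_le_trans (truncnS_gt (4 * `|A|))).
  by rewrite ler_nat leq_maxr.
have nS := scale_ge n.
have [T4 Tr] := gap_powR n1.
set T := S n / 2 - _ in T4 Tr.
have AT : A < T.
  by apply: lt_le_trans T4; have := ler_norm A; lra.
have := HA _ AT; rewrite /= ltNge => /negP; apply.
by apply: (@capacity_ratio n) => //; rewrite (ltn_trans _ n1).
Qed.

End capacity_ratio.

Section exponent.
Context {R : realType}.
Variables (p : nat) (u alpha : R).
Hypothesis p_gt0 : (0 < p)%N.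
Hypothesis u_rng : 0 < u <= 9^-1.
Hypothesis alpha_gt0 : 0 < alpha.
Hypothesis ln_u : 2 * ln u = - alpha * (p%:R * ln 3).

Let mu : {finite_measure set R -> \bar R} :=
  atomic_finite_measure (atom_freq p) (atom_mass_ge0 u_rng) (atom_mass_bound u_rng).

Local Notation S := (@scale R p).
Local Notation J n := (size (layout_prefix level n)).

Lemma scale_le : {homo S : m n / (m <= n)%N >-> m <= n}.
Proof. by move=> m n mn; rewrite ler_nat leq_exp2l // leq_mul2l leq_exp2r // mn orbT. Qed.

(** The first atom of level n + 1 sits at 1 / (2 S_(n+1)), inside the interval, while every atom of
    the levels up to n has modulus at least 1 / (2 S_n), outside it. *)
Lemma mu_bounds n delta : (2 * S n.+1)^-1 <= delta < (2 * S n)^-1 ->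
  u ^+ (2 * n.+1 ^ 2) <= fine (mu (centred_itv delta)) <= 2 * weight u n.+1.
Proof.
move=> /andP[d1 d2]; have S0 k := @scale_gt0 R p k.
have mufin : mu (centred_itv delta) \is a fin_num.
  by apply: fin_num_measure; exact: measurable_itv.
have x0 : (n.+1, 0, 0)%N \in level n.+1 by rewrite mem_level leq0n.
have [j jx] := layout_surj (0, 0, 0)%N level_gt0 x0.
have fj : atom_freq p j = (2 * S n.+1)^-1 by rewrite /atom_freq jx /freq /= mul1r.
have mj : atom_mass u j = u ^+ (2 * n.+1 ^ 2) by rewrite /atom_mass jx /mass /= expr0 mulr1.
have d0 : 0 < (2 * S n.+1)^-1 by rewrite invr_gt0 mulr_gt0.
apply/andP; split; rewrite -lee_fin fineK // -?mj.
  apply: atomic_measure_lb; rewrite /centred_itv /= in_itv /= fj; apply/andP; split; lra.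
apply: le_trans (_ : (limn (series (atom_mass u)) - series (atom_mass u) (J n.+1))%:E <= _)%E.
  apply: (atomic_measure_ub (M := 2 * weight u 0)) => [k|i iJ]; first exact: atom_mass_bound.
  have [k kn /levelP[i' [k' [_ _ lk]]]] := layout_lt (0, 0, 0)%N level_gt0 iJ.
  have : delta < atom_freq p i.
    apply: lt_le_trans d2 _; rewrite /atom_freq lk /freq /=.
    apply: (@le_trans _ _ (2 * S k)^-1).
      by rewrite lef_pV2 ?posrE ?mulr_gt0 // ler_pM2l // scale_le.
    have Sk : 0 <= (2 * S k)^-1 by rewrite ltW // invr_gt0 mulr_gt0.
    by rewrite ler_peMl // ler1n.
  move=> di; split; rewrite /centred_itv /= in_itv /= => /andP[a1 a2]; lra.
by rewrite lee_fin; exact: atom_mass_tail.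
Qed.

Lemma scale_bracket (delta : R) : 0 < delta < 2^-1 ->
  exists n, (2 * S n.+1)^-1 <= delta < (2 * S n)^-1.
Proof.
move=> /andP[d0 d1]; have S0 k := @scale_gt0 R p k.
have ex : exists n, (2 * S n)^-1 <= delta.
  exists (Num.truncn delta^-1).+1; rewrite -[leRHS]invrK lef_pV2 ?posrE ?invr_gt0 ?mulr_gt0 //.
  have := truncnS_gt delta^-1; have := @scale_ge R p p_gt0 (Num.truncn delta^-1).+1.
  by have := S0 (Num.truncn delta^-1).+1; lra.
case: (ex_minnP ex) => -[|n] dn nmin.
  by move: dn; rewrite /scale exp0n // muln0 expn0 mulr1; lra.
exists n; rewrite dn /= ltNge; apply/negP => /nmin.
by rewrite ltnn.
Qed.

Lemma ln_scale n : ln (S n) = (n ^ 2)%:R * (p%:R * ln 3).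
Proof. by rewrite /scale natrX lnXn // -[LHS]mulr_natl natrM; ring. Qed.

(** With b = p ln 3 and N = n + 2, the logarithm of the measure is - alpha b N^2 and that of delta
    is - b N^2, both up to O(N): ln S_n is quadratic in n and its increments are linear. The
    quotient is thus alpha + O(1/N). *)
Lemma log_ratio_bound n delta : (2 * S n.+2)^-1 <= delta < (2 * S n.+1)^-1 ->
  `|ln (fine (mu (centred_itv delta))) / ln delta - alpha| <=
    4 * (2 * alpha * (p%:R * ln 3) + 4 * ln 4 + alpha * ln 2) / (p%:R * ln 3) / n.+2%:R.
Proof.
move=> dn; have S0 k := @scale_gt0 R p k; have u0 := u_gt0 u_rng.
set b := p%:R * ln 3.
have b0 : 0 < b by rewrite mulr_gt0 ?ltr0n // ln_gt0 // ltr1n.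
have /andP[] := mu_bounds dn; have /andP[d1 d2] := dn; rewrite /weight.
set N : R := n.+2%:R; have N2 : 2 <= N by rewrite ler_nat.
have l20 : 0 < ln 2 :> R by rewrite ln_gt0 // ltr1n.
have l40 : 0 < ln 4 :> R by rewrite ln_gt0 // ltr1n.
have : 0 < u ^+ (2 * n.+2 ^ 2) by rewrite exprn_gt0.
have : ln (u ^+ (2 * n.+2 ^ 2)) = - alpha * b * N ^+ 2.
  by rewrite lnXn // -[LHS]mulr_natl natrM natrX mulrAC ln_u -/b -/N; ring.
move: (u ^+ (2 * n.+2 ^ 2)) => x ln_x x0.
have : 2 * (n.+2 ^ 2).+1%:R <= (4 ^ n.+2 * 4 ^ n.+2)%:R :> R.
  rewrite -natrM ler_nat; apply: leq_mul; last exact: ltn_sqr_expn4.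
  by rewrite expnS (@leq_trans 4) // leq_pmulr // expn_gt0.
have : ln (4 ^ n.+2 * 4 ^ n.+2)%:R = 2 * N * ln 4 :> R.
  rewrite natrM natrX lnM ?posrE ?exprn_gt0 // lnXn // -[_ *+ n.+2]mulr_natl -/N.
  by ring.
have : 0 < (4 ^ n.+2 * 4 ^ n.+2)%:R :> R by rewrite ltr0n muln_gt0 expn_gt0.
move: ((4 ^ n.+2 * 4 ^ n.+2)%:R : R) ((n.+2 ^ 2).+1%:R : R) => y z y0 ln_y zy.
set m := fine _ => m1 m2.
have m0 : 0 < m by exact: lt_le_trans m1.
have lm1 : - alpha * b * N ^+ 2 <= ln m by rewrite -ln_x ler_ln ?posrE.
have lm2 : ln m <= - alpha * b * N ^+ 2 + 2 * N * ln 4.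
  rewrite -ln_x -ln_y -lnM ?posrE // ler_ln ?posrE ?mulr_gt0 //.
  by apply: le_trans m2 _; rewrite mulrCA ler_pM2l.
have delta0 : 0 < delta by apply: lt_le_trans d1; rewrite invr_gt0 mulr_gt0.
have ld1 : - ln 2 - b * N ^+ 2 <= ln delta.
  have <- : ln (2 * S n.+2)^-1 = - ln 2 - b * N ^+ 2.
    rewrite lnV ?posrE ?mulr_gt0 // lnM ?posrE // ln_scale natrX -/b -/N; ring.
  by rewrite ler_ln ?posrE ?invr_gt0 ?mulr_gt0.
have ld2 : ln delta <= - ln 2 - b * (N - 1) ^+ 2.
  have <- : ln (2 * S n.+1)^-1 = - ln 2 - b * (N - 1) ^+ 2.
    rewrite lnV ?posrE ?mulr_gt0 // lnM ?posrE // ln_scale natrX -/b.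
    by rewrite (_ : N - 1 = n.+1%:R) ?/N -?natr1; ring.
  by rewrite ler_ln ?posrE ?invr_gt0 ?mulr_gt0 // ltW.
(* Brackets are taken from level 1 on so that N >= 2; then (N - 1)^2 is comparable to N^2 and -ln
   delta is bounded below. *)
have N1 : N ^+ 2 / 4 <= (N - 1) ^+ 2 by rewrite !expr2; nra.
have Y0 : b * (N ^+ 2 / 4) <= - ln delta.
  have : b * (N ^+ 2 / 4) <= b * (N - 1) ^+ 2 by rewrite ler_pM2l.
  by lra.
have bN0 : 0 < b * (N ^+ 2 / 4) by rewrite mulr_gt0 // divr_gt0 // exprn_gt0 //; lra.
have lnd0 : 0 < - ln delta by exact: lt_le_trans Y0.
have -> : ln m / ln delta - alpha = (ln m - alpha * ln delta) / ln delta.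
  by rewrite mulrBl mulfK // -oppr_eq0 lt0r_neq0.
rewrite normrM normfV -[X in _ / X]normrN (gtr0_norm lnd0) ler_pdivrMr //.
set c := 2 * alpha * b + 4 * ln 4 + alpha * ln 2.
have c0 : 0 < c.
  by rewrite /c; have := mulr_gt0 alpha_gt0 b0; have := mulr_gt0 alpha_gt0 l20; lra.
have num : `|ln m - alpha * ln delta| <= c * N.
  have p1 : 0 <= alpha * b by rewrite mulr_ge0 ?ltW.
  have p2 : 0 <= alpha * ln 2 by rewrite mulr_ge0 ?ltW.
  have a1 := ler_wpM2l (ltW alpha_gt0) ld1; have a2 := ler_wpM2l (ltW alpha_gt0) ld2.
  have -> : c * N = 2 * (alpha * b) * N + 4 * ln 4 * N + alpha * ln 2 * N by rewrite /c; ring.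
  have q1 : alpha * ln 2 <= alpha * ln 2 * N by rewrite ler_peMr //; lra.
  have q2 : 0 <= ln 4 * N :> R by rewrite mulr_ge0 ?ltW //; lra.
  have q3 : 0 <= alpha * b * N by rewrite mulr_ge0 //; lra.
  have e1 : alpha * (- ln 2 - b * N ^+ 2) = - (alpha * ln 2) - alpha * b * N ^+ 2 by ring.
  have e2 : alpha * (- ln 2 - b * (N - 1) ^+ 2) =
     - (alpha * ln 2) - alpha * b * N ^+ 2 + 2 * (alpha * b * N) - alpha * b by ring.
  rewrite ler_norml; apply/andP; split; lra.
apply: (le_trans num).
apply: (@le_trans _ _ (4 * c / b / N * (b * (N ^+ 2 / 4)))).
  by rewrite le_eqVlt; apply/orP; left; apply/eqP; field; rewrite !lt0r_neq0 //; lra.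
by rewrite ler_wpM2l // !mulr_ge0 ?invr_ge0 ?ltW //; lra.
Qed.

Lemma exponent_lim :
  ln (fine (mu (centred_itv delta))) / ln delta @[delta --> 0^'+] --> alpha.
Proof.
have b0 : 0 < p%:R * ln 3 :> R by rewrite mulr_gt0 ?ltr0n // ln_gt0 // ltr1n.
set b := p%:R * ln 3 in b0.
pose C := 4 * (2 * alpha * b + 4 * ln 4 + alpha * ln 2) / b.
have C0 : 0 < C.
  have l2 : 0 < ln 2 :> R by rewrite ln_gt0 // ltr1n.
  have l4 : 0 < ln 4 :> R by rewrite ln_gt0 // ltr1n.
  rewrite divr_gt0 // mulr_gt0 //.
  by have := mulr_gt0 alpha_gt0 b0; have := mulr_gt0 alpha_gt0 l2; lra.
apply/cvgrPdist_le => e e0.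
pose n0 := (Num.truncn (C / e)).+1; have S0 k := @scale_gt0 R p k.
near=> delta.
have d0 : 0 < delta by near: delta; exact: nbhs_right_gt.
have d1 : delta < (2 * S n0)^-1.
  by near: delta; apply: nbhs_right_lt; rewrite invr_gt0 mulr_gt0.
have d2 : delta < 2^-1.
  by near: delta; apply: nbhs_right_lt.
have d02 : 0 < delta < 2^-1 by rewrite d0.
have [n dn] := scale_bracket d02.
have n0n : (n0 <= n)%N.
  rewrite leqNgt; apply/negP => nn0; have /andP[dn1 _] := dn.
  have : (2 * S n0)^-1 <= (2 * S n.+1)^-1.
    by rewrite lef_pV2 ?posrE ?mulr_gt0 // ler_pM2l // scale_le.
  by move=> /le_trans /(_ dn1) /(lt_le_trans d1); rewrite ltxx.
case: n n0n dn => // n n0n dn.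
rewrite distrC; apply: le_trans (log_ratio_bound dn) _; rewrite -/b -/C.
rewrite ler_pdivrMr // mulrC -ler_pdivrMr // ltW //.
apply: lt_le_trans (truncnS_gt _) _; rewrite ler_nat.
exact: leq_trans n0n (leqnSn _).
Unshelve. all: by end_near. Qed.

End exponent.

(** * Non-degeneracy *)

Lemma vandermonde_inj (F : fieldType) n (w v : 'I_n -> F) : injective w ->
  (forall k, (k < n)%N -> \sum_(i < n) v i * w i ^+ k = 0) -> forall i, v i = 0.
Proof.
move=> w_inj sum0 i.
pose V := Vandermonde n (\row_i w i); pose c := \col_i v i.
have Vc : V *m c = 0.
  apply/matrixP => k j; rewrite !mxE -[RHS](sum0 k) //.
  by apply: eq_bigr => l _; rewrite !mxE mulrC.
have Vu : V \in unitmx.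
  rewrite unitmxE det_Vandermonde unitfE.
  apply/prodf_neq0 => k _; apply/prodf_neq0 => l kl.
  rewrite !mxE subr_eq0; apply: contraTneq kl => /w_inj ->.
  by rewrite ltnn.
have c0 : c = 0 by rewrite -[c](mulKmx Vu) Vc mulmx0.
by have := congr1 (fun M : 'cV_n => M i ord0) c0; rewrite !mxE.
Qed.

Section cexpi.
Context {R : realType}.
Implicit Types x y : R.

Lemma cexpiD x y : cexpi (x + y) = cexpi x * cexpi y.
Proof. by rewrite /cexpi cosD sinD; simpc; congr (_ +i* _)%C; ring. Qed.

Lemma cexpi_natM k x : cexpi (k%:R * x) = cexpi x ^+ k.
Proof.
elim: k => [|k IH]; first by rewrite mul0r /cexpi cos0 sin0.
by rewrite -natr1 mulrDl mul1r cexpiD IH exprSr.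
Qed.

Lemma cexpi_neq0 x : cexpi x != 0.
Proof.
apply/negP => /eqP[c0 s0]; have := cos2Dsin2 x.
by rewrite c0 s0 expr0n /= addr0 => /eqP; rewrite eq_sym oner_eq0.
Qed.

(** Equal values force cos(x - y) = 1, hence sin((x - y) / 2) = 0, and the half difference lies in
    ]-pi, pi[. *)
Lemma cexpi_inj x y : `|x - y| < 2 * pi -> cexpi x = cexpi y -> x = y.
Proof.
move=> xy [cxy sxy]; pose h := (x - y) / 2.
have hE : x - y = h *+ 2 by rewrite -mulr_natr /h; field.
have cos1 : cos (h *+ 2) = 1.
  by rewrite -hE cosB cxy sxy -!expr2 cos2Dsin2.
have s0 : sin h = 0.
  move: cos1; rewrite cos_mulr2n mulr2n; have := cos2Dsin2 h => cs e.
  by apply/eqP; rewrite -sqrf_eq0; apply/eqP; lra.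
have : - pi < h < pi by move: xy; rewrite ltr_norml /h => /andP[a b]; apply/andP; split; lra.
move=> /andP[h1 h2].
have [hn|hp|h0] := ltgtP h 0.
- have : 0 < sin (- h) by apply: sin_gt0_pi; apply/andP; split; lra.
  by rewrite sinN s0 oppr0 ltxx.
- have : 0 < sin h by apply: sin_gt0_pi; apply/andP; split.
  by rewrite s0 ltxx.
- by apply/eqP; rewrite -subr_eq0 hE h0 mul0rn.
Qed.

End cexpi.

Section level_separates.
Context {R : realType}.
Variable p : nat.
Hypothesis p_gt0 : (0 < p)%N.

(* At the frequencies of the last block of a high level q the vanishing of both
   coefficients is a Vandermonde system in the nodes exp(2 i pi t_l / S_q). *)
Lemma level_separates n (t c : 'I_n -> R) : injective t ->
  (forall j, cos_coef t c (atom_freq p j) = 0 /\ sin_coef t c (atom_freq p j) = 0) ->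
  forall i, c i = 0.
Proof.
move=> t_inj coef0 i.
(* q >= n provides at least n frequencies in the last block, and S_q > 2 |t_l| for all l keeps the
   angles 2 theta_l less than 2 pi apart, so that the nodes are distinct. *)
pose q := maxn n (Num.truncn (2 * \sum_(i < n) `|t i|)).+1.
have S0 := @scale_gt0 R p q.
have tS l : 2 * `|t l| < scale p q.
  apply: lt_le_trans (scale_ge p_gt0 q).
  apply: (@le_lt_trans _ _ (2 * \sum_(i < n) `|t i|)).
    by rewrite ler_pM2l // (bigD1 l) //= lerDl sumr_ge0.
  by apply: (lt_le_trans (truncnS_gt _)); rewrite ler_nat leq_maxr.
pose theta l : R := pi * t l / scale p q.
have theta_eq k l : 2 * pi * freq p (q, q ^ 2, k)%N * t l = k.*2.+1%:R * theta l.
  by rewrite /freq /theta /=; field; rewrite lt0r_neq0.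
(* As (2k+1) theta = theta + k (2 theta), a factor exp(i theta_l) moves into the unknowns and the
   k-th powers of the nodes remain. *)
have sum0 k : (k < n)%N -> \sum_(l < n) ((c l)%:C%C * cexpi (theta l)) * cexpi (2 * theta l) ^+ k = 0.
  move=> kn; have mem : (q, q ^ 2, k)%N \in level q.
    rewrite mem_level leqnn /=; apply: leq_trans kn _.
    apply: leq_trans (leq_maxl n _) _; apply: leq_trans (ltnW (ltn_expl q (isT : 1 < 2)%N)) _.
    by rewrite leq_exp2l // -mulnn; case: (q) => // m; rewrite leq_pmulr.
  have [j jx] := layout_surj (0, 0, 0)%N level_gt0 mem.
  have [] := coef0 j; rewrite /cos_coef /sin_coef /atom_freq jx => cs sn.
  have cs' : \sum_(l < n) c l * cos (k.*2.+1%:R * theta l) = 0.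
    by rewrite -[RHS]cs; apply: eq_bigr => l _; rewrite theta_eq.
  have sn' : \sum_(l < n) c l * sin (k.*2.+1%:R * theta l) = 0.
    by rewrite -[RHS]sn; apply: eq_bigr => l _; rewrite theta_eq.
  transitivity ((\sum_(l < n) c l * cos (k.*2.+1%:R * theta l)) +i*
                (\sum_(l < n) c l * sin (k.*2.+1%:R * theta l)))%C; last first.
    by rewrite cs' sn'.
  elim/big_ind3: _ => [//|x1 x2 x3 y1 y2 y3 -> -> //|l _].
  rewrite -cexpi_natM -mulrA -cexpiD.
  have -> : theta l + k%:R * (2 * theta l) = k.*2.+1%:R * theta l.
    by rewrite -[k.*2.+1%:R]natr1 -(mul2n k) natrM; ring.
  by rewrite /cexpi; simpc.
have w_inj : injective (fun l => cexpi (2 * theta l)).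
  move=> l l' /cexpi_inj ll; apply: t_inj.
  have pi0 := @pi_gt0 R.
  have close : `|2 * theta l - 2 * theta l'| < 2 * pi.
    have -> : 2 * theta l - 2 * theta l' = 2 * pi * ((t l - t l') / scale p q).
      by rewrite /theta; field; rewrite lt0r_neq0.
    rewrite normrM gtr0_norm ?mulr_gt0 // gtr_pMr ?mulr_gt0 //.
    rewrite normrM normfV (gtr0_norm S0) ltr_pdivrMr // mul1r.
    by apply: le_lt_trans (ler_normB _ _) _; have := tS l; have := tS l'; lra.
  have := ll close; rewrite /theta => e.
  have e2 : 2 * pi / scale p q != 0 :> R by rewrite lt0r_neq0 // !mulr_gt0 ?invr_gt0.
  have e3 x : 2 * pi / scale p q * x = 2 * (pi * x / scale p q).
    by field; rewrite lt0r_neq0.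
  by apply: (mulfI e2); rewrite !e3.
have /eqP := vandermonde_inj w_inj sum0 i.
by rewrite mulf_eq0 (negPf (cexpi_neq0 _)) orbF => /eqP[].
Qed.

End level_separates.

Section lacunary_process.
Context {R : realType}.
Variables (p : nat) (u : R).
Hypothesis p_gt0 : (0 < p)%N.
Hypothesis u_rng : 0 < u <= 9^-1.

Local Notation V := (@normal_var R).

Definition atom_amp j : R := Num.sqrt (atom_mass u j / V).

Lemma atom_amp_ge0 j : 0 <= atom_amp j. Proof. exact: sqrtr_ge0. Qed.

Lemma atom_amp_bound N : series atom_amp N <= 4 * Num.sqrt V^-1.
Proof.
have F0 n x : x \in level n -> 0 <= Num.sqrt (mass u x / V) by rewrite sqrtr_ge0.
apply: (@series_layout_le _ _ (0, 0, 0)%N _ level_gt0 _ F0 _ N) => N'.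
apply: (@le_trans _ _ (\sum_(0 <= n < N') \sum_(x <- level n)
    Num.sqrt (mass u x) * Num.sqrt V^-1)).
  rewrite le_eqVlt; apply/orP; left; apply/eqP.
  apply: eq_bigr => n _; apply: eq_bigr => x _.
  by rewrite sqrtrM // ltW // mass_gt0.
under eq_bigr do rewrite -mulr_suml.
by rewrite -mulr_suml ler_wpM2r ?sqrtr_ge0 // level_sqrt_sum.
Qed.

Lemma lacunary_cov_kernel :
  cov_kernel (process_rv (atom_freq p) atom_amp_ge0) =
  atomic_kernel (atom_mass u) (atom_freq p).
Proof.
have V0 := @normal_var_gt0 R.
apply/funext => x; rewrite (process_cov_kernel (atom_freq p) atom_amp_ge0 atom_amp_bound).
pose w j := atom_amp j ^+ 2 * cos (2 * pi * atom_freq p j * x).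
have wE j : atom_mass u j * cos (2 * pi * atom_freq p j * x) = V * w j.
  rewrite /w /atom_amp sqr_sqrtr ?divr_ge0 ?(ltW V0) ?atom_mass_ge0 //.
  by field; rewrite lt0r_neq0.
rewrite /atomic_kernel (_ : (fun j => atom_mass u j * _) = (fun j => V * w j)); last exact/funext.
have cm : cvgn (series (atom_mass u)).
  by apply: bounded_series_cvg (atom_mass_bound u_rng); exact: atom_mass_ge0.
have cw : cvgn (series w).
  apply: (@dominated_series_cvg _ _ (fun j => V^-1 * atom_mass u j)); last exact: is_cvg_seriesZ.
  move=> j; rewrite (_ : w j = V^-1 * (V * w j)); last by rewrite mulKf // lt0r_neq0.
  rewrite -wE normrM ger0_norm ?invr_ge0 ?(ltW V0) // ler_pM2l ?invr_gt0 //.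
  by rewrite normrM ger0_norm ?atom_mass_ge0 // ler_piMr ?atom_mass_ge0 // ler_norml cos_geN1 cos_le1.
by symmetry; apply: lim_seriesZ.
Qed.

Lemma lacunary_stationary :
  stationary_gaussian_process (process_rv (atom_freq p) atom_amp_ge0).
Proof.
apply: (@process_rv_stationary R atom_amp (atom_freq p) _ atom_amp_ge0 atom_amp_bound) => n t c t_inj [i ci].
apply: contrapT => no_j; move/eqP: ci; apply.
apply: (level_separates p_gt0 t_inj) => j.
have amp0 : 0 < atom_amp j.
  by rewrite sqrtr_gt0 divr_gt0 ?atom_mass_gt0 // normal_var_gt0.
by split; apply: contrapT => /eqP coef; apply: no_j; exists j => //; [left|right].
Qed.

End lacunary_process.

Theorem proposition1p7 (R : realType) (alpha : R) (halpha : 0 < alpha < 1) :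
  exists (d : measure_display) (Omega : measurableType d)
         (P : probability Omega R) (f : R -> {RV P >-> R})
         (mu : {finite_measure set R -> \bar R}),
    [/\ stationary_gaussian_process f,
        spectral_measure (cov_kernel f) mu,
        ln (fine (mu (centred_itv delta))) / ln delta
          @[delta --> 0^'+] --> alpha
      & ~ (forall eps : R, 0 < eps ->
             asymp_equiv
               (fun T => capacity (cov_kernel f)
                           (centred_itv (T + T `^ (1 - eps))))
               (fun T => capacity (cov_kernel f) (centred_itv T)))].
Proof.
have /andP[alpha0 _] := halpha.
pose p := (Num.truncn (4 / alpha)).+1.
have p4 : 4 <= p%:R * alpha by rewrite -ler_pdivrMr // ltW // truncnS_gt.
(* This is S_1^(-alpha/2), and [u <= 9^-1] is p alpha >= 4. *)
pose u : R := 3 `^ (- (p%:R * alpha / 2)).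
have ln_u : 2 * ln u = - alpha * (p%:R * ln 3) by rewrite /u ln_powR; field.
have u_rng : 0 < u <= 9^-1.
  rewrite powR_gt0 //=; apply: (@le_trans _ _ (3 `^ (- 2%:R))).
    by apply: ler_powR; [rewrite ler1n|lra].
  by rewrite powRN powR_mulrn // expr2 -natrM.
exists _, _, _, (process_rv (atom_freq p) (@atom_amp_ge0 R u)).
exists (atomic_finite_measure (atom_freq p) (atom_mass_ge0 u_rng) (atom_mass_bound u_rng)).
rewrite (lacunary_cov_kernel p u_rng); split.
- exact: lacunary_stationary.
- exact: spectral_atomic.
- exact: exponent_lim.
- exact: capacity_not_equiv.
Qed.
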